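(* Let $P=\lambda_0M_0+\sum_{i=1}^t\lambda_iM_i$ be a quasi-identity of $M_n$, where $M_0,\dots,M_t$ are noncommutative monomials in the $x_k$ and $\lambda_0,\dots,\lambda_t\in\mathcal C$. If $M_1,\dots,M_t$ are $M_n$-locally linearly independent, then $P$ is a consequence of the Cayley–Hamilton identity, i.e. $P\in(Q_n)$.
   Context: $F$ is a field of characteristic $0$, $n\ge1$, $M_n=M_n(F)$, $\mathcal C=F[x^{(k)}_{ij}:1\le i,j\le n,\ k\ge1]$, $X=\{x_1,x_2,\dots\}$ noncommuting; $\mathcal C\langle X\rangle$ is the free $\mathcal C$-algebra (quasi-polynomials). A quasi-identity vanishes when each $x_k$ is replaced by any $A_k=(a^{(k)}_{ij})\in M_n$ and each $x^{(k)}_{ij}$ by $a^{(k)}_{ij}$. $M_1,\dots,M_t$ are $M_n$-locally linearly independent if there exist matrices at which their values are linearly independent. Generic matrices $\xi_k=(x^{(k)}_{ij})\in M_n(\mathcal C)$; $\mathrm{tr}(x_{i_1}\cdots x_{i_r}):=\mathrm{tr}(\xi_{i_1}\cdots\xi_{i_r})\in\mathcal C$. $Q_n=\sum_{\sigma\in S_{n+1}}\epsilon_\sigma\phi_\sigma(x_1,\dots,x_n)$, where for $\sigma=(i_1,\dots,i_{k_1})\cdots(u_1,\dots,u_h)(s_1,\dots,s_k,n+1)$ (disjoint cycles, the one containing $n+1$ last) $\phi_\sigma=\mathrm{tr}(x_{i_1}\cdots x_{i_{k_1}})\cdots\mathrm{tr}(x_{u_1}\cdots x_{u_h})x_{s_1}\cdots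 x_{s_k}$. A T-ideal is an ideal of $\mathcal C\langle X\rangle$ closed under simultaneous substitutions $x_k\mapsto H_k$, $x^{(k)}_{ij}\mapsto\Phi(H_k)_{ij}$, with $\Phi$ the $\mathcal C$-algebra map $x_k\mapsto\xi_k$; $(Q_n)$ is the T-ideal generated by $Q_n$. *)

(* Defs.v *)
From HB Require Import structures.
From mathcomp Require Import all_boot all_order all_algebra all_fingroup.
Set Implicit Arguments. Unset Strict Implicit. Unset Printing Implicit Defensive.
Import GRing.Theory.
Local Open Scope ring_scope.

(* Convention: the variable index k : nat stands for x_{k+1}
   (resp. the commutative variable (k,i,j) for x^{(k+1)}_{ij}). *)

Section QuasiPoly.
Variables (F : fieldType) (n : nat).

Definition cvar := (nat * 'I_n * 'I_n)%type.
(* commutative monomial: a multiset of commutative variables (order irrelevant) *)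
Definition cmono := seq cvar.
Definition word := seq nat.
Definition qterm := (F * cmono * word)%type.
(* a quasi-polynomial, as a finite formal sum of terms *)
Definition quasipoly := seq qterm.

(* coefficient of the basis element (m, w) of C<X> over F *)
Definition qcoef (P : quasipoly) (m : cmono) (w : word) : F :=
  \sum_(t <- P | perm_eq t.1.2 m && (t.2 == w)) t.1.1.
Definition qeq (P Q : quasipoly) : Prop := forall m w, qcoef P m w = qcoef Q m w.

Definition qzero : quasipoly := [::].
Definition qconst (c : F) : quasipoly := [:: (c, [::], [::])].
Definition qone : quasipoly := qconst 1.
Definition qadd (P Q : quasipoly) : quasipoly := P ++ Q.
Definition qscale (c : F) (P : quasipoly) : quasipoly :=
  [seq (c * t.1.1, t.1.2, t.2) | t <- P].
Definition qmul (P Q : quasipoly) : quasipoly :=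
  [seq (s.1.1 * t.1.1, s.1.2 ++ t.1.2, s.2 ++ t.2) | s <- P, t <- Q].
Definition qword (w : word) : quasipoly := [:: (1, [::], w)].
Definition qsum (s : seq quasipoly) : quasipoly := foldr qadd qzero s.
Definition qprod (s : seq quasipoly) : quasipoly := foldr qmul qone s.

(* elements of C (inside C<X>): no noncommutative part *)
Definition is_coef (P : quasipoly) : bool := all (fun t => t.2 == [::]) P.

(* (i,j) entry of the product of generic matrices xi_{k1} ... xi_{kr},
   as a list of commutative monomials (summed) *)
Fixpoint gword (w : word) (i j : 'I_n) : seq cmono :=
  match w with
  | [::] => if i == j then [:: [::]] else [::]
  | k :: w' => flatten [seq [seq (k, i, l) :: m | m <- gword w' l j] | l <- enum 'I_n]
  end.

(* Phi(P)_{ij} in C, where Phi is the C-algebra map x_k |-> xi_k *)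
Definition qPhi (P : quasipoly) (i j : 'I_n) : quasipoly :=
  flatten [seq [seq (t.1.1, t.1.2 ++ m, [::]) | m <- gword t.2 i j] | t <- P].

Definition qtr (w : word) : quasipoly := qsum [seq qPhi (qword w) i i | i <- enum 'I_n].

Definition qsubst (H : nat -> quasipoly) (P : quasipoly) : quasipoly :=
  qsum [seq qscale t.1.1
          (qmul (qprod [seq qPhi (H v.1.1) v.1.2 v.2 | v <- t.1.2])
                (qprod [seq H k | k <- t.2])) | t <- P].

Definition wordval (A : nat -> 'M[F]_n) (w : word) : 'M[F]_n :=
  foldr (fun k M => A k *m M) 1%:M w.

Definition qeval (A : nat -> 'M[F]_n) (P : quasipoly) : 'M[F]_n :=
  \sum_(t <- P) (t.1.1 * \prod_(v <- t.1.2) A v.1.1 v.1.2 v.2) *: wordval A t.2.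

Definition quasi_identity (P : quasipoly) : Prop := forall A, qeval A P = 0.

Definition locally_lin_indep (t : nat) (Ms : 'I_t -> word) : Prop :=
  exists A : nat -> 'M[F]_n,
    forall c : 'I_t -> F, \sum_(i < t) c i *: wordval A (Ms i) = 0 -> forall i, c i = 0.

(* The Cayley-Hamilton quasi-polynomial Q_n.  Points of 'I_n.+1 below
   n (= ord_max) stand for x_1, ..., x_n (via the shift convention);
   ord_max plays the role of n+1. *)
Definition cycle_word (s : 'S_n.+1) (x : 'I_n.+1) : word :=
  [seq nat_of_ord y | y <- traject s x #|porbit s x|].

Definition phi_perm (s : 'S_n.+1) : quasipoly :=
  qmul (\big[qmul/qone]_(O in porbits s | ord_max \notin O)
           qtr (cycle_word s (odflt ord_max [pick x in O])))
       (qword [seq nat_of_ord y | y <- traject s (s ord_max) #|porbit s ord_max|.-1]).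

Definition Qn : quasipoly :=
  qsum [seq qscale ((-1) ^+ odd_perm s) (phi_perm s) | s <- enum 'S_n.+1].

Inductive in_TQn : quasipoly -> Prop :=
| TQ_gen : in_TQn Qn
| TQ_zero : in_TQn qzero
| TQ_add P Q : in_TQn P -> in_TQn Q -> in_TQn (qadd P Q)
| TQ_mul A P B : in_TQn P -> in_TQn (qmul (qmul A P) B)
| TQ_subst (H : nat -> quasipoly) P : in_TQn P -> in_TQn (qsubst H P)
| TQ_eq P Q : in_TQn P -> qeq P Q -> in_TQn Q.

End QuasiPoly.

(* Main.v *)
(** A relation between the words M_i has coefficients (lam_i) in a module of rank
    one over the polynomial ring C: local linear independence of M_1, ..., M_t
    determines the ratios lam_i / lam_0.  As C is factorial, this module is free on
    a generator mu, and lam = h mu.  Conjugating by g in GL_n preserves the module,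
    hence multiplies mu by a unit of C, i.e. by a scalar chi(g); the group relations
    force chi = 1 on transvections and on the matrices diag(1, .., s^n, .., 1), which
    is enough to conclude that the mu_i are invariants.  By Schur-Weyl duality (a
    double centralizer argument) they are polynomials in traces of words, so
    sum_i mu_i M_i is a trace identity.  After polarization it is an element of
    F[S_(m+1)] acting by 0 on the tensors of degree m+1; modulo antisymmetrizers of
    n+1 points every permutation is a combination of those without decreasing
    subsequence of length n+1, and the latter act independently.  Contracting an
    antisymmetrizer on n+1 points against words gives a multiple of a substitution
    instance v Q_n(H_1, .., H_n) u, or an expression whose coefficient in C vanishes
    because antisymmetrizing n+1 indices in dimension n gives 0. *)

Require Import Defs.
From HB Require Import structures.
From mathcomp Require Import all_boot all_order all_algebra all_fingroup.
From mathcomp Require Import fraction generic_quotient zify ring.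
From Stdlib Require Import Classical.
Set Implicit Arguments. Unset Strict Implicit. Unset Printing Implicit Defensive.
Import GRing.Theory.
Local Open Scope ring_scope.

(** Membership in the T-ideal is a statement about formal quasi-polynomials, while the hypothesis
    speaks of values on matrices of size n, where every consequence of Q_n vanishes and cannot be
    told apart from 0. A quasi-polynomial is therefore tested on pairs (A, B): its coefficients at
    A, its words at larger matrices B, the direct sum of A and the strictly upper triangular
    matrices of a path, which read off the coefficient of a single word. Such pairs separate
    quasi-polynomials, yet nonempty words have the same trace in A and in B. This is why the mu_i
    are wanted in trace form: an invariant of A written with traces can be evaluated at B, and
    coefficient and word merge into one element of a group algebra that acts in every size.

    The exponent in s^n comes from the scalar matrices, which conjugate trivially: they control only
    the n-th power of chi at diag(1, .., s, .., 1). Invariance under these infinitely many matrices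
    then passes to all diagonal ones by interpolation, whatever roots F contains. *)

Section InfiniteField.
Variable F : fieldType.
Hypothesis charF0 : [pchar F] =i pred0.

(** * Univariate polynomials over a field of characteristic zero *)

Lemma natrS_neq0 k : k.+1%:R != 0 :> F.
Proof. by move/pcharf0P: charF0 => ->. Qed.

Lemma natr_inj_pchar0 : injective (fun k : nat => k%:R : F).
Proof.
move=> i j; wlog le_ij : i j / (i <= j)%N.
  by move=> th; case/orP: (leq_total i j) => h e; [|symmetry]; apply: th.
move=> e; have := subnKC le_ij; case: (j - i)%N => [|k] Ek.
  by rewrite -Ek addn0.
have /addrI /esym/eqP : i%:R + 0 = i%:R + k.+1%:R :> F by rewrite addr0 -natrD Ek.
by rewrite (negPf (natrS_neq0 k)).
Qed.

Lemma poly_fun_eq0_infinite (p : {poly F}) (f : nat -> F) :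
  injective f -> (forall k, p.[f k] = 0) -> p = 0.
Proof.
move=> injf p0; apply/eqP; apply: contraT => nz.
have := @max_poly_roots _ p [seq f k | k <- iota 0 (size p)] nz.
rewrite size_map size_iota ltnn; apply.
  by apply/allP=> _ /mapP[k _ ->]; rewrite /root p0.
by rewrite map_inj_uniq ?iota_uniq.
Qed.

Lemma poly_fun_eq0 (p : {poly F}) : (forall s, p.[s] = 0) -> p = 0.
Proof. by move=> p0; apply: (poly_fun_eq0_infinite natr_inj_pchar0). Qed.

(** * Polynomials as lists of terms *)

Section ListPolynomials.
Variable V : eqType.
Implicit Types (x : V -> F) (L : seq (F * seq V)) (m : seq V) (f : (V -> F) -> F).

Definition pev x L : F := \sum_(t <- L) t.1 * \prod_(v <- t.2) x v.

Lemma eq_pev x y L : x =1 y -> pev x L = pev y L.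
Proof.
by move=> exy; apply: eq_bigr => t _; congr (_ * _); apply: eq_bigr => v _.
Qed.

(** Induction on a list of the variables that occur. With the other values fixed, the function is a
    univariate polynomial in v with infinitely many zeros; its coefficient of degree [count_mem v m]
    vanishes and is again a list polynomial, in fewer variables. *)
Lemma pev_eq0_coef L :
  (forall x, pev x L = 0) -> forall m, \sum_(t <- L | perm_eq t.2 m) t.1 = 0.
Proof.
have [vs] : exists vs : seq V, forall t, t \in L -> {subset t.2 <= vs}.
  exists (flatten [seq t.2 | t <- L]) => t tL v vt.
  by apply/flatten_mapP; exists t.
elim: vs L => [|v vs IH] L Lvs L0 m.
  have L1 t : t \in L -> t.2 = [::].
    by move=> /Lvs; case: t.2 => // v s /(_ v (mem_head _ _)).
  have := L0 (fun=> 0); rewrite /pev; case: m => [|v m] E; last first.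
    rewrite big_seq_cond big1 // => t /andP[tL].
    by rewrite (L1 t tL) => /perm_size.
  rewrite -[RHS]E [LHS]big_seq_cond [RHS]big_seq_cond; apply: eq_big => t.
    by case: (boolP (t \in L)) => // tL; rewrite (L1 t tL).
  by case/andP=> tL _; rewrite (L1 t tL) big_nil mulr1.
pose k := count_mem v m.
pose L' := [seq (t.1, filter (predC1 v) t.2) | t <- L & count_mem v t.2 == k].
have L'vs t : t \in L' -> {subset t.2 <= vs}.
  case/mapP=> t'; rewrite mem_filter => /andP[_ tL] -> u /=.
  by rewrite mem_filter /= => /andP[nuv /(Lvs _ tL)]; rewrite inE (negPf nuv).
have L'0 x : pev x L' = 0.
  pose p : {poly F} := \sum_(t <- L)
    (t.1 * \prod_(u <- t.2 | u != v) x u)%:P * 'X^(count_mem v t.2).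
  have p0 : p = 0.
    apply: poly_fun_eq0 => s; rewrite /p horner_sum.
    rewrite -[RHS](L0 (fun u => if u == v then s else x u)).
    apply: eq_bigr => t _; rewrite hornerM hornerC hornerXn -mulrA.
    congr (_ * _); rewrite [RHS](bigID (pred1 v)) /= mulrC; congr (_ * _).
      rewrite (eq_bigr (fun=> s)) => [|u /eqP->]; last by rewrite eqxx.
      by rewrite big_const_seq iter_mulr mulr1.
    by apply: eq_bigr => u /negPf->.
  have := congr1 (fun q : {poly F} => q`_k) p0; rewrite coef0 => <-.
  rewrite /p coef_sum /pev /L' big_map big_filter big_mkcond /=.
  apply: eq_bigr => t _; rewrite coefCM coefXn eq_sym big_filter.
  by case: eqP => _; rewrite ?mulr1 ?mulr0.
rewrite -[RHS](IH L' L'vs L'0 (filter (predC1 v) m)) /L' big_map /= big_filter_cond.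
apply: eq_bigl => t; apply/idP/andP => [pe|[/eqP ek pe]].
  by split; [rewrite /k; move/seq.permP: pe => -> | apply: perm_filter].
apply/allP=> u _ /=; apply/eqP; case: (eqVneq u v) => [->//|nuv].
move/seq.permP: pe => /(_ (pred1 u)); rewrite !count_filter => e.
have eu s : count (predI (pred1 u) (predC1 v)) s = count_mem u s.
  by apply: eq_count => w /=; case: eqP => //= ->.
by move: e; rewrite !eu.
Qed.

End ListPolynomials.

(** The sum over permutations is the coefficient of the multilinear monomial s_1 ... s_m. Forms of
    degree m evaluated at sums of m matrices with weights s_i have the shape required by the
    hypothesis. *)
Lemma polarization_multilinear (m : nat) (G : {ffun 'I_m -> 'I_m} -> F) :
  (forall s : 'I_m -> F, \sum_f G f * \prod_j s (f j) = 0) ->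
  \sum_(t : 'S_m) G [ffun j => t j] = 0.
Proof.
move=> G0; pose L := [seq (G f, [seq f j | j <- enum 'I_m]) | f <- enum {ffun 'I_m -> 'I_m}].
have L0 x : pev x L = 0.
  rewrite /pev big_map big_enum -[RHS](G0 x); apply: eq_bigr => f _ /=.
  by rewrite big_map big_enum.
rewrite -[RHS](pev_eq0_coef L0 (enum 'I_m)) /L big_map /= big_enum_cond /=.
rewrite [RHS](reindex_onto (fun t : 'S_m => [ffun j => t j])
  (fun f => insubd (1%g : 'S_m) f)) /=; last first.
  move=> f pe; rewrite -{2}(_ : pval (insubd (1%g : 'S_m) f) = f).
    by apply/ffunP=> j; rewrite ffunE pvalE.
  apply: insubdK; rewrite unfold_in.
  by have := perm_uniq pe; rewrite enum_uniq.
apply: eq_bigl => t; symmetry; apply/andP; split.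
  apply: uniq_perm; [|exact: enum_uniq|].
    rewrite map_inj_in_uniq ?enum_uniq // => i j _ _; rewrite !ffunE; exact: perm_inj.
  move=> i; rewrite mem_enum; apply/mapP; exists (t^-1%g i); rewrite ?mem_enum //.
  by rewrite ffunE permKV.
apply/eqP/permP => j; rewrite -pvalE insubdK ?ffunE // unfold_in.
by apply/injectiveP => a b; rewrite !ffunE; exact: perm_inj.
Qed.

(** * Polynomial functions in a finite list of variables *)

Section PolynomialFunctions.
Variables (V : eqType) (vs : seq V).
Implicit Types (x y : V -> F) (f g : (V -> F) -> F).

(** Functions rather than lists of terms: lists represent polynomials in many ways, whereas over an
    infinite field the function determines the polynomial. *)
Definition polyfun f := exists L : seq (F * seq V),
  (forall t, t \in L -> {subset t.2 <= vs}) /\ forall x, f x = pev x L.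

Lemma polyfun_ext f g : f =1 g -> polyfun f -> polyfun g.
Proof. by move=> e [L [Lvs E]]; exists L; split=> // x; rewrite -e. Qed.

Lemma polyfun_const c : polyfun (fun=> c).
Proof.
exists [:: (c, [::])]; split=> [t|x]; first by rewrite inE => /eqP ->.
by rewrite /pev big_seq1 big_nil mulr1.
Qed.

Lemma polyfun_var v : v \in vs -> polyfun (fun x => x v).
Proof.
move=> vin; exists [:: (1, [:: v])]; split=> [t|x].
  by rewrite inE => /eqP -> u /=; rewrite inE => /eqP ->.
by rewrite /pev !big_seq1 mul1r.
Qed.

Lemma polyfun_add f g : polyfun f -> polyfun g -> polyfun (fun x => f x + g x).
Proof.
move=> [L [Lvs E]] [L' [Lvs' E']]; exists (L ++ L'); split=> [t|x].
  by rewrite mem_cat => /orP[/Lvs|/Lvs'].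
by rewrite E E' /pev big_cat.
Qed.

Lemma polyfun_mul f g : polyfun f -> polyfun g -> polyfun (fun x => f x * g x).
Proof.
move=> [L [Lvs E]] [L' [Lvs' E']].
exists [seq (s.1 * t.1, s.2 ++ t.2) | s <- L, t <- L']; split=> [t|x].
  case/allpairsP=> -[s u] [/= sL uL ->] v /=; rewrite mem_cat.
  by case/orP; [apply: Lvs | apply: Lvs'].
rewrite E E' /pev big_allpairs_dep /= big_distrlr /=.
apply: eq_bigr => s _; apply: eq_bigr => u _.
by rewrite big_cat /= mulrACA.
Qed.

Lemma polyfun_sum (I : Type) (r : seq I) (P : pred I) (f : I -> (V -> F) -> F) :
  (forall i, polyfun (f i)) -> polyfun (fun x => \sum_(i <- r | P i) f i x).
Proof.
move=> pf; elim: r => [|i r IH].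
  by apply: (polyfun_ext _ (polyfun_const 0)) => x; rewrite big_nil.
case: (boolP (P i)) => Pi.
  by apply: (polyfun_ext _ (polyfun_add (pf i) IH)) => x; rewrite big_cons Pi.
by apply: (polyfun_ext _ IH) => x; rewrite big_cons (negPf Pi).
Qed.

Lemma polyfun_prod (I : Type) (r : seq I) (P : pred I) (f : I -> (V -> F) -> F) :
  (forall i, polyfun (f i)) -> polyfun (fun x => \prod_(i <- r | P i) f i x).
Proof.
move=> pf; elim: r => [|i r IH].
  by apply: (polyfun_ext _ (polyfun_const 1)) => x; rewrite big_nil.
case: (boolP (P i)) => Pi.
  by apply: (polyfun_ext _ (polyfun_mul (pf i) IH)) => x; rewrite big_cons Pi.
by apply: (polyfun_ext _ IH) => x; rewrite big_cons (negPf Pi).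
Qed.

Lemma polyfun_comp (h : (V -> F) -> V -> F) f :
  (forall v, v \in vs -> polyfun (fun x => h x v)) -> polyfun f ->
  polyfun (fun x => f (h x)).
Proof.
move=> ph [L [Lvs E]].
have : polyfun (fun x => \sum_(t <- L) t.1 *
    \prod_(v <- t.2) (if v \in vs then h x v else 0)).
  apply: polyfun_sum => t; apply: polyfun_mul; first exact: polyfun_const.
  apply: polyfun_prod => v; case: (boolP (v \in vs)) => [/ph //|_]; exact: polyfun_const.
apply: polyfun_ext => x; rewrite E /pev [LHS]big_seq [RHS]big_seq.
apply: eq_bigr => t tL; congr (_ * _); rewrite [LHS]big_seq [RHS]big_seq.
by apply: eq_bigr => v vt; rewrite (Lvs _ tL).
Qed.

Lemma polyfun_line f x y : polyfun f ->
  exists p : {poly F}, forall s, p.[s] = f (fun v => x v + s * y v).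
Proof.
case=> L [_ E].
exists (\sum_(t <- L) t.1%:P * \prod_(v <- t.2) ((x v)%:P + 'X * (y v)%:P)) => s.
rewrite E horner_sum; apply: eq_bigr => t _; rewrite hornerM hornerC horner_prod.
by congr (_ * _); apply: eq_bigr => v _; rewrite hornerD hornerC hornerM hornerX hornerC.
Qed.

(** On the line from a to b both functions become univariate polynomials, and that of f is nonzero
    because f a <> 0; so that of g is zero, in particular at b. *)
Lemma polyfun_cancel f g : polyfun f -> polyfun g ->
  (forall x, f x * g x = 0) -> (exists x, f x != 0) -> forall x, g x = 0.
Proof.
move=> pf pg fg0 [a fa] b.
have [p Ep] := polyfun_line a (fun v => b v - a v) pf.
have [q Eq] := polyfun_line a (fun v => b v - a v) pg.
have at0 : (fun v => a v + 0 * (b v - a v)) =1 a by move=> v; rewrite mul0r addr0.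
have at1 : (fun v => a v + 1 * (b v - a v)) =1 b by move=> v; rewrite mul1r addrC subrK.
have fe h x y : polyfun h -> x =1 y -> h x = h y.
  by case=> L [_ E] e; rewrite !E; apply: eq_pev.
have /eqP : p * q = 0 by apply: poly_fun_eq0 => s; rewrite hornerM Ep Eq fg0.
rewrite mulf_eq0 => /orP[/eqP p0|/eqP q0].
  by move: fa; rewrite -(fe _ _ _ pf at0) -Ep p0 horner0 eqxx.
by rewrite -(fe _ _ _ pg at1) -Eq q0 horner0.
Qed.

(** Restricted to the line from a to b, f becomes a unit of [{poly F}], hence a constant. *)
Lemma polyfun_unit_const f g : polyfun f -> polyfun g ->
  (forall x, f x * g x = 1) -> forall a b, f a = f b.
Proof.
move=> pf pg fg1 a b.
have [p Ep] := polyfun_line a (fun v => b v - a v) pf.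
have [q Eq] := polyfun_line a (fun v => b v - a v) pg.
have at0 : (fun v => a v + 0 * (b v - a v)) =1 a by move=> v; rewrite mul0r addr0.
have at1 : (fun v => a v + 1 * (b v - a v)) =1 b by move=> v; rewrite mul1r addrC subrK.
have fe h x y : polyfun h -> x =1 y -> h x = h y.
  by case=> L [_ E] e; rewrite !E; apply: eq_pev.
have pq1 : p * q = 1.
  apply/eqP; rewrite -subr_eq0; apply/eqP; apply: poly_fun_eq0 => s.
  by rewrite hornerD hornerN hornerM Ep Eq fg1 hornerC subrr.
have : p \is a GRing.unit by apply/unitrPr; exists q.
rewrite poly_unitE => /andP[/size_poly1P[c _ pc] _].
by rewrite -(fe _ _ _ pf at0) -(fe _ _ _ pf at1) -!Ep pc !hornerC.
Qed.

End PolynomialFunctions.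
End InfiniteField.

(** * Proportional families over a polynomial ring *)

Definition proportional (R : pzRingType) (I : Type) (a b : I -> R) :=
  forall i j, a i * b j = a j * b i.

(* For a UFD this says that a saturated submodule of rank one of a free module
   is free; unlike unique factorization, it passes directly to polynomials. *)
Definition rank_one_free (R : idomainType) := forall (I : finType) (a : I -> R),
  (exists i, a i != 0) ->
  exists mu : I -> R, forall b, proportional a b -> exists k, forall i, b i = k * mu i.

Lemma rank_one_free_field (F : fieldType) : rank_one_free F.
Proof.
move=> I a [i0 nz]; exists (fun i => a i / a i0) => b ab.
by exists (b i0) => i; apply: (mulfI nz); rewrite ab mulrCA mulrC [a i0 * _]mulrC divfK.
Qed.

Lemma bezout_family (K : fieldType) (I : finType) (f : I -> {poly K}) :
  exists (g : {poly K}) (u : I -> {poly K}),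
    (forall i, g %| f i) /\ g = \sum_i u i * f i.
Proof.
suff H (l : seq I) : exists (g : {poly K}) (u : I -> {poly K}),
    (forall i, i \in l -> g %| f i) /\ g = \sum_i u i * f i.
  by have [g [u [gl E]]] := H (enum I); exists g, u; split=> // i; rewrite gl ?mem_enum.
elim: l => [|i l [g [u [gl E]]]].
  by exists 0, (fun=> 0); split=> //; rewrite big1 // => i _; rewrite mul0r.
have [[w1 w2] /= Ew] := Bezoutp (f i) g.
exists (w1 * f i + w2 * g), (fun j => w1 * (j == i)%:R + w2 * u j); split.
  move=> j; rewrite inE (eqp_dvdl _ Ew) => /orP[/eqP->|/gl]; first exact: dvdp_gcdl.
  by apply: dvdp_trans; apply: dvdp_gcdr.
rewrite {1}E mulr_sumr (bigD1 i) //= [in RHS](bigD1 i) //= eqxx mulr1.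
rewrite mulrDl -!addrA mulrA; congr (_ + (_ + _)); apply: eq_bigr => j /negPf->.
by rewrite mulr0 add0r mulrA.
Qed.

Section Gauss.
Variables (R : idomainType) (I : finType).

Definition dvr (r x : R) := exists y, x = r * y.

Lemma dvr0 r : dvr r 0. Proof. by exists 0; rewrite mulr0. Qed.
Lemma dvrD r x y : dvr r x -> dvr r y -> dvr r (x + y).
Proof. by move=> [u ->] [v ->]; exists (u + v); rewrite mulrDr. Qed.
Lemma dvrN r x : dvr r x -> dvr r (- x).
Proof. by move=> [u ->]; exists (- u); rewrite mulrN. Qed.
Lemma dvrMl r x y : dvr r x -> dvr r (y * x).
Proof. by move=> [u ->]; exists (y * u); rewrite mulrCA. Qed.
Lemma dvr_sum r (J : Type) (s : seq J) (P : pred J) (f : J -> R) :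
  (forall i, P i -> dvr r (f i)) -> dvr r (\sum_(i <- s | P i) f i).
Proof. by move=> H; elim/big_ind: _ => //; [exact: dvr0 | exact: dvrD]. Qed.

(* McCoy's theorem in R / r. *)
Lemma mccoy (r : R) (g : I -> {poly R}) (f : {poly R}) :
  (forall i j, dvr r (f * g i)`_j) -> ~ (forall j, dvr r f`_j) ->
  exists x, ~ dvr r x /\ forall i j, dvr r (x * (g i)`_j).
Proof.
have [s] := ubnP (size f); elim: s f => // s IH f; rewrite ltnS => sf fg nf.
(* If every coefficient of every g i kills f modulo r, any coefficient of f not divisible by r
   serves as x. *)
case: (classic (forall i j l, dvr r ((g i)`_j * f`_l))) => [all|].
  have [l nl] := not_all_ex_not _ _ nf.
  by exists f`_l; split=> // i j; rewrite mulrC.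
move=> /not_all_ex_not[i nall].
(* Take the largest j for which (g i)_j does not kill f modulo r. In degree deg f + j of f * g i all
   the other products are then divisible by r, so (g i)_j kills the leading coefficient of f. Hence
   (g i)_j f without its leading term satisfies the hypotheses with smaller size. *)
have [j [nj jmax]] : exists j, ~ (forall l, dvr r ((g i)`_j * f`_l)) /\
    forall j', (j < j')%N -> forall l, dvr r ((g i)`_j' * f`_l).
  have [j0 nj0] := not_all_ex_not _ _ nall.
  have : forall d j1, (size (g i) <= j1 + d)%N -> ~ (forall l, dvr r ((g i)`_j1 * f`_l)) ->
    exists j, ~ (forall l, dvr r ((g i)`_j * f`_l)) /\
      forall j', (j < j')%N -> forall l, dvr r ((g i)`_j' * f`_l).
    elim=> [|d IHd] j1 sj nj1.
      case: nj1 => l; rewrite addn0 in sj; rewrite nth_default // mul0r; exact: dvr0.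
    case: (classic (forall j', (j1 < j')%N -> forall l, dvr r ((g i)`_j' * f`_l))).
      by move=> ?; exists j1.
    move=> /not_all_ex_not[j2 n2]; have [lt nj2] := imply_to_and _ _ n2.
    by apply: (IHd j2) => //; apply: leq_trans sj _; rewrite addnS -addSn leq_add2r.
  by move/(_ (size (g i)) j0); apply=> //; rewrite leq_addl.
have nz : f != 0.
  by apply: contra_not_neq nj => -> l; rewrite coef0 mulr0; apply: dvr0.
have lead : dvr r ((g i)`_j * lead_coef f).
  have := fg i ((size f).-1 + j)%N; rewrite coefM.
  have jlt : ((size f).-1 < ((size f).-1 + j).+1)%N by rewrite ltnS leq_addr.
  rewrite (bigD1 (Ordinal jlt)) //= addKn => d1.
  have d2 : dvr r (\sum_(i0 < ((size f).-1 + j).+1 | i0 != Ordinal jlt)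
      f`_i0 * (g i)`_((size f).-1 + j - i0)).
    apply: dvr_sum => k nk; case: (ltnP k (size f).-1) => hk.
      rewrite mulrC; apply: jmax.
      by rewrite ltn_subRL ltn_add2r.
    rewrite nth_default ?mul0r; first exact: dvr0.
    have : (k : nat) != (size f).-1 by apply: contraNneq nk => e; apply/eqP/val_inj.
    rewrite eq_sym => h; have /prednK E : (0 < size f)%N by rewrite size_poly_gt0.
    by apply: (leq_trans (eq_leq (esym E))); rewrite ltn_neqAle h.
  have := dvrD d1 (dvrN d2); rewrite addrK mulrC; exact.
pose f' : {poly R} := (g i)`_j *: (f - lead_coef f *: 'X^((size f).-1)).
have cf' l : f'`_l = (g i)`_j * f`_l - (l == (size f).-1)%:R * ((g i)`_j * lead_coef f).
  rewrite /f' coefZ coefB coefZ coefXn mulrBr; congr (_ - _).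
  by rewrite [RHS]mulrC mulrA.
apply: (IH f').
- apply: leq_trans sf; rewrite -(prednK (n := size f)) ?size_poly_gt0 // ltnS.
  apply/leq_sizeP=> l hl; rewrite /f' coefZ coefB coefZ coefXn.
  move: hl; rewrite leq_eqVlt => /orP[/eqP <-|lt].
    by rewrite eqxx mulr1 subrr mulr0.
  have /prednK E : (0 < size f)%N by rewrite size_poly_gt0.
  have fl : f`_l = 0 by apply: nth_default; rewrite -E.
  by rewrite gtn_eqF // mulr0 subr0 fl mulr0.
- move=> i' l.
  have -> : f' * g i' = (g i)`_j *: (f * g i') -
      ((g i)`_j * lead_coef f) *: ('X^((size f).-1) * g i').
    by rewrite /f' -!scalerAl mulrBl scalerBr -scalerAl scalerA.
  rewrite coefB !coefZ; apply: dvrD; first exact/dvrMl/fg.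
  by apply: dvrN; rewrite mulrC; apply: dvrMl.
- move=> H; apply: nj => l; have := H l; rewrite cf' => h.
  have := dvrD h (dvrMl (l == (size f).-1)%:R lead); by rewrite subrK.
Qed.

End Gauss.

Local Notation "x %:F" := (FracField.tofrac x) (at level 1, format "x %:F").

Lemma common_denominator (R : idomainType) (J : finType) (f : J -> {fraction R}) :
  exists r : R, r != 0 /\ exists h : J -> R, forall j, r%:F * f j = (h j)%:F.
Proof.
have den (x : {fraction R}) : exists r : R, r != 0 /\ exists h, r%:F * x = h%:F.
  elim/quotW: x => x; exists \d_x; split; first exact: denom_ratioP; exists \n_x.
  unlock FracField.tofrac; rewrite -[LHS]FracField.pi_mul; apply/eqmodP => /=.
  rewrite /FracField.equivf /FracField.mulf !numden_Ratio ?(oner_neq0, mulf_neq0, denom_ratioP) //.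
  by rewrite mulr1 !mul1r mulrC.
suff [r [nz H]] : exists r : R, r != 0 /\
    forall j, j \in enum J -> exists h, r%:F * f j = h%:F.
  exists r; split=> //.
  apply: (@fin_all_exists J (fun=> R) (fun j h => r%:F * f j = h%:F)) => j.
  by apply: H; rewrite mem_enum.
elim: (enum J) => [|j l [r [nz H]]]; first by exists 1; split=> //; apply: oner_neq0.
have [r' [nz' [h' E']]] := den (f j).
exists (r * r'); split=> [|i]; first exact: mulf_neq0.
rewrite inE => /orP[/eqP->|/H[h E]].
  by exists (r * h'); rewrite !tofracM -mulrA E'.
by exists (r' * h); rewrite !tofracM mulrAC E mulrC.
Qed.

(** Gauss's lemma for families. Over the fraction field, Bezout makes every family proportional to a
    a polynomial multiple of m = a / g. Clearing denominators and dividing out the content of all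
    coefficients gives mu, and McCoy's theorem shows that the multipliers with respect to mu already
    lie in R[X]. *)
Lemma rank_one_free_poly (R : idomainType) : rank_one_free R -> rank_one_free {poly R}.
Proof.
move=> SR I a [i0 nza]; pose tf := map_poly (@FracField.tofrac R).
have tf_inj : injective tf.
  by apply: map_inj_poly => [x y /eqP|]; [rewrite tofrac_eq => /eqP | exact: tofrac0].
have [g [u [gdv Eg]]] := bezout_family (fun i => tf (a i)).
have [m Em] : exists m : I -> {poly {fraction R}}, forall i, tf (a i) = m i * g.
  apply: (@fin_all_exists I (fun=> {poly {fraction R}}) (fun i m => tf (a i) = m * g)).
  by move=> i; exists (tf (a i) %/ g); rewrite divpK.
have tf0 : tf 0 = 0 by rewrite /tf rmorph0.
have nzg : g != 0.
  apply: contraNneq nza => g0; apply/eqP/tf_inj.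
  by rewrite tf0 Em g0 mulr0.
have gen (b : I -> {poly R}) : proportional a b ->
    exists k, forall i, tf (b i) = k * m i.
  move=> ab; exists (\sum_i u i * tf (b i)) => j; apply: (mulIf nzg).
  rewrite -mulrA -Em {1}Eg mulr_sumr mulr_suml; apply: eq_bigr => i _.
  by rewrite mulrCA -!mulrA; congr (_ * _); rewrite /tf -!rmorphM mulrC ab mulrC.
pose d := (\max_i size (m i))%N.
have md i l : (d <= l)%N -> (m i)`_l = 0.
  by move=> h; apply: nth_default; apply: leq_trans h; apply: (leq_bigmax i).
have [r [nzr [h Eh]]] := common_denominator (fun ij : I * 'I_d => (m ij.1)`_ij.2).
have [ij0 nzh] : exists ij, h ij != 0.
  have [l nzl] : exists l, (m i0)`_l != 0.
    exists (size (m i0)).-1; rewrite -/(lead_coef _) lead_coef_eq0.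
    apply: contraNneq nza => m0; apply/eqP/tf_inj; by rewrite tf0 Em m0 mul0r.
  have ld : (l < d)%N by rewrite ltnNge; apply: contra nzl => /md->.
  exists (i0, Ordinal ld); rewrite -tofrac_eq0 -Eh mulf_neq0 //.
  by rewrite tofrac_eq0.
(* All coefficients of all the m i, cleared of denominators, form a single family over R; passing to
   its generator replaces division by the content. *)
have [nu genu] := SR _ h (ex_intro _ ij0 nzh).
have [k0 Ek0] := genu h (fun i j => mulrC _ _).
have nzk0 : k0 != 0 by apply: contraNneq nzh => e; rewrite Ek0 e mul0r.
have nznu : nu ij0 != 0 by apply: contraNneq nzh => e; rewrite Ek0 e mulr0.
pose mu i : {poly R} := \poly_(l < d) (if insub l is Some l' then nu (i, l') else 0).
have Emu i (l : 'I_d) : (mu i)`_l = nu (i, l).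
  by rewrite coef_poly ltn_ord; case: insubP => [l' _ /val_inj->|]; rewrite ?ltn_ord.
have Emm i : r%:F *: m i = k0%:F *: tf (mu i).
  apply/polyP=> l; rewrite !coefZ coef_map.
  case: (ltnP l d) => hl; last by rewrite md // coef_poly ltnNge hl /= tofrac0 !mulr0.
  by rewrite (Emu i (Ordinal hl)) -tofracM -Ek0 -Eh.
exists mu => b ab; have [k Ek] := gen b ab.
have [k' Ek'] : exists k', forall i, tf (b i) = k' * tf (mu i).
  exists ((k0%:F / r%:F) *: k) => i; rewrite Ek -scalerAl [k0%:F / _]mulrC -scalerA.
  by rewrite scalerAr -Emm -scalerAr scalerA mulVf ?tofrac_eq0 // scale1r.
have [r' [nzr' [h' Eh']]] :=
  common_denominator (fun l : 'I_(size k') => k'`_l).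
pose kap : {poly R} := \poly_(l < size k') (if insub l is Some l' then h' l' else 0).
have Ekap : r'%:F *: k' = tf kap.
  apply/polyP=> l; rewrite coefZ coef_map coef_poly.
  case: (ltnP l (size k')) => hl; last first.
    rewrite [k'`_l]nth_default // mulr0; exact: esym (tofrac0 R).
  case: insubP => [l' _ El|]; last by rewrite hl.
  by apply: etrans (Eh' l'); rewrite El.
have Eb i : r' *: b i = kap * mu i.
  apply: tf_inj; rewrite /tf rmorphM /= -/tf -Ekap -scalerAl -Ek'.
  by apply/polyP=> l; rewrite coefZ !coef_map coefZ; apply: tofracM.
(* Primitivity of mu: if x * nu = r' * b', then b' is proportional to h, hence a multiple of nu. *)
have prim x : (forall i j, dvr r' (x * (mu i)`_j)) -> dvr r' x.
  move=> H; have [b' Eb'] : exists b' : I * 'I_d -> R, forall ij, x * nu ij = r' * b' ij.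
    apply: (@fin_all_exists _ (fun=> R) (fun ij y => x * nu ij = r' * y)) => -[i l].
    by have := H i l; rewrite Emu.
  have [k1 Ek1] : exists k1, forall ij, b' ij = k1 * nu ij.
    apply: genu => ij kl; apply: (mulfI nzr').
    rewrite mulrCA -Eb' [RHS]mulrCA -Eb' !Ek0 -!mulrA; congr (_ * _).
    by rewrite mulrCA [RHS]mulrCA; congr (_ * _); rewrite mulrC.
  by exists k1; apply: (mulIf nznu); rewrite Eb' Ek1 mulrA.
(* If r' did not divide kap, McCoy's theorem applied to r' b = kap mu would produce an x that
   contradicts [prim]. *)
have kdv j : dvr r' kap`_j.
  apply: NNPP => nj; have [|nall|x [nx hx]] := @mccoy R I r' mu kap.
  - by move=> i l; rewrite -Eb coefZ; exists (b i)`_l.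
  - by apply: nj.
  - exact/nx/prim.
have [kk Ekk] : exists kk : {poly R}, kap = r' *: kk.
  have [y Ey] : exists y : 'I_(size kap) -> R, forall l : 'I_(size kap), kap`_l = r' * y l.
    apply: (@fin_all_exists _ (fun=> R) (fun (l : 'I_(size kap)) y => kap`_l = r' * y)).
    by move=> l; apply: kdv.
  exists (\poly_(l < size kap) oapp y 0 (insub l)).
  apply/polyP=> l; rewrite coefZ coef_poly; case: ltnP => hl.
    by case: insubP => [l' _ <-|]; [rewrite Ey | rewrite hl].
  by rewrite mulr0 nth_default.
exists kk => i; apply/polyP=> l; apply: (mulfI nzr').
by rewrite -!coefZ Eb Ekk scalerAl.
Qed.

(** * Polynomials in finitely many variables as iterated univariate polynomials *)

Section IteratedPolynomials.
Variable F : fieldType.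
Hypothesis charF0 : [pchar F] =i pred0.

Fixpoint iter_poly (k : nat) : idomainType :=
  if k is k'.+1 then {poly iter_poly k'} : idomainType else F.

Fixpoint iter_ev (k : nat) (x : nat -> F) : {rmorphism iter_poly k -> F} :=
  match k with
  | 0 => idfun
  | k'.+1 => horner_eval (x k') \o map_poly (iter_ev k' x)
  end.

Lemma rank_one_free_iter k : rank_one_free (iter_poly k).
Proof. by elim: k => [|k IH]; [exact: rank_one_free_field | exact: rank_one_free_poly]. Qed.

Lemma eq_iter_ev k x y (r : iter_poly k) :
  (forall i, (i < k)%N -> x i = y i) -> iter_ev k x r = iter_ev k y r.
Proof.
elim: k r => //= k IH r e; rewrite /horner_eval e //.
by congr (_.[_]); apply: eq_map_poly => c /=; apply: IH => i /ltnW/e.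
Qed.

Lemma iter_ev_eq0 k (r : iter_poly k) : (forall x, iter_ev k x r = 0) -> r = 0.
Proof.
elim: k r => [|k IH] r r0; first exact: (r0 (fun=> 0)).
apply/polyP=> l; rewrite coef0; apply: IH => x.
have : map_poly (iter_ev k x) r = 0.
  apply: (poly_fun_eq0 charF0) => s.
  have := r0 (fun i => if i == k then s else x i); rewrite /= /horner_eval eqxx.
  move=> <-; congr (_.[_]); apply: eq_map_poly => c; apply: eq_iter_ev => i.
  by case: eqP => // ->; rewrite ltnn.
by move/(congr1 (fun p : {poly F} => p`_l)); rewrite coef_map coef0.
Qed.

Lemma iter_const k c : exists r : iter_poly k, forall x, iter_ev k x r = c.
Proof.
elim: k => [|k [r E]]; first by exists c.
by exists r%:P => x /=; rewrite map_polyC /horner_eval hornerC; apply: E.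
Qed.

Lemma iter_var k i : (i < k)%N -> exists r : iter_poly k, forall x, iter_ev k x r = x i.
Proof.
elim: k => // k IH; rewrite ltnS leq_eqVlt => /orP[/eqP->|/IH[r E]].
  by exists 'X => x /=; rewrite map_polyX /horner_eval hornerX.
by exists r%:P => x /=; rewrite map_polyC /horner_eval hornerC; apply: E.
Qed.

Variables (V : eqType) (vs : seq V) (v0 : V).

Lemma iter_of_polyfun (f : (V -> F) -> F) : polyfun vs f ->
  exists r : iter_poly (size vs), forall y : nat -> F,
    iter_ev (size vs) y r = f (fun v => y (index v vs)).
Proof.
case=> L [Lvs E].
have mono (m : seq V) : {subset m <= vs} -> exists r : iter_poly (size vs),
    forall y, iter_ev (size vs) y r = \prod_(v <- m) y (index v vs).
  elim: m => [|v m IH] mv.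
    have [r Er] := iter_const (size vs) 1; exists r => y; by rewrite Er big_nil.
  have [|r Er] := IH; first by move=> u um; apply: mv; rewrite inE um orbT.
  have [|r' Er'] := @iter_var (size vs) (index v vs); first by rewrite index_mem mv ?mem_head.
  by exists (r' * r) => y; rewrite rmorphM big_cons -Er -Er'.
suff [r Er] : exists r : iter_poly (size vs), forall y,
    iter_ev (size vs) y r = pev (fun v => y (index v vs)) L.
  by exists r => y; rewrite Er E.
elim: L Lvs {E} => [|t L IH] Lvs.
  by exists 0 => y; rewrite rmorph0 /pev big_nil.
have [|r Er] := IH; first by move=> u um; apply: Lvs; rewrite inE um orbT.
have [|r' Er'] := mono t.2; first by apply: Lvs; rewrite mem_head.
have [c Ec] := iter_const (size vs) t.1.
by exists (c * r' + r) => y; rewrite rmorphD rmorphM /= Er Er' Ec /pev big_cons.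
Qed.

Lemma polyfun_of_iter k (r : iter_poly k) : (k <= size vs)%N ->
  polyfun vs (fun x => iter_ev k (fun p => x (nth v0 vs p)) r).
Proof.
elim: k r => [|k IH] r hk; first exact: polyfun_const.
have : polyfun vs (fun x => \sum_(l < size r)
    iter_ev k (fun p => x (nth v0 vs p)) r`_l * \prod_(j < l) x (nth v0 vs k)).
  apply: polyfun_sum => l; apply: polyfun_mul; first by apply: IH; apply: ltnW.
  by apply: polyfun_prod => j; apply: polyfun_var; apply: mem_nth.
apply: polyfun_ext => x /=; rewrite /horner_eval (@horner_coef_wide _ (size r)) ?size_poly //.
by apply: eq_bigr => l _; rewrite coef_map prodr_const card_ord.
Qed.

(** Transfer from [iter_poly (size vs)], whose variable number p is the entry p of [vs]; evaluation
    is faithful by [iter_ev_eq0]. *)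
Lemma polyfun_rank_one_free (I : finType) (a : I -> (V -> F) -> F) :
  (forall i, polyfun vs (a i)) -> (exists i x, a i x != 0) ->
  exists mu : I -> (V -> F) -> F, (forall i, polyfun vs (mu i)) /\
    forall b : I -> (V -> F) -> F, (forall i, polyfun vs (b i)) ->
      (forall x, proportional (a^~ x) (b^~ x)) ->
      exists k, polyfun vs k /\ forall i x, b i x = k x * mu i x.
Proof.
move=> pa [i0 [x0 nz]].
have nthK (f : (V -> F) -> F) x : polyfun vs f -> f (fun v => x (nth v0 vs (index v vs))) = f x.
  case=> L [Lvs E]; rewrite !E /pev [LHS]big_seq [RHS]big_seq.
  apply: eq_bigr => t tL; congr (_ * _); rewrite [LHS]big_seq [RHS]big_seq.
  by apply: eq_bigr => v vt; rewrite nth_index // (Lvs _ tL).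
have [ra Era] := fin_all_exists (fun i => iter_of_polyfun (pa i)).
have [|nu Enu] := @rank_one_free_iter (size vs) I ra.
  exists i0; apply: contraNneq nz => r0.
  by rewrite -(nthK _ _ (pa i0)) -(Era i0 (fun p => x0 (nth v0 vs p))) r0 rmorph0.
exists (fun i x => iter_ev (size vs) (fun p => x (nth v0 vs p)) (nu i)).
split=> [i|b pb ab]; first exact: polyfun_of_iter.
have [rb Erb] := fin_all_exists (fun i => iter_of_polyfun (pb i)).
have [|k Ek] := Enu rb.
  move=> i j; apply/eqP; rewrite -subr_eq0; apply/eqP; apply: iter_ev_eq0 => y.
  by rewrite rmorphB !rmorphM /= !Era !Erb ab subrr.
exists (fun x => iter_ev (size vs) (fun p => x (nth v0 vs p)) k).
split=> [|i x]; first exact: polyfun_of_iter.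
by rewrite -(nthK _ _ (pb i)) -(Erb i (fun p => x (nth v0 vs p))) Ek rmorphM.
Qed.
End IteratedPolynomials.

(** * Schur-Weyl duality *)

Section SchurWeyl.
Variable F : fieldType.
Hypothesis charF0 : [pchar F] =i pred0.
Variables (m n : nat).
Let K := {ffun 'I_m -> 'I_n}.
Let D := #|K|.
Implicit Types (s t : 'S_m) (a b c : K) (g h : 'M[F]_n) (X Y T : 'M[F]_D).

Definition kval (x : 'I_D) : K := enum_val x.
Definition krank (a : K) : 'I_D := enum_rank a.

Lemma krankK : cancel krank kval. Proof. exact: enum_rankK. Qed.
Lemma kvalK : cancel kval krank. Proof. exact: enum_valK. Qed.
Lemma kval_inj : injective kval. Proof. exact: can_inj kvalK. Qed.

Lemma sum_kval (f : K -> F) : \sum_(x < D) f (kval x) = \sum_a f a.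
Proof.
by rewrite [RHS](reindex kval) //; exists krank => a _; [apply: kvalK | apply: krankK].
Qed.

Lemma kval_eq (x : 'I_D) (a : K) : (kval x == a) = (x == krank a).
Proof. by rewrite -[in LHS](krankK a) (inj_eq kval_inj). Qed.

(** The m-th tensor power of g, in the basis of tensors indexed by K; [pmx s] below permutes the
    tensor factors. *)
Definition tens g : 'M[F]_D :=
  \matrix_(x, y) \prod_i g (kval x i) (kval y i).

Definition pmx s : 'M[F]_D :=
  \matrix_(x, y) (kval x == [ffun i => kval y (s i)])%:R.

Lemma tensM g h : tens (g *m h) = tens g *m tens h.
Proof.
apply/matrixP=> x z; rewrite !mxE.
under eq_bigr do rewrite mxE.
rewrite bigA_distr_bigA /= -sum_kval; apply: eq_bigr => y _.
by rewrite !mxE -big_split.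
Qed.

Lemma tens1 : tens 1%:M = 1%:M.
Proof.
apply/matrixP=> x z; rewrite !mxE; case: eqVneq => [->|nxz].
  by rewrite big1 // => i _; rewrite mxE eqxx.
have [i ni] : exists i, kval x i != kval z i.
  apply/existsP; apply: contraNT nxz; rewrite negb_exists => /forallP H.
  by apply/eqP/kval_inj/ffunP=> i; apply/eqP; rewrite -[_ == _]negbK H.
by rewrite (bigD1 i) //= mxE (negPf ni) mul0r.
Qed.

Lemma pmxM s t : pmx s *m pmx t = pmx (s * t).
Proof.
apply/matrixP=> x z; rewrite !mxE.
pose y0 := krank ([ffun i => kval z (t i)]).
rewrite (bigD1 y0) //= big1 ?addr0 => [|y ny]; rewrite !mxE.
  rewrite krankK eqxx mulr1; congr (_ == _)%:R; apply/ffunP=> i.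
  by rewrite !ffunE permM.
by rewrite (kval_eq y) (negPf ny) mulr0.
Qed.

Lemma pmx1 : pmx 1 = 1%:M.
Proof.
apply/matrixP=> x z; rewrite !mxE -(inj_eq kval_inj); congr (_ == _)%:R.
by apply/ffunP=> i; rewrite ffunE perm1.
Qed.

Lemma mul_pmxr X s x a :
  (X *m pmx s) x (krank a) = X x (krank [ffun i => a (s i)]).
Proof.
rewrite !mxE (bigD1 (krank ([ffun i => a (s i)]))) //= big1 ?addr0.
  by rewrite !mxE !krankK eqxx mulr1.
by move=> y ny; rewrite mxE krankK (kval_eq y) (negPf ny) mulr0.
Qed.

Lemma mul_pmxl X s a x :
  (pmx s *m X) (krank [ffun i => a (s i)]) x = X (krank a) x.
Proof.
rewrite !mxE (bigD1 (krank a)) //= big1 ?addr0.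
  by rewrite !mxE !krankK eqxx mul1r.
move=> y ny; rewrite mxE krankK; case: eqP; rewrite ?mul0r //.
move=> e; case/eqP: ny; apply: kval_inj; rewrite krankK; apply/ffunP=> i.
by have := congr1 (fun f : K => f ((s^-1)%g i)) e; rewrite !ffunE permKV.
Qed.

(** The symmetrization of the tensor product of the elementary matrices E_(b i, c i). These matrices
    span the centralizer of the permutation operators. *)
Definition symmx b c : 'M[F]_D := \sum_(s : 'S_m)
  \matrix_(x, y) ((kval x == [ffun i => b (s i)]) &&
                  (kval y == [ffun i => c (s i)]))%:R.

(** At g = sum_i s_i E_(b i, c i) the commutator of T with [tens g] vanishes for every s, and its
    multilinear coefficient in s is the commutator with [symmx b c]. *)
Lemma comm_symmx T : (forall g, T *m tens g = tens g *m T) ->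
  forall b c, T *m symmx b c = symmx b c *m T.
Proof.
move=> Tg b c.
pose E (f : {ffun 'I_m -> 'I_m}) : 'M[F]_D :=
  \matrix_(x, y) ((kval x == [ffun i => b (f i)]) &&
                  (kval y == [ffun i => c (f i)]))%:R.
have Etens (s : 'I_m -> F) :
    tens (\matrix_(u, v) \sum_i s i * ((u == b i) && (v == c i))%:R) =
    \sum_(f : {ffun 'I_m -> 'I_m}) (\prod_j s (f j)) *: E f.
  apply/matrixP=> x z; rewrite mxE summxE.
  under eq_bigr do rewrite mxE.
  rewrite bigA_distr_bigA /=; apply: eq_bigr => f _; rewrite !mxE big_split /=.
  congr (_ * _); case: andP => [[/eqP-> /eqP->]|H].
    by rewrite big1 // => j _; rewrite !ffunE !eqxx.
  have [j nj] : exists j, ~~ ((kval x j == b (f j)) && (kval z j == c (f j))).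
    apply/existsP; apply: contra_notT H; rewrite negb_exists => /forallP H.
    by split; apply/eqP/ffunP=> j; have := H j; rewrite negbK ffunE => /andP[/eqP ? /eqP ?].
  by rewrite (bigD1 j) //= (negPf nj) mul0r.
apply/eqP; rewrite -subr_eq0; apply/eqP/matrixP=> x z; rewrite [RHS]mxE.
pose G (f : {ffun 'I_m -> 'I_m}) := (T *m E f - E f *m T) x z.
have := @polarization_multilinear F charF0 m G.
rewrite /symmx mulmx_sumr mulmx_suml -sumrB summxE => H; rewrite -[RHS]H.
  apply: eq_bigr => s _; rewrite /G.
  suff -> : E [ffun j => s j] = \matrix_(x, y)
      ((kval x == [ffun i => b (s i)]) && (kval y == [ffun i => c (s i)]))%:R by [].
  apply/matrixP=> u v; rewrite !mxE; congr (_ && _)%:R; congr (_ == _);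
  by apply/ffunP=> i; rewrite !ffunE.
move=> s; have := Tg (\matrix_(u, v) \sum_i s i * ((u == b i) && (v == c i))%:R).
rewrite Etens => /eqP; rewrite -subr_eq0 => /eqP /(congr1 (fun X : 'M_D => X x z)).
rewrite mulmx_sumr mulmx_suml -sumrB summxE [RHS]mxE => E0; rewrite -[RHS]E0.
apply: eq_bigr => f _.
by rewrite /G -scalemxAr -scalemxAl -scalerBr [in RHS]mxE mulrC.
Qed.

(** The entries of Y are constant on the orbits of pairs of indices, so m! Y is the combination of
    the [symmx b c] with the entries of Y as coefficients; m! is invertible. *)
Lemma comm_pmx_comm T Y : (forall g, T *m tens g = tens g *m T) ->
  (forall s, Y *m pmx s = pmx s *m Y) -> T *m Y = Y *m T.
Proof.
move=> Tg Ys.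
have Yinv s a b : Y (krank [ffun i => a (s i)]) (krank [ffun i => b (s i)])
    = Y (krank a) (krank b).
  by rewrite -mul_pmxr Ys mul_pmxl.
have EY : (m`!)%:R *: Y =
    \sum_b \sum_c Y (krank b) (krank c) *: symmx b c.
  apply/matrixP=> x z; rewrite mxE summxE.
  have Es s : \sum_b \sum_c Y (krank b) (krank c) *
      ((kval x == [ffun i => b (s i)]) && (kval z == [ffun i => c (s i)]))%:R
      = Y x z.
    have inv (w : 'I_D) : exists2 b : K, kval w = [ffun i => b (s i)] &
        forall b' : K, kval w = [ffun i => b' (s i)] -> b' = b.
      exists [ffun i => kval w (s^-1%g i)] => [|b' e].
        by apply/ffunP=> i; rewrite !ffunE permK.
      by apply/ffunP=> i; rewrite e !ffunE permKV.
    have [b0 eb ub] := inv x; have [c0 ec uc] := inv z.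
    have Eb b : (kval x == [ffun i => b (s i)]) = (b == b0).
      by apply/eqP/eqP => [/ub|->].
    have Ec c : (kval z == [ffun i => c (s i)]) = (c == c0).
      by apply/eqP/eqP => [/uc|->].
    rewrite (bigD1 b0) //= [X in _ + X]big1 ?addr0 => [|b nb]; last first.
      by rewrite big1 // => c _; rewrite Eb (negPf nb) mulr0.
    rewrite (bigD1 c0) //= big1 ?addr0 => [|c nc]; last first.
      by rewrite Ec (negPf nc) andbF mulr0.
    by rewrite Eb Ec !eqxx mulr1 -(Yinv s) -eb -ec !kvalK.
  transitivity (\sum_(s : 'S_m) Y x z).
    by rewrite sumr_const -[RHS]mulr_natl -(card_Sn m).
  under eq_bigr => s _ do rewrite -(Es s).
  rewrite exchange_big; apply: eq_bigr => b _; rewrite exchange_big summxE.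
  apply: eq_bigr => c _; rewrite mxE /symmx summxE mulr_sumr.
  by apply: eq_bigr => s _; rewrite mxE.
have nz : (m`!)%:R != 0 :> F by rewrite -(prednK (fact_gt0 m)) natrS_neq0.
apply: (scalerI nz); rewrite scalemxAr scalemxAl EY mulmx_sumr mulmx_suml.
apply: eq_bigr => b _; rewrite mulmx_sumr mulmx_suml; apply: eq_bigr => c _.
by rewrite -scalemxAr -scalemxAl comm_symmx.
Qed.

(* Double centralizer: averaging a projection onto the span of the permutation
   operators over the left action gives a map commuting with T; evaluate at 1. *)
Theorem schur_weyl T : (forall g, T *m tens g = tens g *m T) ->
  exists c : 'S_m -> F, T = \sum_s c s *: pmx s.
Proof.
move=> Tg; pose ps := [seq pmx s | s <- enum 'S_m].
pose U := <<ps>>%VS.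
have inU s : pmx s \in U by apply: memv_span; apply/mapP; exists s; rewrite ?mem_enum.
have mulU s X : X \in U -> pmx s *m X \in U.
  move/coord_span => ->; rewrite mulmx_sumr; apply: memv_suml => i _.
  rewrite -scalemxAr memvZ //; have : ps`_i \in ps by rewrite mem_nth // size_map -cardE ltn_ord.
  by case/mapP=> t _ ->; rewrite pmxM.
pose p X : 'M[F]_D :=
  (m`!)%:R^-1 *: \sum_(s : 'S_m) pmx s *m projv U (pmx s^-1 *m X).
have nz : (m`!)%:R != 0 :> F by rewrite -(prednK (fact_gt0 m)) natrS_neq0.
have pU X : p X \in U.
  by apply: memvZ; apply: memv_suml => s _; apply: mulU; apply: memv_proj.
have p1 : p 1%:M = 1%:M.
  rewrite /p (eq_bigr (fun=> 1%:M)) => [|s _].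
    by rewrite sumr_const -scaler_nat (card_Sn m) scalerA mulVf // scale1r.
  by rewrite mulmx1 projv_id // pmxM mulgV pmx1.
have pZ (k : F) X : p (k *: X) = k *: p X.
  rewrite /p scalerA mulrC -scalerA; congr (_ *: _); rewrite scaler_sumr.
  by apply: eq_bigr => s _; rewrite -scalemxAr linearZ -scalemxAr.
have pD (I : Type) (r : seq I) (f : I -> 'M[F]_D) :
    p (\sum_(i <- r) f i) = \sum_(i <- r) p (f i).
  rewrite /p -scaler_sumr; congr (_ *: _); rewrite [RHS]exchange_big /=.
  by apply: eq_bigr => s _; rewrite mulmx_sumr linear_sum mulmx_sumr.
have p_eq t X : p (pmx t *m X) = pmx t *m p X.
  rewrite /p -scalemxAr; congr (_ *: _); rewrite mulmx_sumr.
  rewrite (reindex_inj (mulgI t)); apply: eq_bigr => s _ /=.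
  rewrite [RHS]mulmxA pmxM; congr (_ *m projv U _).
  by rewrite mulmxA pmxM invMg mulgKV.
(* The part of the map p that sends column y of X to column v of p X. Since p commutes with left
   multiplication by the permutation operators, so does this matrix, and therefore T commutes with
   it. *)
pose Y v y : 'M[F]_D := \matrix_(u, x) p (delta_mx x y) u v.
have EpY X u v : p X u v = \sum_y (Y v y *m X) u y.
  rewrite {1}(matrix_sum_delta X) pD summxE.
  under eq_bigr => x _ do rewrite pD summxE.
  rewrite exchange_big /=; apply: eq_bigr => y _; rewrite mxE; apply: eq_bigr => x _.
  by rewrite pZ !mxE mulrC.
have Ycomm v y s : Y v y *m pmx s = pmx s *m Y v y.
  apply/matrixP=> u x; rewrite [RHS]mxE.
  transitivity ((pmx s *m p (delta_mx x y)) u v); last first.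
    by rewrite mxE; apply: eq_bigr => w _; rewrite [Y v y w x]mxE.
  rewrite -p_eq EpY; rewrite (bigD1 y) //= big1 ?addr0 => [|z nz'].
    rewrite mulmxA [RHS]mxE (bigD1 x) //= [delta_mx _ _ _ _]mxE !eqxx mulr1.
    by rewrite big1 ?addr0 // => w nw; rewrite [delta_mx _ _ _ _]mxE (negPf nw) mulr0.
  rewrite mulmxA mxE big1 // => w _.
  by rewrite [delta_mx _ _ _ _]mxE (negPf nz') andbF mulr0.
have TpX : T *m p 1%:M = p T.
  apply/matrixP=> u v; rewrite EpY mxE.
  under eq_bigr => w _ do rewrite EpY mulr_sumr.
  rewrite exchange_big; apply: eq_bigr => y _ /=.
  by rewrite -(comm_pmx_comm Tg (Ycomm v y)) mxE; apply: eq_bigr => w _; rewrite mulmx1.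
have TU : T \in U by rewrite -[T]mulmx1 -p1 TpX pU.
pose a i := coord (in_tuple ps) i T; pose t (i : 'I_(size ps)) := nth 1%g (enum 'S_m) i.
exists (fun s => \sum_(i | t i == s) a i).
rewrite {1}(@coord_span _ _ _ (in_tuple ps) T TU) (partition_big t xpredT) //=; apply: eq_bigr => s _.
rewrite scaler_suml; apply: eq_bigr => i /eqP <-; congr (_ *: _).
by rewrite /ps (nth_map 1%g) //; rewrite -(size_map pmx); apply: ltn_ord.
Qed.

End SchurWeyl.

(** * Generation of all matrices from elementary ones and closure along lines *)

Section MatrixGeneration.
Variable F : fieldType.

Lemma delta_mx_block m1 m2 n1 n2 :
  [/\ forall i j, delta_mx (lshift m2 i) (lshift n2 j) =
        block_mx (delta_mx i j) 0 0 0 :> 'M[F]_(m1 + m2, n1 + n2),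
      forall i j, delta_mx (lshift m2 i) (rshift n1 j) =
        block_mx 0 (delta_mx i j) 0 0 :> 'M[F]_(m1 + m2, n1 + n2),
      forall i j, delta_mx (rshift m1 i) (lshift n2 j) =
        block_mx 0 0 (delta_mx i j) 0 :> 'M[F]_(m1 + m2, n1 + n2) &
      forall i j, delta_mx (rshift m1 i) (rshift n1 j) =
        block_mx 0 0 0 (delta_mx i j) :> 'M[F]_(m1 + m2, n1 + n2)].
Proof.
split=> i j; apply/matrixP=> x y; case: (split_ordP x) => x' ->;
case: (split_ordP y) => y' ->;
by rewrite ?block_mxEul ?block_mxEur ?block_mxEdl ?block_mxEdr !mxE
  ?(eq_lshift, eq_rshift, eq_lrshift, eq_rlshift) ?andbF.
Qed.

(** The last closure property stands in for Zariski density and reaches the singular matrices.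
    Induction on n: a nonzero upper left entry allows a block factorization with a Schur complement,
    and a zero entry is first replaced by s <> 0. *)
Lemma matrix_generation n (G : 'M[F]_n -> Prop) :
  G 1%:M -> (forall A B, G A -> G B -> G (A *m B)) ->
  (forall i j s, G (1%:M + s *: delta_mx i j)) ->
  (forall A B, (forall s, s != 0 -> G (A + s *: B)) -> G A) ->
  forall A, G A.
Proof.
elim: n G => [|n IH].
  by move=> G G1 _ _ _ A; rewrite (flatmx0 A) -(flatmx0 1%:M).
rewrite -[n.+1]/(1 + n)%N => G G1 GM GE Gcl A.
have [Eul Eur Edl Edr] := delta_mx_block 1 n 1 n.
have one : 1%:M =  block_mx 1%:M 0 0 1%:M :> 'M[F]_(1 + n) by rewrite -scalar_mx_block.
have GB B : G (block_mx 1%:M 0 0 B : 'M[F]_(1 + n)).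
  move: B; apply: IH => [|B C GB GC|i j s|B C H].
  - by rewrite -one.
  - by have := GM _ _ GB GC; rewrite mulmx_block !(mulmx0, mul0mx, mulmx1, addr0, add0r).
  - have := GE (rshift 1 i) (rshift 1 j) s; rewrite Edr [1%:M]one scale_block_mx.
    by rewrite add_block_mx !(scaler0, addr0).
  - apply: (Gcl _ (block_mx 0 0 0 C)) => s /H.
    by rewrite scale_block_mx add_block_mx !(scaler0, addr0).
have Gc c : G (block_mx 1%:M 0 c 1%:M : 'M[F]_(1 + n)).
  rewrite [c]matrix_sum_delta; elim/big_rec: _ => [|i x _ Gx]; first by rewrite -one.
  rewrite big_ord1; have := GM _ _ (GE (rshift 1 i) (lshift n 0) (c i 0)) Gx.
  rewrite Edl [1%:M in X in X *m _]one scale_block_mx add_block_mx mulmx_block.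
  by rewrite !(scaler0, mulmx0, mul0mx, mulmx1, mul1mx, addr0, add0r).
have Gr r : G (block_mx 1%:M r 0 1%:M : 'M[F]_(1 + n)).
  rewrite [r]matrix_sum_delta big_ord1; elim/big_rec: _ => [|i x _ Gx]; first by rewrite -one.
  have := GM _ _ Gx (GE (lshift n 0) (rshift 1 i) (r 0 i)).
  rewrite Eur [1%:M in X in _ *m X]one scale_block_mx add_block_mx mulmx_block.
  by rewrite !(scaler0, mulmx0, mul0mx, mulmx1, mul1mx, addr0, add0r).
have Gd (d : F) : G (block_mx d%:M 0 0 1%:M : 'M[F]_(1 + n)).
  have := GE (lshift n 0) (lshift n 0) (d - 1); rewrite Eul [1%:M]one scale_block_mx.
  rewrite add_block_mx !(scaler0, addr0).
  suff -> : 1%:M + (d - 1) *: delta_mx 0 0 = d%:M :> 'M[F]_1 by [].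
  by apply/matrixP=> x y; rewrite !ord1 !mxE !eqxx !mulr1n mulr1 addrC subrK.
have main (a : F) r c B : a != 0 -> G (block_mx a%:M r c B : 'M[F]_(1 + n)).
  move=> nz; have := GM _ _ (GM _ _ (Gc (a^-1 *: c)) (GM _ _ (Gd a)
    (GB (B - a^-1 *: (c *m r))))) (Gr (a^-1 *: r)).
  rewrite !mulmx_block !(mulmx0, mul0mx, mulmx1, mul1mx, addr0, add0r).
  rewrite -!scalemxAl -!scalemxAr !mul_scalar_mx !mul_mx_scalar !scalerA.
  by rewrite -scalemxAl scalerA divfK // mulVf // !scale1r [_ + (B - _)]addrC subrK.
rewrite -[A](@submxK _ 1 n 1 n) [ulsubmx A]mx11_scalar; set a := ulsubmx A 0 0.
case: (eqVneq a 0) => [->|]; last exact: main.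
apply: (Gcl _ (block_mx 1%:M 0 0 0)) => s nz.
by rewrite scale_block_mx add_block_mx !(scaler0, addr0) scale_scalar_mx mulr1 -raddfD add0r; apply: main.
Qed.

End MatrixGeneration.

(** * Commutation with tensor powers along a line of matrices *)

Section TensClosure.
Variable F : fieldType.
Hypothesis charF0 : [pchar F] =i pred0.

Lemma tens_line m n (A B : 'M[F]_n) x y :
  exists p : {poly F}, forall s, p.[s] = tens m (A + s *: B) x y.
Proof.
exists (\prod_i ((A (kval x i) (kval y i))%:P + (B (kval x i) (kval y i))%:P * 'X)) => s.
rewrite horner_prod mxE; apply: eq_bigr => i _; rewrite !mxE.
by rewrite hornerD hornerM !hornerC hornerX mulrC.
Qed.

(** The entries of the commutator are polynomials in s with the infinitely many zeros f k. *)
Lemma tens_comm_line m n (T : 'M[F]_#|{ffun 'I_m -> 'I_n}|) (A B : 'M[F]_n) (f : nat -> F) :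
  injective f -> (forall k, T *m tens m (A + f k *: B) = tens m (A + f k *: B) *m T) ->
  forall s, T *m tens m (A + s *: B) = tens m (A + s *: B) *m T.
Proof.
move=> injf H s; apply/matrixP=> x z.
have [P EP] : exists P : 'I_#|{ffun 'I_m -> 'I_n}| * 'I_#|{ffun 'I_m -> 'I_n}| -> {poly F},
    forall xy s, (P xy).[s] = tens m (A + s *: B) xy.1 xy.2.
  exact: (fin_all_exists (fun xy => tens_line (m := m) A B xy.1 xy.2)).
pose p := \sum_y ((T x y)%:P * P (y, z) - P (x, y) * (T y z)%:P).
have Ep u : p.[u] = (T *m tens m (A + u *: B)) x z - (tens m (A + u *: B) *m T) x z.
  rewrite horner_sum !mxE -sumrB; apply: eq_bigr => y _.
  by rewrite hornerD hornerN !hornerM !hornerC !EP.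
apply/eqP; rewrite -subr_eq0 -Ep (_ : p = 0) ?horner0 //.
by apply: (poly_fun_eq0_infinite injf) => k; rewrite Ep H subrr.
Qed.

End TensClosure.

(** * The kernel of the action of the symmetric group on tensors *)

Section TensorKernel.
Variable F : fieldType.
Hypothesis charF0 : [pchar F] =i pred0.
Variables (M n : nat).
Implicit Types (s t p : 'S_M) (I : {set 'I_M}) (c : {ffun 'S_M -> F}).

(** The values of s read as digits in base M, the last value being the most significant: a numerical
    form of the lexicographic order, suited to induction. *)
Definition lexw s : nat := \sum_(i < M) s i * M ^ i.

Lemma lexw_lt s t (i0 : 'I_M) :
  (forall i : 'I_M, (i0 < i)%N -> s i = t i) -> (s i0 < t i0)%N -> (lexw s < lexw t)%N.
Proof.
move=> eq_st lt_st.
pose f (u : 'S_M) j : nat := oapp (fun i : 'I_M => nat_of_ord (u i)) 0%N (insub j).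
have fE u (i : 'I_M) : f u i = u i by rewrite /f valK.
have lexE u : lexw u = (\sum_(0 <= j < M) f u j * M ^ j)%N.
  by rewrite big_mkord; apply: eq_bigr => i _; rewrite fE.
have M0 : (0 < M)%N by apply: leq_ltn_trans (ltn_ord i0).
have small u k : (\sum_(0 <= j < k) f u j * M ^ j < M ^ k)%N.
  elim: k => [|k IH]; first by rewrite big_nil.
  have fM : (f u k < M)%N by rewrite /f; case: insubP => //= i _ _; apply: ltn_ord.
  rewrite big_nat_recr //= expnS; nia.
have split u : lexw u = (\sum_(0 <= j < i0) f u j * M ^ j +
    (u i0 * M ^ i0 + \sum_(i0.+1 <= j < M) f u j * M ^ j))%N.
  rewrite lexE (@big_cat_nat _ _ _ i0) //= ?(ltnW (ltn_ord i0)) //; congr addn.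
  by rewrite big_ltn // fE.
have tail : (\sum_(i0.+1 <= j < M) f s j * M ^ j = \sum_(i0.+1 <= j < M) f t j * M ^ j)%N.
  apply: eq_big_nat => j /andP[h1 h2].
  by rewrite -[j]/(nat_of_ord (Ordinal h2)) !fE eq_st.
have := small s i0; have : ((s i0).+1 * M ^ i0 <= t i0 * M ^ i0)%N by rewrite leq_mul2r lt_st orbT.
by rewrite !split tail mulSn; lia.
Qed.

Lemma last_diff s t : s != t ->
  exists i0 : 'I_M, s i0 != t i0 /\ forall i : 'I_M, (i0 < i)%N -> s i = t i.
Proof.
move=> nst; have [i1 ni1] : exists i, s i != t i.
  apply/existsP; apply: contraNT nst; rewrite negb_exists => /forallP H.
  by apply/eqP/permP=> i; apply/eqP; rewrite -[_ == _]negbK.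
case: (@arg_maxnP _ i1 (fun i => s i != t i) (fun i => i : nat) ni1) => i ni imax.
exists i; split=> // j lt; apply/eqP; apply: contraTT lt => /imax.
by rewrite -leqNgt.
Qed.

Definition decr s I := [forall i in I, forall j in I, (i < j)%N ==> (s j < s i)%N].

Lemma decrP s I : reflect
  (forall i j : 'I_M, i \in I -> j \in I -> (i < j)%N -> (s j < s i)%N) (decr s I).
Proof.
apply: (iffP forall_inP) => [H i j iI jI|H i iI].
  by move/forall_inP: (H i iI) => /(_ j jI) /implyP.
by apply/forall_inP=> j jI; apply/implyP; apply: H.
Qed.

(** At the last point i0 moved by p one has p i0 < i0, hence s (p i0) > s i0, and (p * s) i = s (p
    i) by the convention for products. *)
Lemma decr_lexw s I p : decr s I -> perm_on I p -> p != 1%g -> (lexw s < lexw (p * s))%N.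
Proof.
move=> /decrP dec pI np; have [i0 [ni0 i0max]] := last_diff np.
rewrite perm1 in ni0.
have fixp (i : 'I_M) : (i0 < i)%N -> p i = i by move/i0max; rewrite perm1.
have i0I : i0 \in I by apply: contraNT ni0 => h; rewrite (out_perm pI h).
have lt : (p i0 < i0)%N.
  rewrite ltn_neqAle ni0 leqNgt; apply/negP=> /fixp/perm_inj e.
  by rewrite e eqxx in ni0.
apply: (@lexw_lt _ _ i0) => [i /fixp e|]; first by rewrite permM e.
by rewrite permM; apply: dec => //; rewrite (perm_closed _ pI).
Qed.

(* Colour i by the length of a longest decreasing subsequence ending at i. *)
Lemma increasing_colouring s : (forall I, #|I| = n.+1 -> ~~ decr s I) ->
  exists b : {ffun 'I_M -> 'I_n}, forall i j : 'I_M, (i < j)%N -> b i = b j -> (s i < s j)%N.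
Proof.
move=> nodec.
pose P i I := [&& decr s I, i \in I & [forall j in I, (j <= i)%N]].
pose l i := (\max_(I | P i I) #|I|)%N.
have P1 i : P i [set i].
  apply/and3P; split; last 1 first.
  - by apply/forall_inP=> j; rewrite inE => /eqP ->.
  - by apply/decrP=> j k; rewrite !inE => /eqP-> /eqP->; rewrite ltnn.
  - by rewrite inE.
have l_gt0 i : (0 < l i)%N.
  by apply: leq_trans (leq_bigmax_cond _ (P1 i)); rewrite cards1.
have l_len i : (l i <= n)%N.
  apply/bigmax_leqP=> I /and3P[dec _ _]; rewrite leqNgt; apply/negP=> big.
  pose J := [set x in take n.+1 (enum I)].
  have JI : {subset J <= I} by move=> x; rewrite inE => /mem_take; rewrite mem_enum.
  have cJ : #|J| = n.+1.
    rewrite cardsE (card_uniqP _) ?take_uniq ?enum_uniq // size_takel //.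
    by rewrite -cardE.
  case/negP: (nodec J cJ); apply/decrP=> i' j' /JI iI /JI jI.
  by move/decrP: dec; apply.
have [b Eb] : exists b : 'I_M -> 'I_n, forall i, b i = (l i).-1 :> nat.
  apply: (@fin_all_exists _ (fun=> 'I_n) (fun i x => x = (l i).-1 :> nat)) => i.
  have lt : ((l i).-1 < n)%N by rewrite prednK.
  by exists (Ordinal lt).
exists [ffun i => b i] => i j lt_ij; rewrite !ffunE => e.
have {}e : l i = l j.
  by rewrite -(prednK (l_gt0 i)) -(prednK (l_gt0 j)) -!Eb e.
have nij : s i != s j by rewrite (inj_eq perm_inj); apply: contraTneq lt_ij => ->; rewrite ltnn.
rewrite ltnNge; apply/negP=> le_ji.
have lt_ji : (s j < s i)%N by rewrite ltn_neqAle le_ji andbT eq_sym.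
have Pi_gt0 : (0 < #|P i|)%N by apply/card_gt0P; exists [set i]; apply: P1.
have [I PI El] := eq_bigmax_cond (fun J : {set 'I_M} => #|J|) Pi_gt0.
rewrite -[\max_(_ in _) _]/(l i) in El.
case/and3P: PI => /decrP dec iI /forall_inP imax.
have jI : j \notin I by apply/negP=> /imax; rewrite leqNgt lt_ij.
have : (#|j |: I| <= l j)%N.
  apply: (leq_bigmax_cond (P := P j)); apply/and3P; split; last 1 first.
  - apply/forall_inP=> k; rewrite !inE => /orP[/eqP->//|/imax h].
    by apply: leq_trans h (ltnW lt_ij).
  - apply/decrP=> x y; rewrite !inE => /orP[/eqP->|xI] /orP[/eqP->|yI].
    + by rewrite ltnn.
    + by move=> h; have := imax _ yI; lia.
    + move=> _; case: (ltngtP x i) (imax _ xI) => // [h|h] _.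
        exact: ltn_trans lt_ji (dec _ _ xI iI h).
      by rewrite (val_inj h).
    + exact: dec.
  - by rewrite !inE eqxx.
by rewrite cardsU1 jI /= -El e add1n ltnn.
Qed.

(** The coefficients of the group algebra element (sum of sgn(p) p over the permutations p of I)
    t. *)
Definition zelt t I : {ffun 'S_M -> F} :=
  [ffun s => if perm_on I (s * t^-1)%g then (-1) ^+ odd_perm (s * t^-1)%g else 0].

Lemma sum_zelt t I (X : 'S_M -> F) :
  \sum_s zelt t I s * X s = \sum_(p | perm_on I p) (-1) ^+ odd_perm p * X (p * t)%g.
Proof.
rewrite (reindex_inj (mulIg t)) [RHS]big_mkcond /=; apply: eq_bigr => p _.
by rewrite ffunE mulgK; case: ifP => //; rewrite mul0r.
Qed.

(** The sum is the entry at (b, a) of the operator of c on tensors of degree M over an n-dimensional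
    space. *)
Definition acts0 c := forall a b : {ffun 'I_M -> 'I_n},
  \sum_s c s * (b == [ffun i => a (s i)])%:R = 0.

(** Among the n+1 points of I two, i and j, have a (t i) = a (t j); composing p with their
    transposition keeps Y and changes the sign, so the sum is its own opposite. The bound on a is
    asked on I only, as other points may carry larger indices when the matrices are larger than
    n. *)
Lemma antisym_pigeonhole t I (a : 'I_M -> nat) : #|I| = n.+1 ->
  (forall i, i \in I -> (a (t i) < n)%N) -> forall Y : ('I_M -> nat) -> F,
  (forall u v, u =1 v -> Y u = Y v) ->
  \sum_(p | perm_on I p) (-1) ^+ odd_perm p * Y (fun i => a (t (p i))) = 0.
Proof.
move=> cI lt_a Y eqY.
have [i [j [iI jI nij eij]]] : exists i j, [/\ i \in I, j \in I, i != j & a (t i) = a (t j)].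
  pose g (x : {x | x \in I}) : 'I_n := Ordinal (lt_a (val x) (valP x)).
  have : ~~ injectiveb g.
    apply/negP=> /injectiveP inj; have := leq_card _ inj.
    by rewrite card_sig cI card_ord ltnn.
  case/injectivePn=> -[i iI] [[j jI]] nij /(congr1 (@nat_of_ord n)) /= e.
  by exists i, j; split=> //; apply: contraNneq nij => e'; apply/eqP/val_inj.
set S := \sum_(p | _) _.
have : S = - S.
  rewrite {1}/S (reindex_inj (mulIg (tperm i j))) /= /S -sumrN.
  have tI : perm_on I (tperm i j).
    by apply/subsetP=> x; rewrite inE; case: tpermP => [->|->|]; rewrite ?eqxx.
  apply: eq_big => p.
    apply/idP/idP => h; last exact: perm_onM.
    by rewrite -[p](mulgK (tperm i j)) perm_onM // tpermV.
  move=> _; rewrite odd_permM odd_tperm nij addbT -mulNr; congr (_ * _).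
    by case: odd_perm; rewrite ?opprK.
  apply: eqY => x; rewrite permM.
  by case: tpermP => // ->.
move/eqP; rewrite -subr_eq0 opprK -mulr2n -mulr_natl mulf_eq0.
by rewrite (negPf (natrS_neq0 charF0 1)) => /eqP.
Qed.

Lemma acts0_zelt t I : #|I| = n.+1 -> acts0 (zelt t I).
Proof.
move=> cI a b; rewrite sum_zelt.
have := @antisym_pigeonhole t I (fun i => a i) cI (fun i _ => ltn_ord (a (t i)))
  (fun u => [forall i, b i == u i :> nat]%:R).
move=> H; rewrite -[RHS]H => [|u v e]; last first.
  by under eq_forallb => i do rewrite e.
apply: eq_bigr => p _; suff -> : (b == [ffun i => a ((p * t)%g i)]) =
    [forall i, b i == a (t (p i)) :> nat] by [].
apply/eqP/forallP=> [-> i|h]; first by rewrite ffunE permM.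
by apply/ffunP=> i; rewrite ffunE permM; apply/val_inj/eqP/h.
Qed.

(** Z will be realizability by an element of the T-ideal. The induction pushes up the least weight
    [lexw] in the support of c; distinct permutations have distinct weights, so a single permutation
    is treated at each step. *)
Theorem tensor_kernel (Z : {ffun 'S_M -> F} -> Prop) :
  Z 0 -> (forall c c', Z c -> Z c' -> Z (c + c')) ->
  (forall k c, Z c -> Z [ffun s => k * c s]) ->
  (forall t I, #|I| = n.+1 -> Z (zelt t I)) -> forall c, acts0 c -> Z c.
Proof.
move=> Z0 ZD ZZ Zz.
pose N := (\max_s lexw s).+1.
have ltN s : (lexw s < N)%N by rewrite ltnS; apply: (leq_bigmax s).
suff H k c : acts0 c -> (forall s, c s != 0 -> (N <= lexw s + k)%N) -> Z c.
  by move=> c c0; apply: (H N c c0) => s _; apply: leq_addl.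
elim: k c => [|k IH] c c0 supp.
  suff -> : c = 0 by [].
  apply/ffunP=> s; rewrite ffunE; apply/eqP; apply: contraT => /supp.
  by rewrite addn0 leqNgt ltN.
case: (pickP (fun s => (c s != 0) && (N == lexw s + k.+1)%N)) => [s /andP[cs /eqP eN]|none].
  have suppgt t : c t != 0 -> t != s -> (lexw s < lexw t)%N.
    move=> ct nts; have := supp t ct; have : lexw t != lexw s; last by lia.
    have [i0 [ni0 i0max]] := last_diff nts.
    case: (ltngtP (t i0) (s i0)) => [h|h|h]; last by rewrite (val_inj h) eqxx in ni0.
      by rewrite ltn_eqF // (@lexw_lt _ _ i0).
    by rewrite gtn_eqF // (@lexw_lt _ _ i0) // => i /i0max.
  case: (pickP (fun I => (#|I| == n.+1) && decr s I)) => [I /andP[/eqP cI dec]|nodec].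
    (* [zelt s I] has coefficient 1 at s and otherwise involves only permutations of larger weight,
       so subtracting it raises the least weight. *)
    pose c' := [ffun t => c t - c s * zelt s I t].
    have -> : c = c' + [ffun t => c s * zelt s I t].
      by apply/ffunP=> t; rewrite !ffunE subrK.
    apply: ZD; last exact/ZZ/Zz.
    apply: IH => [a b|t].
      under eq_bigr do rewrite ffunE mulrBl.
      rewrite sumrB c0 sub0r; under eq_bigr do rewrite -mulrA.
      by rewrite -mulr_sumr acts0_zelt // mulr0 oppr0.
    rewrite ffunE => nz; suff : (lexw s < lexw t)%N by rewrite eN; lia.
    case: (eqVneq t s) nz => [->|nts] nz.
      by rewrite ffunE mulgV perm_on1 odd_perm1 mulr1 subrr eqxx in nz.
    case: (eqVneq (c t) 0) nz => [->|ct _]; last exact: suppgt.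
    rewrite ffunE; case: ifP => [h _|]; last by rewrite mulr0 subrr eqxx.
    rewrite -[t](mulgKV s); apply: decr_lexw dec h _.
    by apply: contraNneq nts => e; rewrite -[t](mulgKV s) e mul1g.
  have [|b incr] := @increasing_colouring s.
    by move=> I cI; have := nodec I; rewrite cI eqxx /= => ->.
  (* Without a decreasing subsequence, test c at the indices b and a = b o s^-1. A further
     permutation t with b = a o t takes a smaller value than s at the last place where they differ,
     because s increases on each colour class; then t has smaller weight than s and is not in the
     support. Hence c s = 0. *)
  pose a := [ffun i => b (s^-1%g i)] : {ffun 'I_M -> 'I_n}.
  have := c0 a b; rewrite (bigD1 s) //= big1 => [|t nts].
    rewrite addr0 (_ : b = [ffun i => a (s i)]) ?eqxx ?mulr1.
      by move=> e; rewrite e eqxx in cs.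
    by apply/ffunP=> i; rewrite !ffunE permK.
  case: (eqVneq (c t) 0) => [->|ct]; first by rewrite mul0r.
  case: eqP => [/ffunP bt|]; last by rewrite mulr0.
  have := suppgt t ct nts; rewrite ltnNge => /negP[]; apply: ltnW.
  have [i0 [ni0 i0max]] := last_diff nts.
  apply: (@lexw_lt _ _ i0) => //; pose j := s^-1%g (t i0).
  have sj : s j = t i0 by rewrite permKV.
  rewrite -sj; apply: incr; last by have := bt i0; rewrite !ffunE -sj permK.
  case: (ltngtP j i0) => // [h|/val_inj h].
    have := i0max _ h; rewrite sj => /perm_inj e.
    by rewrite e ltnn in h.
  by rewrite -h sj h eqxx in ni0.
apply: IH => // s cs; have := supp s cs; have := none s; rewrite cs /= => /negbT; lia.
Qed.

End TensorKernel.

(** * Extension of permutations along an injection *)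

Section ExtPerm.
Variables (k M : nat) (h : 'I_k -> 'I_M).
Hypothesis inj_h : injective h.

Definition ext_fun (r : 'S_k) (x : 'I_M) := if [pick i | h i == x] is Some i then h (r i) else x.

Lemma ext_funE r i : ext_fun r (h i) = h (r i).
Proof.
rewrite /ext_fun; case: pickP => [j /eqP/inj_h->//|/(_ i)]; by rewrite eqxx.
Qed.

Lemma ext_fun_out r x : x \notin codom h -> ext_fun r x = x.
Proof.
by rewrite /ext_fun; case: pickP => // i /eqP <-; rewrite codom_f.
Qed.

Lemma ext_fun_inj r : injective (ext_fun r).
Proof.
apply: (can_inj (g := ext_fun (r^-1)%g)) => x.
case: (boolP (x \in codom h)) => [/codomP[i ->]|nx]; first by rewrite !ext_funE permK.
by rewrite !ext_fun_out.
Qed.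

Definition ext_perm r : 'S_M := perm (@ext_fun_inj r).

Lemma ext_permE r i : ext_perm r (h i) = h (r i).
Proof. by rewrite permE ext_funE. Qed.

Lemma ext_perm_out r x : x \notin codom h -> ext_perm r x = x.
Proof. by move=> nx; rewrite permE ext_fun_out. Qed.

Lemma ext_permP (r : 'S_k) (s : 'S_M) :
  (forall i, s (h i) = h (r i)) -> (forall x, x \notin codom h -> s x = x) -> s = ext_perm r.
Proof.
move=> s1 s2; apply/permP=> x.
case: (boolP (x \in codom h)) => [/codomP[i ->]|nx]; first by rewrite s1 ext_permE.
by rewrite s2 // ext_perm_out.
Qed.

Lemma ext_permM r t : ext_perm (r * t) = (ext_perm r * ext_perm t)%g.
Proof.
symmetry; apply: ext_permP => [i|x nx]; first by rewrite permM !ext_permE permM.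
by rewrite permM !ext_perm_out.
Qed.

Lemma ext_perm1 : ext_perm 1 = 1%g.
Proof. by symmetry; apply: ext_permP => [i|x _]; rewrite !perm1. Qed.

Lemma ext_perm_inj : injective ext_perm.
Proof.
move=> r t e; apply/permP=> i; apply: inj_h; by rewrite -!ext_permE e.
Qed.

Lemma ext_tperm i j : ext_perm (tperm i j) = tperm (h i) (h j).
Proof.
symmetry; apply: ext_permP => [l|x nx]; first by rewrite -inj_tperm.
by rewrite tpermD //; apply: contraNneq nx => <-; apply: codom_f.
Qed.

Lemma odd_ext_perm r : odd_perm (ext_perm r) = odd_perm r.
Proof.
have [ts Er dts] := prod_tpermP r.
have -> : ext_perm r = (\prod_(t <- [seq (h u.1, h u.2) | u <- ts]) tperm t.1 t.2)%g.
  rewrite {}Er {dts}; elim: ts => [|t ts IH]; first by rewrite !big_nil ext_perm1.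
  by rewrite /= !big_cons ext_permM IH ext_tperm.
rewrite odd_perm_prod; first by rewrite Er odd_perm_prod // size_map.
rewrite all_map; apply: sub_all dts => t; rewrite /dpair /=.
by rewrite /= (inj_eq inj_h).
Qed.

Lemma ext_perm_on (I : {set 'I_M}) r : I =i codom h -> perm_on I (ext_perm r).
Proof.
move=> eI; apply/subsetP=> x; rewrite inE; apply: contraR; rewrite eI => nx.
by rewrite ext_perm_out.
Qed.

Lemma perm_on_ext (I : {set 'I_M}) s : I =i codom h -> perm_on I s ->
  exists r, s = ext_perm r.
Proof.
move=> eI sI.
have [r Er] : exists r : 'I_k -> 'I_k, forall i, s (h i) = h (r i).
  apply: (@fin_all_exists _ (fun=> 'I_k) (fun i y => s (h i) = h y)) => i.
  by apply/codomP; rewrite -eI (perm_closed _ sI) eI codom_f.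
have inj_r : injective r by move=> i j e; apply/inj_h/(@perm_inj _ s); rewrite !Er e.
exists (perm inj_r); apply: ext_permP => [i|x]; first by rewrite Er permE.
by rewrite -eI => /(out_perm sI).
Qed.

Lemma sum_perm_on_ext (F : fieldType) (I : {set 'I_M}) (X : 'S_M -> F) : I =i codom h ->
  \sum_(s | perm_on I s) X s = \sum_r X (ext_perm r).
Proof.
move=> eI.
rewrite (reindex_onto ext_perm (fun s => odflt 1%g [pick r | ext_perm r == s])) /=.
  apply: eq_bigl => r; rewrite ext_perm_on //=; case: pickP => [t /eqP/ext_perm_inj->|/(_ r)].
    by rewrite eqxx.
  by rewrite eqxx.
move=> s /(perm_on_ext eI)[r ->]; case: pickP => [t /eqP//|/(_ r)].
by rewrite eqxx.
Qed.

End ExtPerm.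

(** * Contraction of tensors along a permutation *)

Lemma mxtrace_delta (F : fieldType) d (p q : 'I_d) :
  \tr (delta_mx p q : 'M[F]_d) = (p == q)%:R.
Proof.
rewrite /mxtrace (bigD1 p) //= big1 ?addr0 => [|i ni]; rewrite mxE ?eqxx //.
by rewrite (negPf ni).
Qed.

Section Psi.
Variables (F : fieldType) (d : nat) (j0 : 'I_d).
Local Notation E0 := (delta_mx j0 j0 : 'M[F]_d).

(** The full contraction of the tensor product of the H i along s, that is, the product over the
    cycles of s of the traces of the matrices met along the cycle. The idempotent E0, of trace 1, is
    the filler for slots that have been emptied: a fixed point carrying it contributes the factor
    1. *)
Definition psi M (s : 'S_M) (H : 'I_M -> 'M[F]_d) : F :=
  \sum_(a : {ffun 'I_M -> 'I_d}) \prod_i H i (a i) (a (s i)).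

Definition upd M (H : 'I_M -> 'M[F]_d) j X i := if i == j then X else H i.

Lemma eq_psi M (s : 'S_M) H H' : H =1 H' -> psi s H = psi s H'.
Proof. by move=> e; apply: eq_bigr => a _; apply: eq_bigr => i _; rewrite e. Qed.

Lemma psi_conj M (s t : 'S_M) H : psi (t^-1 * s * t) H = psi s (fun i => H (t i)).
Proof.
rewrite /psi (reindex (fun a : {ffun 'I_M -> 'I_d} => [ffun i => a (t^-1%g i)])) /=.
  apply: eq_bigr => a _; rewrite (reindex_inj (@perm_inj _ t)) /=.
  by apply: eq_bigr => i _; rewrite !ffunE !permM !permK.
by exists (fun a : {ffun 'I_M -> 'I_d} => [ffun i => a (t i)]) => a _;
  apply/ffunP=> i; rewrite !ffunE ?permK ?permKV.
Qed.

(** Sums out the index at j while the indexing functions keep their domain: on the right their value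
    at j is frozen at j0. *)
Lemma sum_pull M (j : 'I_M) (K : {ffun 'I_M -> 'I_d} -> 'I_d -> F) :
  (forall (a b : {ffun 'I_M -> 'I_d}) x, (forall i, i != j -> a i = b i) -> K a x = K b x) ->
  \sum_(a : {ffun 'I_M -> 'I_d}) K a (a j) = \sum_(a : {ffun 'I_M -> 'I_d} | a j == j0) \sum_x K a x.
Proof.
move=> indK; rewrite (partition_big (fun a : {ffun 'I_M -> 'I_d} => a j) xpredT) //=.
rewrite [RHS]exchange_big; apply: eq_bigr => x _ /=.
pose sw (a : {ffun 'I_M -> 'I_d}) : {ffun 'I_M -> 'I_d} :=
  [ffun i => if i == j then tperm x j0 (a j) else a i].
have swK : involutive sw.
  by move=> a; apply/ffunP=> i; rewrite !ffunE eqxx; case: eqP => // ->; rewrite tpermK.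
rewrite (reindex_inj (inv_inj swK)) /=; apply: eq_big => a.
  by rewrite ffunE eqxx -{2}(tpermR x j0) (inj_eq perm_inj).
move=> /eqP->; apply: indK => i ni; by rewrite ffunE (negPf ni).
Qed.

Lemma psi_fix M (s : 'S_M) H j : s j = j -> psi s H = \tr (H j) * psi s (upd H j E0).
Proof.
move=> sj.
pose K (a : {ffun 'I_M -> 'I_d}) x := H j x x * \prod_(i | i != j) H i (a i) (a (s i)).
have := @sum_pull M j K; rewrite /K => pull.
rewrite {1}/psi; under eq_bigr => a _ do rewrite (bigD1 j) //= sj.
rewrite {}pull => [|a b x e]; last first.
  congr (_ * _); apply: eq_bigr => i ni; rewrite !e //.
  by apply: contraNneq ni => e'; rewrite -(inj_eq (@perm_inj _ s)) e' sj.
rewrite /psi mulr_sumr big_mkcond /=; apply: eq_bigr => a _.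
rewrite [in RHS](bigD1 j) //= sj {1}/upd eqxx mxE andbb.
case: eqP => _; rewrite ?mul0r ?mulr0 // mul1r /mxtrace mulr_suml.
apply: eq_bigr => x _; congr (_ * _); apply: eq_bigr => i ni.
by rewrite /upd (negPf ni).
Qed.

(** Takes j out of its cycle: its matrix is multiplied into that of the next point, and j is left as
    a fixed point carrying E0. *)
Lemma psi_cut M (s : 'S_M) H j : s j != j ->
  psi s H = psi (s * tperm j (s j)) (upd (upd H (s j) (H j *m H (s j))) j E0).
Proof.
set y := s j => nyj; set s' := (s * tperm j y)%g.
have s'j : s' j = j by rewrite permM tpermR.
pose K (a : {ffun 'I_M -> 'I_d}) x := H j (a y) x * (H y x (a (s' y)) *
  \prod_(i | (i != j) && (i != y)) H i (a i) (a (s' i))).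
have nj i : i != j -> s' i != j.
  by apply: contraNneq => e; apply/eqP/(@perm_inj _ s'); rewrite e s'j.
have := @sum_pull M j K; rewrite {1 2}/K => pull.
transitivity (\sum_(a : {ffun 'I_M -> 'I_d}) K a (a j)).
  rewrite /psi [RHS](reindex (fun a : {ffun 'I_M -> 'I_d} => [ffun i => a (tperm j y i)])) /=.
    apply: eq_bigr => a _; rewrite (bigD1 j) //= (bigD1 y) //= /K !ffunE tpermR tpermL.
    congr (_ * (_ * _)).
      by congr (H y _ (a _)); rewrite /s' permM tpermK.
    apply: eq_bigr => i /andP[ni ny]; rewrite !ffunE /s' permM tpermK tpermD //.
      by rewrite eq_sym.
    by rewrite eq_sym.
  by exists (fun a : {ffun 'I_M -> 'I_d} => [ffun i => a (tperm j y i)]) => a _;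
    apply/ffunP=> i; rewrite !ffunE tpermK.
rewrite {}pull => [|a b x e]; last first.
  rewrite !e // ?nj //; congr (_ * (_ * _)); apply: eq_bigr => i /andP[ni _].
  by rewrite !e // nj.
rewrite /psi big_mkcond /=; apply: eq_bigr => a _.
rewrite [in RHS](bigD1 j) //= s'j {1}/upd eqxx mxE andbb.
case: eqP => _; rewrite ?mul0r // mul1r (bigD1 y) //= /upd (negPf nyj) eqxx mxE mulr_suml.
apply: eq_bigr => x _; rewrite /K mulrA; congr (_ * _).
by apply: eq_bigr => i /andP[/negPf-> /negPf->].
Qed.

Lemma psi_merge M (s : 'S_M) H H' j : s j != j -> H j *m H (s j) = H' j *m H' (s j) ->
  (forall i, i != j -> i != s j -> H i = H' i) -> psi s H = psi s H'.
Proof.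
move=> nj e eH; rewrite !(psi_cut _ nj) e; apply: eq_psi => i; rewrite /upd.
by case: eqVneq => // ni; case: eqVneq => // ni'; rewrite eH.
Qed.

Definition wprod M (H : 'I_M -> 'M[F]_d) (l : seq 'I_M) :=
  foldr (fun y A => H y *m A) 1%:M l.

Lemma wprod_rcons M (H : 'I_M -> 'M[F]_d) l y : wprod H (rcons l y) = wprod H l *m H y.
Proof. by elim: l => [|z l IH] /=; rewrite ?mulmx1 ?mul1mx // IH mulmxA. Qed.

Lemma eq_wprod M (H H' : 'I_M -> 'M[F]_d) l : {in l, H =1 H'} -> wprod H l = wprod H' l.
Proof.
elim: l => //= y l IH e; rewrite e ?mem_head // IH // => z zl; apply: e.
by rewrite inE zl orbT.
Qed.

(** Repeated merging carries the product of the matrices along the orbit; with t maximal, the whole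
    cycle is concentrated at its last point. *)
Lemma psi_traject M (s : 'S_M) H x t : (t < #|porbit s x|)%N ->
  psi s H = psi s (fun i => if i \in traject s x t then 1%:M else
    if i == iter t s x then wprod H (traject s x t.+1) else H i).
Proof.
have U := uniq_traject_porbit s x.
elim: t => [|t IH] lt.
  by apply: eq_psi => i /=; case: eqP => // ->; rewrite mulmx1.
rewrite IH; last exact: ltnW.
have Ut : uniq (traject s x t.+2).
  have -> : traject s x t.+2 = take t.+2 (traject s x #|porbit s x|) by rewrite take_traject.
  exact: take_uniq.
rewrite trajectSr rcons_uniq in Ut; case/andP: Ut => ny Ut.
rewrite trajectSr rcons_uniq in Ut; case/andP: Ut => nj _.
set j := iter t s x in nj *; have Ey : iter t.+1 s x = s j by [].
rewrite Ey in ny *; rewrite trajectSr mem_rcons inE negb_or in ny.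
case/andP: ny => nyj nyt.
have EW : wprod H (traject s x t.+2) = wprod H (traject s x t.+1) *m H (s j).
  by rewrite trajectSr wprod_rcons.
rewrite EW trajectSr -/j; move: (wprod H _) => W.
apply: (@psi_merge _ _ _ _ j) => //=.
  rewrite !mem_rcons !inE !eqxx (negPf nj) (negPf nyj) (negPf nyt) /=.
  by rewrite mul1mx.
by move=> i ni niy; rewrite mem_rcons inE (negPf ni) (negPf niy).
Qed.

(** The identity matrices force a to be constant on the orbit. The remaining factors do not see this
    constant, which is summed into the trace and then normalized to j0. *)
Lemma psi_const_orbit M (s : 'S_M) H y :
  (forall i, i \in porbit s y -> i != y -> H i = 1%:M) ->
  psi s H = \tr (H y) * \sum_(a : {ffun 'I_M -> 'I_d} | [forall i in porbit s y, a i == j0])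
    \prod_(i | i \notin porbit s y) H i (a i) (a (s i)).
Proof.
move=> H1; pose O := porbit s y; pose R (a : {ffun 'I_M -> 'I_d}) :=
  \prod_(i | i \notin O) H i (a i) (a (s i)).
have yO : y \in O by apply: porbit_id.
have sO i : (s i \in O) = (i \in O).
  by have := porbit_perm s 1 i; rewrite expg1 /O => e; rewrite porbit_sym e porbit_sym.
have constO (a : {ffun 'I_M -> 'I_d}) :
    (forall i, i \in O -> i != y -> a i = a (s i)) -> forall i, i \in O -> a i = a y.
  move=> e i; rewrite /O -porbitV => /porbitP[t ->]; elim: t => [|t IH].
    by rewrite expg0 perm1.
  set i' := (s^-1 ^+ t.+1)%g y; have si : s i' = (s^-1 ^+ t)%g y.
    by rewrite /i' expgSr permM permKV.
  case: (eqVneq i' y) => [->//|ni]; rewrite e // ?si //.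
  by rewrite /O -porbitV; apply: mem_porbit.
have prodO (a : {ffun 'I_M -> 'I_d}) : \prod_(i in O) H i (a i) (a (s i)) =
    if [forall i in O, a i == a y] then H y (a y) (a y) else 0.
  case: (boolP [forall i in O, a i == a y]) => [/forall_inP e|].
    rewrite (bigD1 y) //= (eqP (e _ _)) ?sO // big1 ?mulr1 // => i /andP[iO ni].
    by rewrite H1 // mxE !(eqP (e _ _)) ?eqxx ?sO.
  move=> nc; have [i /and3P[iO niy nai]] : exists i, [&& i \in O, i != y & a i != a (s i)].
    apply/existsP; apply: contraNT nc; rewrite negb_exists => /forallP h.
    apply/forall_inP=> i iO; apply/eqP; apply: constO iO => l lO nl; apply/eqP.
    by have := h l; rewrite lO nl /= negbK.
  by rewrite (bigD1 i) //= H1 // mxE (negPf nai) mul0r.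
have sumR x : \sum_(a : {ffun 'I_M -> 'I_d} | [forall i in O, a i == x]) R a =
    \sum_(a : {ffun 'I_M -> 'I_d} | [forall i in O, a i == j0]) R a.
  pose sw (a : {ffun 'I_M -> 'I_d}) : {ffun 'I_M -> 'I_d} :=
    [ffun i => if i \in O then tperm x j0 (a i) else a i].
  have swK : involutive sw.
    by move=> a; apply/ffunP=> i; rewrite !ffunE; case: (i \in O); rewrite ?tpermK.
  rewrite (reindex_inj (inv_inj swK)) /=; apply: eq_big => a.
    apply: eq_forallb => i; case: (boolP (i \in O)) => //= iO.
    by rewrite ffunE iO -{2}(tpermR x j0) (inj_eq perm_inj).
  move=> _; apply: eq_bigr => i niO; by rewrite !ffunE sO (negPf niO).
rewrite -/O /mxtrace mulr_suml -[in RHS]/(R _).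
transitivity (\sum_(a : {ffun 'I_M -> 'I_d} | [forall i in O, a i == a y]) H y (a y) (a y) * R a).
  rewrite [RHS]big_mkcond /=; apply: eq_bigr => a _.
  by rewrite (bigID [in O]) /= prodO; case: ifP; rewrite ?mul0r.
rewrite (partition_big (fun a : {ffun 'I_M -> 'I_d} => a y) xpredT) //=.
apply: eq_bigr => x _; rewrite -(sumR x) mulr_sumr; apply: eq_big => a.
  apply/andP/forall_inP => [[/forall_inP h /eqP <-]//|h].
  by have /eqP ey := h y yO; rewrite ey; split=> //; apply/forall_inP.
by case/andP=> _ /eqP ->.
Qed.

(** The cycle is concentrated at its last point, once for H and once for the family filled with E0,
    whose product over the cycle is E0 itself. *)
Lemma psi_orbit M (s : 'S_M) H x :
  psi s H = \tr (wprod H (traject s x #|porbit s x|)) *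
    psi s (fun i => if i \in porbit s x then E0 else H i).
Proof.
set k := #|porbit s x|; have k0 : (0 < k)%N by rewrite lt0n card_porbit_neq0.
pose y := iter k.-1 s x.
have Exy : porbit s y = porbit s x by rewrite /y -permX porbit_perm.
have tk : traject s x k = rcons (traject s x k.-1) y by rewrite -trajectSr prednK.
have key H' : psi s H' = \tr (wprod H' (traject s x k)) *
    \sum_(a : {ffun 'I_M -> 'I_d} | [forall i in porbit s x, a i == j0])
    \prod_(i | i \notin porbit s x) H' i (a i) (a (s i)).
  rewrite (@psi_traject _ s H' x k.-1) ?prednK // (@psi_const_orbit _ s _ y) Exy.
    have := uniq_traject_porbit s x; rewrite -/k tk rcons_uniq => /andP[/negPf-> _].
    rewrite eqxx; congr (_ * _); apply: eq_bigr => a _; apply: eq_bigr => i.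
    rewrite porbit_traject -/k tk mem_rcons inE negb_or => /andP[ny nt].
    by rewrite (negPf nt) (negPf ny).
  move=> i; rewrite porbit_traject -/k tk mem_rcons inE => /orP[->//|-> //].
rewrite key [in RHS]key; congr (_ * _); rewrite (_ : wprod _ _ = E0).
  rewrite mxtrace_delta eqxx mul1r; apply: eq_bigr => a _; apply: eq_bigr => i /negPf.
  by move=> ->.
have -> : wprod (fun i => if i \in porbit s x then E0 else H i) (traject s x k) =
    wprod (fun=> E0) (traject s x k).
  by apply: eq_wprod => i; rewrite -porbit_traject => ->.
elim: (k) k0 (x) => //= l IH _ z; case: l IH => [|l] IH; first by rewrite mulmx1.
by rewrite IH // mul_delta_mx.
Qed.

(** The starting point of each cycle is left free, so that an open word can be read from the point
    following the special one. *)
Lemma psi_porbits M (s : 'S_M) H (x : {set 'I_M} -> 'I_M) :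
  (forall O, O \in porbits s -> x O \in O) ->
  psi s H = \prod_(O in porbits s) \tr (wprod H (traject s (x O) #|O|)).
Proof.
move=> xO.
have porb O : O \in porbits s -> porbit s (x O) = O.
  move=> Os; have := xO O Os; case/imsetP: Os => z _ ->.
  by move=> h; apply/eqP; rewrite eq_porbit_mem.
suff step (r : seq {set 'I_M}) : uniq r -> {subset r <= porbits s} ->
    psi s H = \prod_(O <- r) \tr (wprod H (traject s (x O) #|O|)) *
      psi s (fun i => if porbit s i \in r then E0 else H i).
  rewrite (step (enum (porbits s))) ?enum_uniq // => [|O]; last by rewrite mem_enum.
  rewrite big_enum /= [X in _ * X](_ : _ = 1) ?mulr1 //.
  rewrite (eq_psi _ (H' := fun=> E0)) => [|i]; last by rewrite mem_enum imset_f.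
  rewrite /psi (bigD1 [ffun=> j0]) //= big1 => [|i _]; last by rewrite !ffunE mxE eqxx.
  rewrite big1 ?addr0 // => a na.
  have [i ni] : exists i, a i != j0.
    apply/existsP; apply: contraNT na; rewrite negb_exists => /forallP h.
    by apply/eqP/ffunP=> i; rewrite ffunE; apply/eqP; rewrite -[_ == _]negbK.
  by rewrite (bigD1 i) //= mxE (negPf ni) mul0r.
elim: r => [|O r IH] /=; first by rewrite big_nil mul1r.
move=> /andP[nO ur] sub; have Os : O \in porbits s by apply: sub; rewrite mem_head.
rewrite IH //; last by move=> O' h; apply: sub; rewrite inE h orbT.
rewrite big_cons (psi_orbit s _ (x O)) porb // mulrCA mulrA.
congr (\tr _ * _ * _).
  apply: eq_wprod => i; have -> : #|O| = #|porbit s (x O)| by rewrite porb.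
  by rewrite -porbit_traject -eq_porbit_mem porb // => /eqP ->; rewrite (negPf nO).
apply: eq_psi => i; rewrite inE -[in X in _ = if X || _ then _ else _](porb O Os).
by rewrite eq_porbit_mem porb //; case: (i \in O).
Qed.

(** Points outside the image of h are fixed and carry E0, which forces their index to be j0 and
    contributes 1. *)
Lemma psi_ext k M (h : 'I_k -> 'I_M) (inj_h : injective h) (r : 'S_k) H :
  (forall x, x \notin codom h -> H x = E0) ->
  psi (ext_perm inj_h r) H = psi r (fun i => H (h i)).
Proof.
move=> HE.
pose g (a : {ffun 'I_k -> 'I_d}) : {ffun 'I_M -> 'I_d} :=
  [ffun x => if [pick i | h i == x] is Some i then a i else j0].
have gh a i : g a (h i) = a i.
  by rewrite ffunE; case: pickP => [j /eqP/inj_h->//|/(_ i)]; rewrite eqxx.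
have gout a x : x \notin codom h -> g a x = j0.
  by rewrite ffunE; case: pickP => // i /eqP <-; rewrite codom_f.
rewrite /psi (bigID (fun a : {ffun 'I_M -> 'I_d} => [forall x, (x \in codom h) || (a x == j0)])) /=.
rewrite [X in _ + X]big1 ?addr0 => [|a]; last first.
  rewrite negb_forall => /existsP[x]; rewrite negb_or => /andP[nx nax].
  by rewrite (bigD1 x) //= HE // mxE (negPf nax) mul0r.
rewrite (reindex_onto g (fun a => [ffun i => a (h i)])) /=; last first.
  move=> a /forallP ha; apply/ffunP=> x; rewrite ffunE.
  case: pickP => [i /eqP <-|nh]; first by rewrite ffunE.
  have nx : x \notin codom h by apply/codomP=> -[i e]; have := nh i; rewrite e eqxx.
  by have := ha x; rewrite (negPf nx) => /eqP.
apply: eq_big => [a|a _].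
  apply/andP; split.
    by apply/forallP=> x; case: (boolP (x \in codom h)) => //= nx; rewrite gout.
  by apply/eqP/ffunP=> i; rewrite ffunE gh.
rewrite (bigID [in codom h]) /= [X in _ * X]big1 ?mulr1 => [|x nx]; last first.
  by rewrite HE // ext_perm_out // gout // mxE eqxx.
rewrite (eq_bigl [in h @: 'I_k]) => [|x]; last first.
  by apply/codomP/imsetP => [[i ->]|[i _ ->]]; exists i.
rewrite big_imset /=; last by move=> i j _ _; apply: inj_h.
by apply: eq_bigr => i _; rewrite ext_permE !gh.
Qed.

End Psi.

(** * Evaluation of quasi-polynomials *)

Section Evaluation.
Variables (F : fieldType) (n : nat).
Implicit Types (P Q : quasipoly F n) (w : word).

Definition cmev (A : nat -> 'M[F]_n) (m : cmono n) := \prod_(v <- m) A v.1.1 v.1.2 v.2.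

(** Coefficients are taken at A and words at B, possibly of another size: values on matrices of size
    n alone do not determine a quasi-polynomial. *)
Definition bigeval (A : nat -> 'M[F]_n) d (B : nat -> 'M[F]_d) P : 'M[F]_d :=
  \sum_(t <- P) (t.1.1 * cmev A t.1.2) *: wordval B t.2.

Lemma wordval_cat d (B : nat -> 'M[F]_d) w w' :
  wordval B (w ++ w') = wordval B w *m wordval B w'.
Proof. by elim: w => [|k w IH] /=; rewrite ?mul1mx // IH mulmxA. Qed.

Lemma gwordE A w i j : \sum_(m <- gword w i j) cmev A m = wordval A w i j.
Proof.
elim: w i => [|k w IH] i /=.
  by rewrite mxE; case: eqP => _; rewrite ?big_seq1 ?big_nil // /cmev big_nil.
rewrite big_flatten /= big_map /= mxE big_enum; apply: eq_bigr => l _.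
by rewrite big_map -IH mulr_sumr; apply: eq_bigr => m _; rewrite /cmev big_cons.
Qed.

Section Fixed.
Variables (A : nat -> 'M[F]_n) (d : nat) (B : nat -> 'M[F]_d).
Local Notation ev := (bigeval A B).

Lemma bigeval0 : ev (qzero F n) = 0. Proof. exact: big_nil. Qed.

Lemma bigevalD P Q : ev (qadd P Q) = ev P + ev Q.
Proof. by rewrite /bigeval big_cat. Qed.

Lemma bigevalZ c P : ev (qscale c P) = c *: ev P.
Proof.
by rewrite /bigeval big_map scaler_sumr; apply: eq_bigr => t _; rewrite scalerA mulrA.
Qed.

Lemma bigevalM P Q : ev (qmul P Q) = ev P *m ev Q.
Proof.
rewrite /bigeval big_allpairs_dep /= mulmx_suml; apply: eq_bigr => s _.
rewrite mulmx_sumr; apply: eq_bigr => t _; rewrite wordval_cat /cmev big_cat /=.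
by rewrite -scalemxAl -scalemxAr scalerA mulrACA.
Qed.

Lemma bigeval_const c : ev (qconst n c) = c%:M.
Proof. by rewrite /bigeval big_seq1 /cmev big_nil mulr1 scale_scalar_mx mulr1. Qed.

Lemma bigeval_word w : ev (qword F n w) = wordval B w.
Proof. by rewrite /bigeval big_seq1 /cmev big_nil mulr1 scale1r. Qed.

Lemma bigeval_sum (I : Type) (r : seq I) (f : I -> quasipoly F n) :
  ev (qsum [seq f i | i <- r]) = \sum_(i <- r) ev (f i).
Proof.
elim: r => [|i r IH]; first by rewrite big_nil bigeval0.
by rewrite /= bigevalD IH big_cons.
Qed.

Lemma bigeval_Phi P i j : ev (qPhi P i j) = (bigeval A A P i j)%:M.
Proof.
rewrite /bigeval /qPhi big_flatten big_map summxE raddf_sum; apply: eq_bigr => t _.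
rewrite big_map mxE -gwordE /= -scaler_suml scale_scalar_mx mulr1; congr (_%:M).
rewrite mulr_sumr; apply: eq_bigr => m _; by rewrite /cmev big_cat /= mulrA.
Qed.

Lemma bigeval_tr w : ev (qtr F n w) = (\tr (wordval A w))%:M.
Proof.
rewrite /qtr bigeval_sum raddf_sum big_enum; apply: eq_bigr => i _ /=.
by rewrite bigeval_Phi /bigeval big_seq1 /cmev big_nil mulr1 scale1r.
Qed.

End Fixed.

(** A substitution enters the coefficients through Phi, which is evaluated at A alone; hence the
    pair (A, A) for the new coefficients and (A, B) for the new letters. *)
Lemma bigeval_subst A d (B : nat -> 'M[F]_d) (H : nat -> quasipoly F n) P :
  bigeval A B (qsubst H P) =
  bigeval (fun k => bigeval A A (H k)) (fun k => bigeval A B (H k)) P.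
Proof.
rewrite /qsubst bigeval_sum; apply: eq_bigr => t _.
rewrite bigevalZ bigevalM -scalerA; congr (_ *: _).
have -> : bigeval A B (qprod [seq H k | k <- t.2]) = wordval (fun k => bigeval A B (H k)) t.2.
  by elim: t.2 => [|k w IH] /=; rewrite ?bigeval_const // bigevalM IH.
rewrite -mul_scalar_mx; congr (_ *m _); rewrite /cmev.
elim: t.1.2 => [|v m IH] /=; first by rewrite big_nil bigeval_const.
by rewrite bigevalM IH bigeval_Phi big_cons scalar_mxM.
Qed.

Lemma qevalE A P : qeval A P = bigeval A A P.
Proof. by []. Qed.

(* The words are evaluated at B, the coefficients at A; the traces of words in A
   and B agree, as for B the direct sum of A and strictly upper triangular blocks. *)
Definition compat (A : nat -> 'M[F]_n) d (B : nat -> 'M[F]_d) :=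
  [/\ (n <= d)%N, forall k (x y : 'I_d), (n <= x)%N -> (y <= x)%N -> B k x y = 0 &
      forall w, w != [::] -> \tr (wordval A w) = \tr (wordval B w)].

Lemma compat_refl A : compat A A.
Proof. by split=> // k x y; rewrite leqNgt ltn_ord. Qed.

(** Adjacency matrices of a path whose successive edges are labelled by the letters of w. The entry
    from its first to its last vertex of a product along w' is 1 exactly when w' = w. *)
Definition path_mx w (k : nat) : 'M[F]_((size w).+1) :=
  \matrix_(i, j) ((j == i.+1 :> nat) && (nth 0%N w i == k))%:R.

Lemma wordval_path w w' (i j : 'I_(size w).+1) : wordval (path_mx w) w' i j =
  ((j == i + size w' :> nat)%N && (take (size w') (drop i w) == w'))%:R.
Proof.
elim: w' i => [|k w' IH] i /=.
  by rewrite mxE addn0 take0 andbT eq_sym.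
rewrite mxE; case: (ltnP i (size w)) => hi.
  have h : (i.+1 < (size w).+1)%N by [].
  rewrite (bigD1 (Ordinal h)) //= big1 ?addr0 => [|l nl]; last first.
    rewrite mxE; case: eqP => [e|]; last by rewrite mul0r.
    by case/eqP: nl; apply: val_inj.
  rewrite IH mxE /= eqxx (drop_nth 0%N hi) /= eqseq_cons addnS addSn /=.
  by case: (_ == k); case: (_ == _) => /=; rewrite ?mul1r ?mul0r ?andbF.
rewrite big1 => [|l _].
  by case: eqP => // e; have := ltn_ord j; lia.
rewrite mxE; case: eqP => [e|]; last by rewrite mul0r.
by have := ltn_ord l; rewrite e ltnS ltnNge hi.
Qed.

Lemma wordval_block d (A : nat -> 'M[F]_n) (N : nat -> 'M[F]_d) w :
  wordval (fun k => block_mx (A k) 0 0 (N k)) w =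
  block_mx (wordval A w) 0 0 (wordval N w).
Proof.
elim: w => [|k w IH] /=; first by rewrite -scalar_mx_block.
by rewrite IH mulmx_block !(mul0mx, mulmx0, addr0, add0r).
Qed.

Lemma compat_path A w : compat A (fun k => block_mx (A k) 0 0 (path_mx w k)).
Proof.
split=> [|k x y|w' nw]; first exact: leq_addr.
  case: (split_ordP x) => x' -> /=; first by rewrite leqNgt ltn_ord.
  case: (split_ordP y) => y' -> /= _; first by rewrite block_mxEdl mxE.
  by rewrite leq_add2l => h; rewrite block_mxEdr mxE; case: eqP => // e; lia.
rewrite wordval_block mxtrace_block [X in _ + X]big1 ?addr0 // => i _.
rewrite wordval_path; case: eqP => // e; case: w' nw e => //= k w' _; lia.
Qed.

Hypothesis charF0 : [pchar F] =i pred0.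

(** The corner entry of the path block keeps exactly the terms with word w; what remains is a
    polynomial function of the entries of A, whose coefficients are those of m and w. *)
Lemma qeq_bigeval P Q :
  (forall d A (B : nat -> 'M[F]_d), compat A B -> bigeval A B P = bigeval A B Q) -> qeq P Q.
Proof.
move=> PQ m w.
pose sel (R : quasipoly F n) (c : F) := [seq (c * t.1.1, t.1.2) | t <- R & t.2 == w].
have Esel R c : \sum_(t <- sel R c | perm_eq t.2 m) t.1 = c * qcoef R m w.
  rewrite big_map big_filter_cond /qcoef mulr_sumr /=.
  by apply: eq_bigl => t; rewrite andbC.
have := @pev_eq0_coef F charF0 _ (sel P 1 ++ sel Q (-1)) _ m.
rewrite big_cat /= !Esel mul1r mulN1r => H; apply/eqP; rewrite -subr_eq0; apply/eqP.
apply: H => x; pose A k : 'M[F]_n := \matrix_(i, j) x (k, i, j).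
have i0 : (0 < (size w).+1)%N by [].
have e0 : (size w < (size w).+1)%N by [].
have coefE R c : pev x (sel R c) =
    c * bigeval A (fun k => block_mx (A k) 0 0 (path_mx w k)) R
      (rshift n (Ordinal i0)) (rshift n (Ordinal e0)).
  rewrite /bigeval summxE mulr_sumr /pev big_map big_filter big_mkcond /=.
  apply: eq_bigr => t _; rewrite mxE wordval_block block_mxEdr wordval_path /= add0n drop0.
  have -> : (size w == size t.2) && (take (size t.2) w == t.2) = (t.2 == w).
    apply/andP/eqP => [[/eqP <-]|->]; first by rewrite take_size => /eqP.
    by rewrite take_size !eqxx.
  case: eqP => _; rewrite ?mulr0 // mulr1 -mulrA; congr (_ * (_ * _)).
  by apply: eq_bigr => -[[k i] j] _; rewrite mxE.
rewrite /pev big_cat /= -!/(pev _ _) !coefE (PQ _ _ _ (compat_path A w)).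
by rewrite mul1r mulN1r subrr.
Qed.

Lemma bigeval_phi A d (B : nat -> 'M[F]_d) (s : 'S_n.+1) : bigeval A B (phi_perm F s) =
  (\prod_(O in porbits s | ord_max \notin O)
    \tr (wordval A (cycle_word s (odflt ord_max [pick x in O])))) *:
  wordval B [seq nat_of_ord y | y <- traject s (s ord_max) #|porbit s ord_max|.-1].
Proof.
rewrite /phi_perm bigevalM bigeval_word -mul_scalar_mx; congr (_ *m _).
rewrite (big_morph (bigeval A B) (@bigevalM A d B) (@bigeval_const A d B 1)).
rewrite (big_morph (@scalar_mx F d) (@scalar_mxM F d) (erefl _)).
by apply: eq_bigr => O _; rewrite bigeval_tr.
Qed.

Lemma wprod_wordval d (B : nat -> 'M[F]_d) M (l : seq 'I_M) :
  wprod (fun i : 'I_M => B i) l = wordval B [seq nat_of_ord y | y <- l].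
Proof. by elim: l => //= y l ->. Qed.

(** Multiplying by X and taking the trace closes the open cycle of n+1, with X in the slot
    [ord_max]; as X varies these traces determine the matrix. The traces of words at A can be read
    at B. *)
Lemma trace_Qn A d (B : nat -> 'M[F]_d) (j0 : 'I_d) (X : 'M[F]_d) :
  (forall w, w != [::] -> \tr (wordval A w) = \tr (wordval B w)) ->
  \tr (bigeval A B (Qn F n) *m X) = \sum_(s : 'S_n.+1) (-1) ^+ odd_perm s *
    psi s (fun i : 'I_n.+1 => if i == ord_max then X else B i).
Proof.
move=> trAB; rewrite /Qn bigeval_sum big_enum mulmx_suml raddf_sum.
apply: eq_bigr => s _ /=; rewrite bigevalZ -scalemxAl mxtraceZ; congr (_ * _).
rewrite bigeval_phi -scalemxAl mxtraceZ.
(* The cycle of [ord_max] is read from the point after it, so that X comes last. *)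
pose x (O : {set 'I_n.+1}) := if ord_max \in O then s ord_max else odflt ord_max [pick x in O].
have smax O : O \in porbits s -> ord_max \in O -> O = porbit s ord_max.
  by case/imsetP=> z _ ->; rewrite -eq_porbit_mem => /eqP.
have xO O : O \in porbits s -> x O \in O.
  move=> Os; rewrite /x; case: ifP => [h|_].
    by rewrite (smax O Os h); have := mem_porbit s 1 ord_max; rewrite expg1.
  case: pickP => [//|]; case/imsetP: Os => z _ -> /(_ z); by rewrite porbit_id.
rewrite (psi_porbits j0 _ xO) [RHS](bigID (fun O : {set 'I_n.+1} => ord_max \notin O)) /=.
congr (_ * _).
  apply: eq_bigr => O /andP[Os nO]; rewrite /cycle_word trAB; last first.
    rewrite -size_eq0 size_map size_traject; exact: card_porbit_neq0.
  have -> : odflt ord_max [pick x0 in O] = x O by rewrite /x (negPf nO).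
  have porb : porbit s (x O) = O.
    have := xO O Os; case/imsetP: Os => z _ ->.
    by move=> h; apply/eqP; rewrite eq_porbit_mem.
  rewrite -wprod_wordval porb; congr (\tr _); apply: eq_wprod => i.
  rewrite -[in #|O|]porb -porbit_traject porb => iO.
  by case: eqP => // e; rewrite -e iO in nO.
set O0 := porbit s ord_max; have O0s : O0 \in porbits s by apply: imset_f.
rewrite (big_pred1 O0) => [|O]; last first.
  rewrite negbK; apply/andP/eqP => [[Os h]|->]; first exact: smax.
  by split=> //; apply: porbit_id.
rewrite /x porbit_id; set k := #|O0|.
have k0 : (0 < k)%N by rewrite lt0n card_porbit_neq0.
have U := uniq_traject_porbit s ord_max; rewrite -/O0 -/k -(prednK k0) /= in U.
case/andP: U => nmax _.
have -> : traject s (s ord_max) k = rcons (traject s (s ord_max) k.-1) ord_max.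
  by rewrite -{1}(prednK k0) trajectSr -iterSr prednK // iter_porbit.
rewrite wprod_rcons eqxx -wprod_wordval; congr (\tr (_ *m _)); apply: eq_wprod => i il.
by case: eqP => // e; rewrite e (negPf nmax) in il.
Qed.

End Evaluation.

(** * Antisymmetrized contractions lie in the T-ideal *)

Section Contraction.
Variables (F : fieldType) (n : nat).
Hypothesis charF0 : [pchar F] =i pred0.

(** Words in the slots of D and the filler outside. The unit E_(q, p) between u and v at the
    distinguished point s turns the trace along its cycle into the (p, q) entry of a product that
    starts with v and ends with u. *)
Definition spec d (B : nat -> 'M[F]_d) (j0 : 'I_d) M (D : {set 'I_M}) (s : 'I_M)
    (u v : word) (W : 'I_M -> word) (p q : 'I_d) (i : 'I_M) : 'M[F]_d :=
  if i == s then wordval B u *m delta_mx q p *m wordval B v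
  else if i \in D then wordval B (W i) else delta_mx j0 j0.

Lemma mul_delta_tr d (X Y Z : 'M[F]_d) p q :
  (X *m Y *m Z) p q = \tr (Y *m (Z *m delta_mx q p *m X)).
Proof.
rewrite mulmxA mxtrace_mulC !mulmxA; set U := X *m Y *m Z.
rewrite /mxtrace (bigD1 p) //= big1 ?addr0 => [|i ni].
  rewrite [RHS]mxE (bigD1 q) //= [delta_mx _ _ _ _]mxE !eqxx mulr1 big1 ?addr0 // => j nj.
  by rewrite [delta_mx _ _ _ _]mxE (negPf nj) mulr0.
by rewrite mxE big1 // => j _; rewrite [delta_mx _ _ _ _]mxE (negPf ni) andbF mulr0.
Qed.

Lemma wordval_strict d (A : nat -> 'M[F]_n) (B : nat -> 'M[F]_d) w (x y : 'I_d) :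
  compat A B -> w != [::] -> (n <= x)%N -> (y <= x)%N -> wordval B w x y = 0.
Proof.
move=> [_ st _]; elim: w x y => // k w IH x y _ nx yx /=.
rewrite mxE big1 // => z _; case: (leqP z x) => h; first by rewrite st // mul0r.
case: w IH => [|k' w] IH /=.
  by rewrite mxE; case: eqP => e; rewrite ?mulr0 //; move: h; rewrite e ltnNge yx.
by rewrite (IH z y) ?mulr0 //; [apply: leq_trans nx (ltnW h) | apply: leq_trans yx (ltnW h)].
Qed.

(** Here s is alone in its cycle, so the antisymmetrizer acts inside a scalar factor, which vanishes
    in dimension n. For the larger B the argument is made index by index. *)
Lemma contraction_scalar d (A : nat -> 'M[F]_n) (B : nat -> 'M[F]_d) (j0 : 'I_d) M
    (t : 'S_M) (I D : {set 'I_M}) s u v W p q :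
  compat A B -> (j0 < n)%N -> #|I| = n.+1 -> s \notin I -> t s = s ->
  (forall i, i \in D -> i != s -> W i != [::]) ->
  \sum_(r | perm_on I r) (-1) ^+ odd_perm r * psi (r * t) (spec B j0 D s u v W p q) = 0.
Proof.
move=> cAB j0n cI sI ts Wn; set H := spec _ _ _ _ _ _ _ _ _.
under eq_bigr => r _ do rewrite /psi mulr_sumr.
rewrite exchange_big big1 // => a _.
(* If all indices away from s are below n, the pigeonhole argument applies. Otherwise look at the
   largest of them: in that row the nonempty word is strictly upper triangular, the filler is zero
   since j0 < n, and the column index is not larger. *)
have [small|[i1 /andP[ni1 ai1]]] :
    (forall i, i != s -> (a i < n)%N) \/ exists i, (i != s) && (n <= a i)%N.
  case: (boolP [exists i, (i != s) && (n <= a i)%N]) => [/existsP|]; first by right.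
  rewrite negb_exists => /forallP h; left=> i ni; have := h i.
  by rewrite ni /= -ltnNge.
  pose Y (f : 'I_M -> nat) := \prod_i H i (a i) (insubd j0 (f i)).
  have := @antisym_pigeonhole F charF0 M n t I (fun i => a i) cI _ Y.
  move=> E; rewrite -[RHS]E => [|i iI|f g e].
  - by apply: eq_bigr => r _; congr (_ * _); apply: eq_bigr => i _; rewrite permM valKd.
  - apply: small; apply: contraNneq sI => e.
    by have <- : i = s by apply: (@perm_inj _ t); rewrite ts.
  - by apply: eq_bigr => i _; rewrite e.
rewrite big1 // => r rI.
have rts : (r * t)%g s = s by rewrite permM (out_perm rI sI).
case: (@arg_maxnP _ i1 (fun i => i != s) (fun i => a i : nat) ni1) => i ni imax.
rewrite (bigD1 i) //= (_ : H i _ _ = 0) ?mul0r ?mulr0 //.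
have le : (a ((r * t)%g i) <= a i)%N.
  apply: imax; apply: contraNneq ni => e.
  by apply/eqP/(@perm_inj _ (r * t)%g); rewrite rts.
have nai : (n <= a i)%N := leq_trans ai1 (imax _ ni1).
rewrite /H /spec (negPf ni); case: ifP => iD.
  by apply: (wordval_strict cAB) => //; apply: Wn.
by rewrite mxE; case: eqP => // e; move: nai; rewrite e leqNgt j0n.
Qed.

(** Induction on the number of points of D outside I. Permutations of I fix such a point, so it can
    be merged with its successor or split off as a trace without disturbing the antisymmetrizer.
    When D = I, the sum is v Q_n(W) u up to sign. The words must be nonempty because the trace of
    the empty word depends on the size. *)
Lemma in_TQn_contract M (I : {set 'I_M}) : #|I| = n.+1 ->
  forall (D : {set 'I_M}) (t : 'S_M) (s : 'I_M) (u v : word) (W : 'I_M -> word),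
  I \subset D -> perm_on D t -> s \in D -> (forall i, i \in D -> i != s -> W i != [::]) ->
  exists P : quasipoly F n, in_TQn P /\
    forall d (A : nat -> 'M[F]_n) (B : nat -> 'M[F]_d) (j0 p q : 'I_d),
      compat A B -> (j0 < n)%N ->
      bigeval A B P p q = \sum_(r | perm_on I r) (-1) ^+ odd_perm r *
        psi (r * t) (spec B j0 D s u v W p q).
Proof.
move=> cI D; have [k] := ubnP #|D :\: I|.
elim: k D => // k IH D; rewrite ltnS => kD t s u v W ID tD sD Wn.
(* The common merging step: j disappears from D, and the new data must reproduce the product placed
   at t j. *)
have cut j s' u' v' W' : j \in D -> j \notin I -> t j != j ->
    s' \in D -> s' != j -> (forall i, i \in D -> i != s' -> i != j -> W' i != [::]) ->
    (forall d (B : nat -> 'M[F]_d) (j0 p q : 'I_d) i, i != j ->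
      spec B j0 (D :\ j) s' u' v' W' p q i =
      if i == t j then spec B j0 D s u v W p q j *m spec B j0 D s u v W p q (t j)
      else spec B j0 D s u v W p q i) ->
  exists P : quasipoly F n, in_TQn P /\
    forall d (A : nat -> 'M[F]_n) (B : nat -> 'M[F]_d) (j0 p q : 'I_d),
      compat A B -> (j0 < n)%N ->
      bigeval A B P p q = \sum_(r | perm_on I r) (-1) ^+ odd_perm r *
        psi (r * t) (spec B j0 D s u v W p q).
  move=> jD jI tj s'D s'j W'n E.
  have tjD : t j \in D by rewrite (perm_closed _ tD).
  have [||||//|P [TP EP]] := IH (D :\ j) _ (t * tperm j (t j))%g s' u' v' W'.
  - apply: leq_trans kD; apply: proper_card; apply/properP; split.
      by apply: setSD; apply: subD1set.
    by exists j; rewrite !inE ?eqxx ?jI ?jD ?andbF.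
  - apply/subsetP=> i iI; rewrite !inE (subsetP ID) // andbT.
    by apply: contraNneq jI => <-.
  - apply/subsetP=> i; rewrite !inE permM => ni.
    have nij : i != j by apply: contraNneq ni => ->; rewrite tpermR.
    rewrite nij /=; apply: contraNT ni => iD; rewrite (out_perm tD iD).
    by rewrite tpermD //; [rewrite eq_sym | apply: contraNneq iD => <-].
  - by rewrite !inE s'j.
  - by move=> i; rewrite !inE => /andP[nij iD] nis; apply: W'n.
  exists P; split=> // d A B j0 p q cAB j0n; rewrite (EP _ _ _ j0) //.
  apply: eq_bigr => r rI; congr (_ * _).
  have rtj : (r * t)%g j = t j by rewrite permM (out_perm rI jI).
  rewrite (psi_cut j0 (s := (r * t)%g) _ (j := j)) rtj // mulgA; apply: eq_psi => i.
  rewrite /upd; case: eqVneq => [->|nij]; last exact: E.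
  by rewrite /spec eq_sym (negPf s'j) !inE eqxx.
(* A distinguished point outside I absorbs its successor, which becomes distinguished with v
   extended to the right; if it is a fixed point, the sum is 0. *)
have [sI|sI] := boolP (s \in I); last first.
  case: (eqVneq (t s) s) => ts.
    exists (qzero F n); split=> [|d A B j0 p q cAB j0n]; first exact: TQ_zero.
    by rewrite bigeval0 mxE (contraction_scalar _ _ _ _ cAB).
  have tsD : t s \in D by rewrite (perm_closed _ tD).
  apply: (cut s (t s) u (v ++ W (t s)) W) => //.
    by move=> i iD _ ni; apply: Wn.
  move=> d B j0 p q i nis; rewrite /spec !inE eqxx (negPf ts) tsD nis (negPf nis) /=.
  by case: (eqVneq i (t s)) => [_|//]; rewrite wordval_cat !mulmxA.
case: (set_0Vmem (D :\: I)) => [D0|[j]]; last first.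
  rewrite inE => /andP[jI jD].
  have js : j != s by apply: contraNneq jI => ->.
  (* A fixed point j outside I contributes the trace of its word, an element of C. *)
  case: (eqVneq (t j) j) => tj.
    have [||||//|P [TP EP]] := IH (D :\ j) _ t s u v W.
    - apply: leq_trans kD; apply: proper_card; apply/properP; split.
        by apply: setSD; apply: subD1set.
      by exists j; rewrite !inE ?eqxx ?jI ?jD ?andbF.
    - apply/subsetP=> i iI; rewrite !inE (subsetP ID) // andbT.
      by apply: contraNneq jI => <-.
    - apply/subsetP=> i; rewrite !inE => ni; apply/andP; split.
        by apply: contraNneq ni => ->; rewrite tj.
      by apply: contraNT ni => iD; rewrite (out_perm tD iD).
    - by rewrite !inE eq_sym js.
    - by move=> i; rewrite !inE => /andP[nij iD] nis; apply: Wn.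
    exists (qmul (qmul (qtr F n (W j)) P) (qone F n)); split=> [|d A B j0 p q cAB j0n].
      exact: TQ_mul.
    rewrite !bigevalM bigeval_tr bigeval_const mulmx1 mul_scalar_mx mxE (EP _ _ _ j0) // mulr_sumr.
    apply: eq_bigr => r rI; rewrite mulrCA; congr (_ * _).
    rewrite [in RHS](psi_fix j0 _ (j := j)); last by rewrite permM (out_perm rI jI).
    case: cAB => _ _ ->; last exact: Wn.
    rewrite {2}/spec (negPf js) jD; congr (_ * _); apply: eq_psi => i; rewrite /upd /spec !inE.
    by case: (eqVneq i j) => [->|nij]; rewrite ?(negPf js).
  have tjD : t j \in D by rewrite (perm_closed _ tD).
  case: (eqVneq (t j) s) => tjs.
    apply: (cut j s (W j ++ u) v W) => //; first by rewrite eq_sym.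
      by move=> i iD nis _; apply: Wn.
    move=> d B j0 p q i nij; rewrite /spec !inE tjs eqxx (negPf js) jD nij /=.
    by case: eqVneq => // _; rewrite wordval_cat !mulmxA.
  apply: (cut j s u v (fun i => if i == t j then W j ++ W i else W i)) => //.
  - by rewrite eq_sym.
  - move=> i iD nis nij; case: ifP => _; last exact: Wn.
    by case: (W j) (Wn j jD js).
  - move=> d B j0 p q i nij; rewrite /spec !inE (negPf js) (negPf tjs) jD tjD nij /=.
    case: (eqVneq i (t j)) => [->|ni]; first by rewrite (negPf tjs) tjD wordval_cat.
    by [].
have DI : D = I by apply/eqP; rewrite eqEsubset ID -setD_eq0 D0 eqxx.
subst D.
(* The points of I are listed with s last, so that s takes the place of [ord_max] in Q_n. *)
pose l := rcons (enum (I :\ s)) s.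
have szl : size l = n.+1.
  by rewrite size_rcons -cardE; have := cardsD1 s I; rewrite sI cI add1n => <-.
have ul : uniq l by rewrite rcons_uniq mem_enum !inE eqxx enum_uniq.
have meml i : (i \in l) = (i \in I).
  by rewrite mem_rcons inE mem_enum !inE; case: eqVneq => // ->.
pose h (i : 'I_n.+1) := nth s l i.
have inj_h : injective h.
  by move=> i j /eqP; rewrite nth_uniq ?szl // => /eqP/val_inj.
have Ih : I =i codom h.
  move=> i; rewrite -meml; apply/idP/codomP => [il|[j ->]]; last by rewrite mem_nth ?szl.
  have hi : (index i l < n.+1)%N by rewrite -szl index_mem.
  by exists (Ordinal hi); rewrite /h nth_index.
have hmax : h ord_max = s.
  have e : size (enum (I :\ s)) = n by move: szl; rewrite size_rcons => -[].
  by rewrite /h /= nth_rcons e ltnn eqxx.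
have [t' Et] := perm_on_ext inj_h Ih tD.
(* Q_n involves the letters below n; the default [[:: 0%N]] keeps every substituted word
   nonempty. *)
pose W2 j : word := if (j < n)%N then W (h (inord j)) else [:: 0%N].
have hns (i : 'I_n.+1) : i != ord_max -> h i != s.
  by move=> ni; rewrite -hmax (inj_eq inj_h).
have W2n j : W2 j != [::].
  rewrite /W2; case: ltnP => // hj; apply: Wn; first by rewrite Ih codom_f.
  apply: hns; rewrite -(inj_eq val_inj) /= inordK; first by rewrite ltn_eqF.
  exact: ltnW.
(* The sign comes from absorbing t' into the summation variable of the antisymmetrizer. *)
exists (qmul (qmul (qscale ((-1) ^+ odd_perm t') (qword F n v))
    (qsubst (fun k => qword F n (W2 k)) (Qn F n))) (qword F n u)).
split=> [|d A B j0 p q cAB j0n]; first by apply: TQ_mul; apply: TQ_subst; apply: TQ_gen.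
rewrite !bigevalM bigevalZ !bigeval_word -!scalemxAl mxE mul_delta_tr bigeval_subst.
rewrite (trace_Qn j0) => [|w nw]; last first.
  have flat c (C : nat -> 'M[F]_c) : wordval (fun k => bigeval A C (qword F n (W2 k))) w =
      wordval C (flatten [seq W2 k | k <- w]).
    elim: w {nw} => //= j w IHw; by rewrite IHw bigeval_word wordval_cat.
  rewrite !flat; case: cAB => _ _; apply.
  by case: w nw {flat} => //= j w _; case: (W2 j) (W2n j).
rewrite (sum_perm_on_ext inj_h) // mulr_sumr (reindex_inj (mulIg t')) /=.
apply: eq_bigr => r _; rewrite odd_ext_perm Et -ext_permM (psi_ext (j0 := j0)) => [|x nx].
  rewrite odd_permM signr_addb mulrA [_ * (_ * _)]mulrCA -signr_addb addbb mulr1.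
  congr (_ * _); apply: eq_psi => i; rewrite /spec.
  case: (eqVneq i ord_max) => [->|ni]; first by rewrite hmax eqxx.
  rewrite (negPf (hns i ni)) Ih codom_f bigeval_word; congr (wordval B _).
  have lt : (i < n)%N.
    have := ltn_ord i; rewrite ltnS leq_eqVlt => /orP[/eqP e|//].
    by case/eqP: ni; apply: val_inj.
  by rewrite /W2 lt inord_val.
rewrite /spec Ih (negPf nx); case: eqVneq => // e.
by rewrite e -Ih sI in nx.
Qed.

End Contraction.

(** * Trace identities *)

Section TraceIdentities.
Variables (F : fieldType) (n N : nat).
Hypothesis charF0 : [pchar F] =i pred0.
Hypothesis n_gt0 : (0 < n)%N.

(* Slot 0 is the special point n+1 of the cycle notation; the letter k j sits in
   slot j+1. *)
Definition slots d (B : nat -> 'M[F]_d) m (k : {ffun 'I_m -> 'I_N}) (p q : 'I_d)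
    (i : 'I_m.+1) : 'M[F]_d :=
  if unlift ord0 i is Some j then B (k j) else delta_mx q p.

(** Coefficients of a homogeneous trace polynomial of degree m: the cycle of slot 0 under s gives
    the open word, the other cycles give the traces. *)
Definition tpoly m := {ffun 'I_m -> 'I_N} -> 'S_m.+1 -> F.

Definition tpev m (C : tpoly m) d (B : nat -> 'M[F]_d) (p q : 'I_d) : F :=
  \sum_k \sum_s C k s * psi s (slots B k p q).

Definition fperm m (T : finType) (k : {ffun 'I_m -> T}) (t : 'S_m) : {ffun 'I_m -> T} :=
  [ffun j => k (t j)].

Definition lift0 m (t : 'S_m) : 'S_m.+1 := ext_perm (@lift_inj m.+1 ord0) t.

Lemma lift0_0 m (t : 'S_m) : lift0 t ord0 = ord0.
Proof.
by apply: ext_perm_out; apply/codomP=> -[i /eqP]; rewrite (negPf (neq_lift _ _)).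
Qed.

Lemma lift0_lift m (t : 'S_m) i : lift0 t (lift ord0 i) = lift ord0 (t i).
Proof. exact: ext_permE. Qed.

Lemma slots_lift d (B : nat -> 'M[F]_d) m (k : {ffun 'I_m -> 'I_N}) p q i :
  slots B k p q (lift ord0 i) = B (k i).
Proof. by rewrite /slots liftK. Qed.

Lemma slots_0 d (B : nat -> 'M[F]_d) m (k : {ffun 'I_m -> 'I_N}) p q :
  slots B k p q ord0 = delta_mx q p.
Proof. by rewrite /slots unlift_none. Qed.

Lemma slots_fperm d (B : nat -> 'M[F]_d) m (k : {ffun 'I_m -> 'I_N}) (t : 'S_m) p q i :
  slots B (fperm k t) p q i = slots B k p q (lift0 t i).
Proof.
case: (unliftP ord0 i) => [j ->|->]; last by rewrite lift0_0 !slots_0.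
by rewrite lift0_lift !slots_lift ffunE.
Qed.

Lemma fperm_bij m (T : finType) (t : 'S_m) : bijective (fun k : {ffun 'I_m -> T} => fperm k t).
Proof.
by exists (fun k => fperm k t^-1%g) => k; apply/ffunP=> i; rewrite !ffunE ?permK ?permKV.
Qed.

(** Sum over simultaneous permutations of the letters and of the slots other than 0. Polarization
    sees only such sums, so it is these coefficients that act by 0 on tensors. *)
Definition tsym m (C : tpoly m) : tpoly m := fun k r =>
  \sum_(t : 'S_m) C (fperm k t) (lift0 t * r * (lift0 t)^-1)%g.

Lemma tpev_sym m (C : tpoly m) d (B : nat -> 'M[F]_d) p q :
  tpev (tsym C) B p q = (m`!)%:R * tpev C B p q.
Proof.
transitivity (\sum_(t : 'S_m) tpev C B p q); last first.
  by rewrite sumr_const -[LHS]mulr_natl -(card_Sn m).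
rewrite /tpev; under eq_bigr => k _.
  under eq_bigr => s _ do rewrite /tsym mulr_suml.
  rewrite exchange_big; over.
rewrite exchange_big; apply: eq_bigr => t _ /=.
rewrite [RHS](reindex _ (onW_bij _ (fperm_bij 'I_N t))) /=; apply: eq_bigr => k _.
rewrite (reindex_inj (@conjg_inj _ (lift0 t))); apply: eq_bigr => s _ /=.
rewrite conjgE !mulgA mulgV mul1g mulgK psi_conj; congr (_ * _).
by apply: eq_psi => i; rewrite slots_fperm.
Qed.

(** At A_l = sum_i s_i [l = k i] E_(a (i+1), b (i+1)) and the entry (b 0, a 0), the multilinear
    coefficient in s of the identity is the tensor action at (b, a). *)
Lemma acts0_tsym m (C : tpoly m) : (forall A p q, @tpev m C n A p q = 0) ->
  forall k, acts0 n [ffun r => tsym C k r].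
Proof.
move=> C0 k a b.
pose As (s : 'I_m -> F) (l : nat) : 'M[F]_n := \matrix_(x, y) \sum_i s i *
  [&& l == k i, x == a (lift ord0 i) & y == b (lift ord0 i)]%:R.
pose G (f : {ffun 'I_m -> 'I_m}) := \sum_(k' : {ffun 'I_m -> 'I_N}) \sum_s C k' s *
  \sum_(c : {ffun 'I_m.+1 -> 'I_n}) ((c ord0 == a ord0) && (c (s ord0) == b ord0))%:R *
    \prod_j [&& k' j == k (f j) :> nat, c (lift ord0 j) == a (lift ord0 (f j)) &
      c (s (lift ord0 j)) == b (lift ord0 (f j))]%:R.
have GE (s : 'I_m -> F) : \sum_f G f * \prod_j s (f j) = 0.
  rewrite -[RHS](C0 (As s) (b ord0) (a ord0)) /tpev.
  under eq_bigr => f _ do rewrite mulr_suml.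
  rewrite exchange_big; apply: eq_bigr => k' _.
  under eq_bigr => f _ do rewrite mulr_suml.
  rewrite exchange_big; apply: eq_bigr => r _; rewrite /psi.
  under eq_bigr => f _ do rewrite -mulrA mulr_suml.
  rewrite -mulr_sumr exchange_big; congr (_ * _); apply: eq_bigr => c _ /=.
  rewrite big_ord_recl slots_0 mxE.
  under [X in _ = _ * X]eq_bigr => j _ do rewrite slots_lift mxE.
  rewrite bigA_distr_bigA mulr_sumr; apply: eq_bigr => f _ /=.
  by rewrite -mulrA; congr (_ * _); rewrite mulrC big_split.
have := polarization_multilinear charF0 GE => GS.
transitivity (\sum_(t : 'S_m) G [ffun j => t j]); last exact: GS.
under eq_bigr => r _ do rewrite ffunE /tsym mulr_suml.
rewrite exchange_big; apply: eq_bigr => t _ /=; rewrite /G.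
rewrite (bigD1 (fperm k t)) //= [X in _ = _ + X]big1 ?addr0 => [|k' nk']; last first.
  rewrite big1 // => r _; rewrite big1 ?mulr0 // => c _.
  have [j nj] : exists j, k' j != k (t j).
    apply/existsP; apply: contraNT nk'; rewrite negb_exists => /forallP h.
    by apply/eqP/ffunP=> j; rewrite ffunE; apply/eqP; rewrite -[_ == _]negbK.
  rewrite (bigD1 j) //= !ffunE (_ : (k' j == _ :> nat) = false) ?mul0r ?mulr0 //.
  by apply/negbTE; rewrite (inj_eq val_inj).
rewrite (reindex_inj (@conjg_inj _ (lift0 t))); apply: eq_bigr => s _ /=.
rewrite conjgE !mulgA mulgV mul1g mulgK; congr (_ * _).
pose c0 : {ffun 'I_m.+1 -> 'I_n} := [ffun i => a (lift0 t i)].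
rewrite (bigD1 c0) //= [X in _ = _ + X]big1 ?addr0 => [|c nc]; last first.
  have [i ni] : exists i, c i != a (lift0 t i).
    apply/existsP; apply: contraNT nc; rewrite negb_exists => /forallP h.
    by apply/eqP/ffunP=> i; rewrite ffunE; apply/eqP; rewrite -[_ == _]negbK.
  move: ni; case: (unliftP ord0 i) => [j ->|->]; last first.
    by rewrite lift0_0 => /negPf->; rewrite mul0r.
  by rewrite lift0_lift (bigD1 j) //= !ffunE => /negPf->; rewrite andbF mul0r mulr0.
have condE : (b == [ffun i => a (((lift0 t)^-1 * s * lift0 t)%g i)]) =
    [forall i, c0 (s i) == b (lift0 t i)].
  apply/eqP/forallP => [-> i|h].
    by rewrite !ffunE !permM permK eqxx.
  apply/ffunP=> i; have /eqP := h ((lift0 t)^-1%g i).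
  by rewrite !ffunE permKV !permM => <-.
rewrite {}condE; case: (boolP [forall i, _]) => [/forallP h|].
  rewrite (eqP (h ord0)) lift0_0 ffunE lift0_0 !eqxx mul1r big1 // => j _.
  by rewrite (eqP (h _)) !ffunE lift0_lift !eqxx.
rewrite negb_forall => /existsP[i]; case: (unliftP ord0 i) => [j ->|->].
  by rewrite lift0_lift (bigD1 j) //= !ffunE => /negPf->; rewrite !andbF mul0r mulr0.
by rewrite lift0_0 => /negPf->; rewrite andbF mul0r.
Qed.

(** The property fed to [tensor_kernel] is realizability in the T-ideal; for an antisymmetrizer,
    slot 0 is the distinguished point and the words are single letters. *)
Lemma in_TQn_zeltwise m (k : {ffun 'I_m -> 'I_N}) (c : {ffun 'S_m.+1 -> F}) : acts0 n c ->
  exists P : quasipoly F n, in_TQn P /\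
    forall d (A : nat -> 'M[F]_n) (B : nat -> 'M[F]_d) p q, compat A B ->
      bigeval A B P p q = \sum_s c s * psi s (slots B k p q).
Proof.
move: c; apply: (tensor_kernel charF0 (n := n)).
- exists (qzero F n); split=> [|d A B p q _]; first exact: TQ_zero.
  by rewrite bigeval0 mxE big1 // => s _; rewrite ffunE mul0r.
- move=> c c' [P [TP EP]] [Q [TQ EQ]]; exists (qadd P Q); split=> [|d A B p q cAB].
    exact: TQ_add.
  by rewrite bigevalD mxE EP // EQ // -big_split; apply: eq_bigr => s _; rewrite ffunE mulrDl.
- move=> x c [P [TP EP]]; exists (qmul (qmul (qconst n x) P) (qone F n)); split.
    exact: TQ_mul.
  move=> d A B p q cAB; rewrite !bigevalM !bigeval_const mulmx1 mul_scalar_mx mxE EP //.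
  by rewrite mulr_sumr; apply: eq_bigr => s _; rewrite ffunE mulrA.
- move=> t I cI.
  pose W (i : 'I_m.+1) : word := if unlift ord0 i is Some j then [:: nat_of_ord (k j)] else [::].
  have [||||P [TP EP]] := @in_TQn_contract F n charF0 m.+1 I cI setT t ord0 [::] [::] W.
  + exact: subsetT.
  + by apply/subsetP=> i _; rewrite inE.
  + by rewrite inE.
  + by move=> i _; rewrite /W; case: (unliftP ord0 i) => // ->; rewrite eqxx.
  exists P; split=> // d A B p q cAB; have [nd _ _] := cAB.
  rewrite (EP _ _ _ (Ordinal (leq_trans n_gt0 nd))) // sum_zelt; apply: eq_bigr => r _.
  congr (_ * _); apply: eq_psi => i; rewrite /spec inE.
  case: (unliftP ord0 i) => [j ->|->]; last by rewrite eqxx slots_0 /= mul1mx mulmx1.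
  by rewrite eq_sym (negPf (neq_lift _ _)) slots_lift /W liftK /= mulmx1.
Qed.

Lemma homogeneous_trace_identity m (C : tpoly m) :
  (forall A p q, @tpev m C n A p q = 0) ->
  exists P : quasipoly F n, in_TQn P /\
    forall d (A : nat -> 'M[F]_n) (B : nat -> 'M[F]_d) p q, compat A B ->
      bigeval A B P p q = tpev C B p q.
Proof.
move=> C0; have [Pk EPk] := fin_all_exists (fun k => in_TQn_zeltwise k (acts0_tsym C0 k)).
exists (qmul (qmul (qconst n (m`!)%:R^-1) (qsum [seq Pk k | k <- enum {ffun 'I_m -> 'I_N}]))
  (qone F n)); split.
  apply: TQ_mul; elim: (enum _) => [|k r IH] /=; first exact: TQ_zero.
  by apply: TQ_add IH; case: (EPk k).
move=> d A B p q cAB; rewrite !bigevalM !bigeval_const mulmx1 mul_scalar_mx mxE.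
rewrite bigeval_sum summxE big_enum.
have nz : (m`!)%:R != 0 :> F by rewrite -(prednK (fact_gt0 m)) natrS_neq0.
apply: (mulfI nz); rewrite mulVKf // -tpev_sym /tpev; apply: eq_bigr => k _.
have [_ ->] := EPk k; last by [].
by apply: eq_bigr => s _; rewrite ffunE.
Qed.

Lemma psi_scale_slots d (B : nat -> 'M[F]_d) m (k : {ffun 'I_m -> 'I_N}) p q s c :
  psi s (slots (fun l => c *: B l) k p q) = c ^+ m * psi s (slots B k p q).
Proof.
rewrite /psi mulr_sumr; apply: eq_bigr => a _; rewrite !big_ord_recl !slots_0 mulrCA.
congr (_ * _); under eq_bigr => i _ do rewrite slots_lift mxE.
rewrite big_split prodr_const card_ord; congr (_ * _).
by apply: eq_bigr => i _; rewrite slots_lift.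
Qed.

(** Scaling all matrices by s separates the degrees. The hypothesis concerns size n, the conclusion
    all compatible pairs. *)
Theorem trace_identity_in_TQn (D : nat) (C : forall m, tpoly m) :
  (forall A p q, \sum_(m < D) @tpev m (C m) n A p q = 0) ->
  exists P : quasipoly F n, in_TQn P /\
    forall d (A : nat -> 'M[F]_n) (B : nat -> 'M[F]_d) p q, compat A B ->
      bigeval A B P p q = \sum_(m < D) tpev (C m) B p q.
Proof.
move=> C0.
have Cm0 (m : 'I_D) A p q : @tpev m (C m) n A p q = 0.
  pose f : {poly F} := \poly_(l < D) tpev (C l) A p q.
  have : f = 0.
    apply: (poly_fun_eq0 charF0) => s; rewrite horner_poly.
    rewrite -[RHS](C0 (fun l => s *: A l) p q); apply: eq_bigr => l _.
    rewrite /tpev mulr_suml; apply: eq_bigr => k _; rewrite mulr_suml.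
    by apply: eq_bigr => r _; rewrite psi_scale_slots -mulrA [_ * s ^+ _]mulrC.
  move/(congr1 (fun g : {poly F} => g`_m)); by rewrite coef_poly ltn_ord coef0.
have [P EP] := fin_all_exists (fun m : 'I_D => homogeneous_trace_identity (Cm0 m)).
exists (qsum [seq P m | m <- enum 'I_D]); split.
  elim: (enum _) => [|k r IH] /=; first exact: TQ_zero.
  by apply: TQ_add IH; case: (EP k).
move=> d A B p q cAB; rewrite bigeval_sum summxE big_enum; apply: eq_bigr => m _.
by have [_ ->] := EP m.
Qed.

End TraceIdentities.

(** * Expressions given by trace polynomials on compatible pairs *)

Section Representable.
Variables (F : fieldType) (n N : nat).

(** A product of traces times an open word is one contraction: the letters of the word are inserted
    into the cycle of slot 0. The equation for m avoids casts between the types of permutations. *)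
Lemma psi_word m0 (s : 'S_m0) (k : {ffun 'I_m0 -> 'I_N}) (w : word) :
  (forall l, l \in w -> (l < N)%N) -> forall m, m = (m0 + size w)%N ->
  exists (k' : {ffun 'I_m -> 'I_N}) (s' : 'S_m.+1),
    forall d (B : nat -> 'M[F]_d) p q,
      psi s (fun j => B (k j)) * wordval B w p q = psi s' (slots B k' p q).
Proof.
elim/last_ind: w => [|w x IH] wN m Em.
  rewrite addn0 in Em; subst m; exists k, (lift0 s) => d B p q.
  rewrite (psi_fix p _ (j := ord0)) ?lift0_0 // slots_0 mxtrace_delta mxE eq_sym mulrC.
  congr (_ * _); rewrite (psi_ext (j0 := p)).
    by apply: eq_psi => i; rewrite /upd eq_sym (negPf (neq_lift _ _)) slots_lift.
  move=> i ni; rewrite /upd; case: (unliftP ord0 i) => [j ej|->]; last by rewrite eqxx.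
  by rewrite ej codom_f in ni.
rewrite size_rcons addnS in Em; subst m.
have [|k1 [s1 E1]] := IH _ _ (erefl _).
  by move=> l lw; apply: wN; rewrite mem_rcons inE lw orbT.
have xN : (x < N)%N by apply: wN; rewrite mem_rcons mem_head.
set m := (m0 + size w)%N in k1 s1 E1 *.
pose k' : {ffun 'I_m.+1 -> 'I_N} :=
  [ffun i => if unlift ord_max i is Some i' then k1 i' else Ordinal xN].
pose e := ext_perm (@lift_inj m.+2 ord_max) s1.
have emax : e ord_max = ord_max.
  by apply: ext_perm_out; apply/codomP=> -[i /eqP]; rewrite (negPf (neq_lift _ _)).
(* The new slot [ord_max] is inserted immediately before slot 0, that is, at the end of the open
   word. *)
exists k', (e * tperm ord_max ord0)%g => d B p q.
have s'j : (e * tperm ord_max ord0)%g ord_max = ord0 by rewrite permM emax tpermL.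
have -> : psi (e * tperm ord_max ord0) (slots B k' p q) = psi e
    (upd (upd (slots B k' p q) ord0 (slots B k' p q ord_max *m slots B k' p q ord0))
      ord_max (delta_mx p p)).
  by rewrite (psi_cut p _ (j := ord_max)) s'j // -mulgA tperm2 mulg1.
rewrite (psi_ext (j0 := p)); last first.
  move=> i ni; rewrite /upd; case: (unliftP ord_max i) => [j ej|->]; last by rewrite eqxx.
  by rewrite ej codom_f in ni.
rewrite -cats1 wordval_cat mxE mulr_sumr /= mulmx1.
under eq_bigr => r _ do rewrite mulrA E1.
rewrite /psi; under eq_bigr => r _ do rewrite mulr_suml.
rewrite exchange_big; apply: eq_bigr => a _ /=; rewrite [in RHS]big_ord_recl.
under eq_bigr => r _.
  rewrite big_ord_recl slots_0 mulrAC (eq_bigr _ (fun i _ =>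
    congr1 (fun X : 'M[F]_d => X _ _) (slots_lift B k1 p r i))).
  over.
rewrite -mulr_suml; congr (_ * _).
  have l0 : lift ord_max ord0 = ord0 :> 'I_m.+2 by apply: val_inj.
  have lm : ord_max = lift ord0 ord_max :> 'I_m.+2 by apply: val_inj.
  rewrite /upd l0 eqxx /= {1}lm slots_lift slots_0 ffunE unlift_none mxE.
  rewrite (bigD1 (a ord0)) //= [X in _ + X]big1 ?addr0 => [|r nr]; last first.
    by rewrite mxE eq_sym (negPf nr) mul0r.
  rewrite [RHS](bigD1 q) //= [X in _ = _ + X]big1 ?addr0 => [|r nr]; last first.
    by rewrite mxE (negPf nr) mulr0.
  by rewrite !mxE !eqxx mulrC.
apply: eq_bigr => i _; rewrite /upd.
have -> : lift ord_max (lift ord0 i) = lift ord0 (lift ord_max i) :> 'I_m.+2.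
  by apply: val_inj; rewrite /= /bump /=; have := ltn_ord i; lia.
have -> : (lift ord0 (lift ord_max i) == ord_max :> 'I_m.+2) = false.
  by rewrite -(inj_eq val_inj) /= /bump /=; have := ltn_ord i; lia.
by rewrite eq_sym (negPf (neq_lift _ _)) slots_lift ffunE liftK.
Qed.

(** A contraction along s is a product of traces of words, nonempty because cycles are; for m = 0 it
    is 1 in every size. *)
Lemma psi_compat (A : nat -> 'M[F]_n) d (B : nat -> 'M[F]_d) m (s : 'S_m) (k : {ffun 'I_m -> 'I_N}) :
  (0 < n)%N -> compat A B -> psi s (fun j => A (k j)) = psi s (fun j => B (k j)).
Proof.
move=> n0 [nd _ trAB].
have psi0 c (r : 'S_0) (H : 'I_0 -> 'M[F]_c) : psi r H = 1.
  rewrite /psi (eq_bigr (fun=> 1)) => [|a _]; last by rewrite big_ord0.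
  by rewrite sumr_const card_ffun !card_ord expn0.
case: m s k => [|m] s k; first by rewrite !psi0.
pose x (O : {set 'I_m.+1}) := odflt ord0 [pick i in O].
have xO O : O \in porbits s -> x O \in O.
  case/imsetP=> z _ ->; rewrite /x; case: pickP => // /(_ z); by rewrite porbit_id.
rewrite (psi_porbits (Ordinal n0) _ xO) (psi_porbits (Ordinal (leq_trans n0 nd)) _ xO).
apply: eq_bigr => O Os.
have wE c (C : nat -> 'M[F]_c) (l : seq 'I_m.+1) : wprod (fun j => C (k j)) l =
    wordval C [seq nat_of_ord (k j) | j <- l] by elim: l => //= j l ->.
rewrite !wE trAB // -size_eq0 size_map size_traject.
by case/imsetP: Os => z _ ->; apply: card_porbit_neq0.
Qed.

(** The coefficients are independent of d, A and B, so an identity verified at B = A can be lifted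
    with the same C. *)
Definition rep (Phi : forall d, (nat -> 'M[F]_n) -> (nat -> 'M[F]_d) -> 'I_d -> 'I_d -> F) :=
  exists D (C : forall m, tpoly F N m), forall d A (B : nat -> 'M[F]_d) p q, compat A B ->
    Phi d A B p q = \sum_(m < D) tpev (C m) B p q.

Lemma rep0 : rep (fun _ _ _ _ _ => 0).
Proof. by exists 0%N, (fun _ _ _ => 0) => *; rewrite big_ord0. Qed.

Lemma repD Phi Psi : rep Phi -> rep Psi -> rep (fun d A B p q => Phi d A B p q + Psi d A B p q).
Proof.
move=> [D [C E]] [D' [C' E']].
exists (D + D')%N, (fun m k s => (m < D)%N%:R * C m k s + (m < D')%N%:R * C' m k s).
move=> d A B p q cAB; rewrite E // E' //.
have wid (D1 D2 : nat) (C1 : forall m, tpoly F N m) : (D1 <= D2)%N ->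
    \sum_(m < D1) tpev (C1 m) B p q = \sum_(m < D2) (m < D1)%N%:R * tpev (C1 m) B p q.
  move=> le; rewrite (big_ord_widen _ (fun m => tpev (C1 m) B p q) le) big_mkcond.
  by apply: eq_bigr => m _; case: ltnP; rewrite ?mul1r ?mul0r.
rewrite (wid D (D + D')%N) ?leq_addr // (wid D' (D + D')%N) ?leq_addl // -big_split.
apply: eq_bigr => m _ /=; rewrite /tpev !mulr_sumr -big_split; apply: eq_bigr => k _.
rewrite /= !mulr_sumr -big_split; apply: eq_bigr => s _ /=.
by rewrite mulrDl !mulrA.
Qed.

Lemma repZ c Phi : rep Phi -> rep (fun d A B p q => c * Phi d A B p q).
Proof.
move=> [D [C E]]; exists D, (fun m k s => c * C m k s) => d A B p q cAB.
rewrite E // mulr_sumr; apply: eq_bigr => m _; rewrite /tpev mulr_sumr.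
by apply: eq_bigr => k _; rewrite mulr_sumr; apply: eq_bigr => s _; rewrite mulrA.
Qed.

Lemma rep_ext Phi Psi : rep Phi ->
  (forall d A (B : nat -> 'M[F]_d) p q, compat A B -> Phi d A B p q = Psi d A B p q) -> rep Psi.
Proof. by move=> [D [C E]] e; exists D, C => d A B p q cAB; rewrite -e // E. Qed.

Lemma rep_sum (I : Type) (r : seq I)
    (Phi : I -> forall d, (nat -> 'M[F]_n) -> (nat -> 'M[F]_d) -> 'I_d -> 'I_d -> F) :
  (forall i, rep (Phi i)) -> rep (fun d A B p q => \sum_(i <- r) Phi i d A B p q).
Proof.
move=> H; elim: r => [|i r IH]; first by apply: (rep_ext rep0) => *; rewrite big_nil.
by apply: (rep_ext (repD (H i) IH)) => *; rewrite big_cons.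
Qed.

Lemma rep_psi m (k : {ffun 'I_m -> 'I_N}) (s : 'S_m.+1) :
  rep (fun d A B p q => psi s (slots B k p q)).
Proof.
pose T m := ({ffun 'I_m -> 'I_N} * 'S_m.+1)%type.
(* Tagged pairs allow permutations of different degrees to be compared. *)
exists m.+1, (fun m' k' s' => (Tagged T (k', s') == Tagged T (k, s))%:R) => d A B p q _.
rewrite (bigD1 ord_max) //= [X in _ + X]big1 ?addr0 => [|m' nm]; last first.
  rewrite /tpev big1 // => k' _; rewrite big1 // => s' _.
  rewrite -tag_eqE /tag_eq /= (_ : (m' == m :> nat) = false) ?mul0r //.
  by apply/negbTE; apply: contraNneq nm => e; apply/eqP/val_inj.
rewrite /tpev (bigD1 k) //= [X in _ + X]big1 ?addr0 => [|k' nk]; last first.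
  by rewrite big1 // => s' _; rewrite eq_Tagged xpair_eqE (negPf nk) mul0r.
rewrite (bigD1 s) //= [X in _ + X]big1 ?addr0 => [|s' ns]; last first.
  by rewrite eq_Tagged xpair_eqE (negPf ns) andbF mul0r.
by rewrite eqxx mul1r.
Qed.

Lemma rep_trace_word m (k : {ffun 'I_m -> 'I_N}) (s : 'S_m) (w : word) :
  (0 < n)%N -> (forall l, l \in w -> (l < N)%N) ->
  rep (fun d A B p q => psi s (fun j => A (k j)) * wordval B w p q).
Proof.
move=> n0 wN; have [k' [s' E]] := psi_word s k wN (erefl _).
by apply: (rep_ext (rep_psi k' s')) => d A B p q cAB; rewrite (psi_compat s k n0 cAB) E.
Qed.

End Representable.

(** * Invariants of matrices are trace polynomials *)

Section FirstFundamentalTheorem.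
Variables (F : fieldType) (n N : nat).
Hypothesis charF0 : [pchar F] =i pred0.
Hypothesis n_gt0 : (0 < n)%N.

Lemma mul_diag1 (i : 'I_n) (x y : F) :
  (1%:M + x *: delta_mx i i) *m (1%:M + y *: delta_mx i i) =
  1%:M + (x + y + x * y) *: delta_mx i i.
Proof.
rewrite mulmxDr mulmx1 mulmxDl mul1mx -scalemxAl -scalemxAr mul_delta_mx.
by rewrite scalerA !scalerDl !addrA.
Qed.

Definition point (A : nat -> 'M[F]_n) (v : cvar n) : F := A v.1.1 v.1.2 v.2.

Section Degree.
Variables (d : nat) (T : {ffun 'I_d -> 'I_N} -> {ffun 'I_d -> 'I_n} -> {ffun 'I_d -> 'I_n} -> F).

Definition tform (A : nat -> 'M[F]_n) : F :=
  \sum_k \sum_a \sum_b T k a b * \prod_j A (k j) (a j) (b j).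

Lemma eq_tform A B : A =1 B -> tform A = tform B.
Proof.
move=> e; apply: eq_bigr => k _; apply: eq_bigr => a _; apply: eq_bigr => b _.
by congr (_ * _); apply: eq_bigr => j _; rewrite e.
Qed.

Definition tformsym k a b := \sum_(t : 'S_d) T (fperm k t) (fperm a t) (fperm b t).

(** Rows are indexed by b and columns by a, so that the part of the symmetrized form with letters k
    is the trace of [symop k] times the tensor product of the A (k j). *)
Definition symop k : 'M[F]_#|{ffun 'I_d -> 'I_n}| :=
  \matrix_(y, x) tformsym k (kval x) (kval y).

Lemma tform_sym A : (d`!)%:R * tform A =
  \sum_k \sum_a \sum_b tformsym k a b * \prod_j A (k j) (a j) (b j).
Proof.
transitivity (\sum_(t : 'S_d) tform A).
  by rewrite sumr_const -[RHS]mulr_natl -(card_Sn d).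
rewrite /tform; under eq_bigr => t _.
  rewrite (reindex _ (onW_bij _ (fperm_bij _ t))) /=.
  under eq_bigr => k _.
    rewrite (reindex _ (onW_bij _ (fperm_bij _ t))) /=.
    under eq_bigr => a _.
      rewrite (reindex _ (onW_bij _ (fperm_bij _ t))) /=; over.
    over.
  over.
rewrite exchange_big; apply: eq_bigr => k _; rewrite exchange_big.
apply: eq_bigr => a _; rewrite exchange_big; apply: eq_bigr => b _ /=.
rewrite /tformsym mulr_suml; apply: eq_bigr => t _; congr (_ * _).
by rewrite [RHS](reindex_inj (@perm_inj _ t)); apply: eq_bigr => j _; rewrite !ffunE.
Qed.

(** The coefficient attached to f when the form is expanded at g (sum_i s_i [l = k i] E_(a i, b i))
    g'. *)
Definition polG (k : {ffun 'I_d -> 'I_N}) (a b : {ffun 'I_d -> 'I_n}) (g g' : 'M[F]_n)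
    (f : {ffun 'I_d -> 'I_d}) :=
  \sum_k' \sum_p \sum_q T k' p q * \prod_j
    ((k' j == k (f j))%:R * (g (p j) (a (f j)) * g' (b (f j)) (q j))).

Lemma tform_pol (k : {ffun 'I_d -> 'I_N}) (a b : {ffun 'I_d -> 'I_n}) (g g' : 'M[F]_n)
    (s : 'I_d -> F) :
  tform (fun l => g *m (\sum_i (s i * (l == k i :> nat)%:R) *: delta_mx (a i) (b i)) *m g') =
  \sum_f polG k a b g g' f * \prod_j s (f j).
Proof.
have entry l (x y : 'I_n) :
    (g *m (\sum_i (s i * (l == k i :> nat)%:R) *: delta_mx (a i) (b i)) *m g') x y =
    \sum_i s i * ((l == k i :> nat)%:R * (g x (a i) * g' (b i) y)).
  rewrite mulmx_sumr mulmx_suml summxE; apply: eq_bigr => i _.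
  rewrite -scalemxAr -scalemxAl mxE -mulrA; congr (_ * (_ * _)).
  rewrite mxE (bigD1 (b i)) //= big1 ?addr0 => [|z nz].
    rewrite mxE (bigD1 (a i)) //= big1 ?addr0 => [|z nz]; rewrite mxE ?eqxx ?mulr1 //.
    by rewrite (negPf nz) mulr0.
  by rewrite mxE big1 ?mul0r // => w _; rewrite mxE (negPf nz) andbF mulr0.
rewrite /tform /polG; under [RHS]eq_bigr => f _ do rewrite mulr_suml.
rewrite [RHS]exchange_big; apply: eq_bigr => k' _.
under [RHS]eq_bigr => f _ do rewrite mulr_suml.
rewrite [RHS]exchange_big; apply: eq_bigr => p _.
under [RHS]eq_bigr => f _ do rewrite mulr_suml.
rewrite [RHS]exchange_big; apply: eq_bigr => q _ /=.
under eq_bigr => j _ do rewrite entry.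
rewrite bigA_distr_bigA mulr_sumr; apply: eq_bigr => f _ /=.
by rewrite -mulrA; congr (_ * _); rewrite big_split mulrC.
Qed.

Lemma sum_polG k a b g g' : \sum_(t : 'S_d) polG k a b g g' [ffun j => t j] =
  (tens d g' *m symop k *m tens d g) (krank b) (krank a).
Proof.
transitivity (\sum_(p : {ffun 'I_d -> 'I_n}) \sum_(q : {ffun 'I_d -> 'I_n}) (\prod_j g' (b j) (q j)) * tformsym k p q *
    (\prod_j g (p j) (a j))); last first.
  rewrite mxE -sum_kval; apply: eq_bigr => x _; rewrite mxE mulr_suml -sum_kval.
  by apply: eq_bigr => y _; rewrite !mxE !krankK.
have step (t : 'S_d) : polG k a b g g' [ffun j => t j] =
    \sum_(p : {ffun 'I_d -> 'I_n}) \sum_(q : {ffun 'I_d -> 'I_n})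
    T (fperm k t) (fperm p t) (fperm q t) *
    \prod_j (g (p j) (a j) * g' (b j) (q j)).
  rewrite /polG (bigD1 (fperm k t)) //= [X in _ + X]big1 ?addr0 => [|k' nk].
    rewrite (reindex _ (onW_bij _ (fperm_bij _ t))) /=; apply: eq_bigr => p _.
    rewrite (reindex _ (onW_bij _ (fperm_bij _ t))) /=; apply: eq_bigr => q _.
    congr (_ * _); rewrite [RHS](reindex_inj (@perm_inj _ t)); apply: eq_bigr => j _.
    by rewrite !ffunE eqxx mul1r.
  have [j nj] : exists j, k' j != k (t j).
    apply/existsP; apply: contraNT nk; rewrite negb_exists => /forallP h.
    by apply/eqP/ffunP=> j; rewrite ffunE; apply/eqP; rewrite -[_ == _]negbK.
  rewrite big1 // => p _; rewrite big1 // => q _.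
  by rewrite (bigD1 j) //= !ffunE (negPf nj) !mul0r mulr0.
under eq_bigr => t _ do rewrite step.
rewrite exchange_big; apply: eq_bigr => p _; rewrite exchange_big; apply: eq_bigr => q _.
rewrite -mulr_suml -/(tformsym k p q) big_split /= mulrA mulrC mulrA.
by [].
Qed.

Lemma symop_invariant g g' : g *m g' = 1%:M ->
  (forall A, tform (fun l => g *m A l *m g') = tform A) ->
  forall k, symop k *m tens d g = tens d g *m symop k.
Proof.
move=> gg' inv k; suff E : tens d g' *m symop k *m tens d g = symop k.
  by rewrite -{2}E !mulmxA -tensM gg' tens1 mul1mx.
apply/matrixP=> y x; rewrite -[y]kvalK -[x]kvalK.
set a := kval x; set b := kval y; rewrite -sum_polG.
transitivity ((tens d 1%:M *m symop k *m tens d 1%:M) (krank b) (krank a)); last first.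
  by rewrite tens1 mul1mx mulmx1.
rewrite -sum_polG; apply/eqP; rewrite -subr_eq0 -sumrB; apply/eqP.
apply: (@polarization_multilinear F charF0 d
  (fun f => polG k a b g g' f - polG k a b 1%:M 1%:M f)) => s.
under eq_bigr => f _ do rewrite mulrBl.
rewrite sumrB -!tform_pol inv.
rewrite [X in _ - X](eq_tform (B := fun l => \sum_i (s i * (l == k i :> nat)%:R) *:
  delta_mx (a i) (b i))) ?subrr // => l.
by rewrite mul1mx mulmx1.
Qed.

Hypothesis transv_inv : forall (i j : 'I_n) s A, i != j ->
  tform (fun l => (1%:M + s *: delta_mx i j) *m A l *m (1%:M - s *: delta_mx i j)) = tform A.
Hypothesis diag_inv : forall (i : 'I_n) (t : F) A, t != 0 ->
  tform (fun l => (1%:M + (t ^+ n - 1) *: delta_mx i i) *m A l *m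
    (1%:M + (t^-1 ^+ n - 1) *: delta_mx i i)) = tform A.

(** Invariance is known for transvections and for diagonal entries that are n-th powers. The values
    (l+1)^n are pairwise distinct, so interpolation along lines supplies the other diagonal
    matrices, and then the singular limits. *)
Lemma symop_comm k g : symop k *m tens d g = tens d g *m symop k.
Proof.
move: g; apply: matrix_generation.
- by rewrite tens1 mul1mx mulmx1.
- by move=> g h cg ch; rewrite tensM mulmxA cg -!mulmxA ch.
- move=> i j s; case: (eqVneq i j) => [<-|nij]; last first.
    apply: (symop_invariant _ (fun A => transv_inv s A nij)).
    rewrite mulmxDl mulmxBr !mulmxBr !mul1mx mulmx1 -scalemxAl -scalemxAr.
    by rewrite mul_delta_mx_0 1?eq_sym // !scaler0 subr0 addrNK.
  pose f l : F := l.+1%:R ^+ n - 1.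
  apply: (tens_comm_line (f := f)) => [x y /addIr|l].
    rewrite -!natrX => /(natr_inj_pchar0 charF0) /eqP; rewrite eqn_exp2r //.
    by move=> /eqP[].
  have nz := natrS_neq0 charF0 l.
  apply: (symop_invariant _ (fun A => diag_inv i A nz)).
  rewrite mul_diag1 exprVn (_ : _ + _ + _ = 0) ?scale0r ?addr0 //.
  by field; rewrite expf_neq0.
- move=> A B H; rewrite -[A]addr0 -(scale0r B).
  apply: (tens_comm_line (f := fun l => l.+1%:R)) => [x y /(natr_inj_pchar0 charF0)[]//|l].
  by apply: H; apply: natrS_neq0.
Qed.

(** By Schur-Weyl duality [symop k] is a combination of permutation operators; the entry of [pmx s]
    identifies b with a o s, which turns the form into [psi s]. *)
Lemma tform_trace : exists c : {ffun 'I_d -> 'I_N} -> 'S_d -> F, forall A,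
  tform A = \sum_k \sum_s c k s * psi s (fun j => A (k j)).
Proof.
have [c Ec] := fin_all_exists (fun k => schur_weyl charF0 (symop_comm k)).
have nz : (d`!)%:R != 0 :> F by rewrite -(prednK (fact_gt0 d)) natrS_neq0.
exists (fun k s => (d`!)%:R^-1 * c k s) => A; apply: (mulfI nz).
rewrite tform_sym mulr_sumr; apply: eq_bigr => k _; rewrite mulr_sumr.
under [RHS]eq_bigr => s _ do rewrite mulrA mulVKf // /psi mulr_sumr.
rewrite [RHS]exchange_big; apply: eq_bigr => a _ /=.
have Esym b : tformsym k a b = \sum_s c k s * (b == [ffun i => a (s i)])%:R.
  have := congr1 (fun X : 'M_#|_| => X (krank b) (krank a)) (Ec k).
  rewrite mxE !krankK summxE => ->; apply: eq_bigr => s _.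
  by rewrite !mxE !krankK.
under eq_bigr => b _ do rewrite Esym mulr_suml.
rewrite exchange_big; apply: eq_bigr => s _ /=.
rewrite (bigD1 [ffun i => a (s i)]) //= eqxx mulr1 [X in _ + X]big1 ?addr0 => [|b nb].
  by congr (_ * _); apply: eq_bigr => j _; rewrite ffunE.
by rewrite (negPf nb) mulr0 mul0r.
Qed.

End Degree.

Section Lists.
Variable L : seq (F * cmono n).
Hypothesis LN : forall t v, t \in L -> v \in t.2 -> (v.1.1 < N)%N.

Definition mono_of d (k : {ffun 'I_d -> 'I_N}) (a b : {ffun 'I_d -> 'I_n}) : cmono n :=
  [seq (nat_of_ord (k j), a j, b j) | j <- enum 'I_d].

Lemma nth_mono_of d k a b v0 (j : 'I_d) :
  nth v0 (mono_of k a b) j = (nat_of_ord (k j), a j, b j).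
Proof. by rewrite /mono_of (nth_map j) ?size_enum_ord // nth_ord_enum. Qed.

(** Monomials are matched as ordered lists, not up to permutation, so that each term of L is counted
    exactly once. *)
Definition tcoef d k a b := \sum_(t <- L | t.2 == @mono_of d k a b) t.1.

Lemma pev_tform : exists D, forall A, pev (point A) L = \sum_(d < D) tform (@tcoef d) A.
Proof.
exists (\max_(t <- L) size t.2).+1 => A; set D := _.+1.
have LD t : t \in L -> (size t.2 < D)%N.
  by move=> tL; rewrite ltnS; apply: (@leq_bigmax_seq _ L xpredT (fun t => size t.2)).
have one t : t \in L -> \prod_(v <- t.2) point A v = \sum_(d < D)
    \sum_(k : {ffun 'I_d -> 'I_N}) \sum_(a : {ffun 'I_d -> 'I_n}) \sum_(b : {ffun 'I_d -> 'I_n})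
    (t.2 == mono_of k a b)%:R * \prod_j A (k j) (a j) (b j).
  move=> tL; rewrite (bigD1 (Ordinal (LD t tL))) //= [X in _ + X]big1 ?addr0 => [|d nd].
    pose v0 : cvar n := (0%N, Ordinal n_gt0, Ordinal n_gt0).
    have lt (j : 'I_(size t.2)) : ((nth v0 t.2 j).1.1 < N)%N by apply: (LN tL); apply: mem_nth.
    pose k0 := [ffun j : 'I_(size t.2) => Ordinal (lt j)].
    pose a0 := [ffun j : 'I_(size t.2) => (nth v0 t.2 j).1.2].
    pose b0 := [ffun j : 'I_(size t.2) => (nth v0 t.2 j).2].
    have Emono : t.2 = mono_of k0 a0 b0.
      rewrite /mono_of -[LHS](mkseq_nth v0) /mkseq -val_enum_ord -map_comp.
      by apply: eq_map => j /=; rewrite !ffunE /=; case: (nth _ _ _) => -[].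
    have mono_inj (k : {ffun 'I_(size t.2) -> 'I_N}) (a b : {ffun 'I_(size t.2) -> 'I_n}) :
      (t.2 == mono_of k a b) = [&& k == k0, a == a0 & b == b0].
      apply/eqP/and3P => [e|[/eqP-> /eqP-> /eqP->] //].
      have ej j : (nat_of_ord (k0 j), a0 j, b0 j) = (nat_of_ord (k j), a j, b j).
        have : nth v0 (mono_of k0 a0 b0) j = nth v0 (mono_of k a b) j by rewrite -e -Emono.
        by rewrite !nth_mono_of.
      by split; apply/eqP/ffunP=> j; case: (ej j) => /val_inj eqk eqa eqb; rewrite ?eqk ?eqa ?eqb.
    rewrite (bigD1 k0) //= [X in _ + X]big1 ?addr0 => [|k nk]; last first.
      rewrite big1 // => a _; rewrite big1 // => b _.
      by rewrite mono_inj (negPf nk) mul0r.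
    rewrite (bigD1 a0) //= [X in _ + X]big1 ?addr0 => [|a na]; last first.
      by rewrite big1 // => b _; rewrite mono_inj (negPf na) andbF mul0r.
    rewrite (bigD1 b0) //= [X in _ + X]big1 ?addr0 => [|b nb]; last first.
      by rewrite mono_inj (negPf nb) !andbF mul0r.
    by rewrite -Emono eqxx mul1r {1}Emono big_map big_enum.
  rewrite big1 // => k _; rewrite big1 // => a _; rewrite big1 // => b _.
  rewrite (_ : (_ == _) = false) ?mul0r //; apply/negbTE; apply: contraNneq nd => e.
  by apply/eqP/val_inj; rewrite /= e size_map size_enum_ord.
rewrite /pev (eq_big_seq _ (fun t tL => congr1 ( *%R t.1) (one t tL))).
under eq_bigr => t _ do rewrite mulr_sumr.
rewrite exchange_big; apply: eq_bigr => d _ /=; rewrite /tform /tcoef.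
under eq_bigr => t _ do rewrite mulr_sumr.
rewrite exchange_big; apply: eq_bigr => k _ /=.
under eq_bigr => t _ do rewrite mulr_sumr.
rewrite exchange_big; apply: eq_bigr => a _ /=.
under eq_bigr => t _ do rewrite mulr_sumr.
rewrite exchange_big; apply: eq_bigr => b _ /=.
rewrite [in RHS]big_mkcond mulr_suml; apply: eq_bigr => t _ /=.
by case: eqP; rewrite ?mul1r ?mul0r ?mulr0.
Qed.

Lemma tform_scale d T s A : @tform d T (fun l => s *: A l) = s ^+ d * tform T A.
Proof.
rewrite /tform mulr_sumr; apply: eq_bigr => k _; rewrite mulr_sumr.
apply: eq_bigr => a _; rewrite mulr_sumr; apply: eq_bigr => b _; rewrite mulrCA.
congr (_ * _); under eq_bigr => j _ do rewrite mxE.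
by rewrite big_split prodr_const card_ord.
Qed.

(** Conjugation commutes with scaling, so each homogeneous component is invariant on its own. *)
Theorem invariant_trace_polynomial :
  (forall (i j : 'I_n) s A, i != j -> pev (point (fun l =>
    (1%:M + s *: delta_mx i j) *m A l *m (1%:M - s *: delta_mx i j))) L = pev (point A) L) ->
  (forall (i : 'I_n) (t : F) A, t != 0 -> pev (point (fun l =>
    (1%:M + (t ^+ n - 1) *: delta_mx i i) *m A l *m
    (1%:M + (t^-1 ^+ n - 1) *: delta_mx i i))) L = pev (point A) L) ->
  exists D (c : forall d : 'I_D, {ffun 'I_d -> 'I_N} -> 'S_d -> F), forall A,
    pev (point A) L = \sum_(d < D) \sum_k \sum_s c d k s * psi s (fun j => A (k j)).
Proof.
move=> inv1 inv2; have [D ED] := pev_tform.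
have hom g g' : (forall A, pev (point (fun l => g *m A l *m g')) L = pev (point A) L) ->
    forall (d : 'I_D) A, tform (@tcoef d) (fun l => g *m A l *m g') = tform (@tcoef d) A.
  move=> inv d A; pose f : {poly F} := \poly_(l < D)
    (tform (@tcoef l) (fun l => g *m A l *m g') - tform (@tcoef l) A).
  have : f = 0.
    apply: (poly_fun_eq0 charF0) => s; rewrite horner_poly.
    have := inv (fun l => s *: A l); rewrite !ED => /eqP; rewrite -subr_eq0 -sumrB => /eqP E.
    rewrite -[RHS]E; apply: eq_bigr => l _.
    rewrite mulrBl ![_ * s ^+ _]mulrC -!tform_scale; congr (_ - _); apply: eq_tform => i.
    by rewrite -scalemxAr -scalemxAl.
  move/(congr1 (fun h : {poly F} => h`_d)); rewrite coef_poly ltn_ord coef0.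
  by move/eqP; rewrite subr_eq0 => /eqP.
have [c Ec] : exists c : forall d : 'I_D, {ffun 'I_d -> 'I_N} -> 'S_d -> F, forall (d : 'I_D) A,
    tform (@tcoef d) A = \sum_k \sum_s c d k s * psi s (fun j => A (k j)).
  apply: (@fin_all_exists 'I_D (fun d => {ffun 'I_d -> 'I_N} -> 'S_d -> F)
    (fun d c => forall A, tform (@tcoef d) A = \sum_k \sum_s c k s * psi s (fun j => A (k j)))).
  move=> d; apply: tform_trace => [i j s A nij|i t A nt].
    by apply: (hom _ _ (fun A => inv1 i j s A nij)).
  by apply: (hom _ _ (fun A => inv2 i t A nt)).
by exists D, c => A; rewrite ED; apply: eq_bigr => d _; rewrite Ec.
Qed.

End Lists.
End FirstFundamentalTheorem.

(** * Relations between words *)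

Section Relations.
Variables (F : fieldType) (n N t : nat).
Hypothesis charF0 : [pchar F] =i pred0.
Hypothesis n_gt0 : (0 < n)%N.
Implicit Types (x : cvar n -> F) (g : 'M[F]_n).

Definition allvars : seq (cvar n) :=
  [seq (nat_of_ord z.1.1, z.1.2, z.2) | z <- enum {: 'I_N * 'I_n * 'I_n}].

Lemma mem_allvars (v : cvar n) : (v \in allvars) = (v.1.1 < N)%N.
Proof.
apply/mapP/idP => [[z _ ->]|lt]; first exact: ltn_ord.
by exists (Ordinal lt, v.1.2, v.2); rewrite ?mem_enum //; case: v lt => -[].
Qed.

Local Notation pfun := (polyfun allvars).

Definition mat x k : 'M[F]_n := \matrix_(i, j) x (k, i, j).

Lemma point_mat x : point (mat x) =1 x.
Proof. by move=> [[k i] j]; rewrite /point mxE. Qed.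

Lemma mat_point A k : mat (point A) k = A k.
Proof. by apply/matrixP=> i j; rewrite mxE. Qed.

Lemma pfun_ext1 f x y : pfun f -> x =1 y -> f x = f y.
Proof. by case=> L [_ E] e; rewrite !E; apply: eq_pev. Qed.

Lemma eq_wordval d (A B : nat -> 'M[F]_d) w : A =1 B -> wordval A w = wordval B w.
Proof. by move=> e; elim: w => //= k w ->; rewrite e. Qed.

Lemma pfun_wordval w i j : (forall l, l \in w -> (l < N)%N) ->
  pfun (fun x => wordval (mat x) w i j).
Proof.
elim: w i => [|k w IH] i wN /=.
  by apply: (polyfun_ext _ (polyfun_const allvars (1%:M i j : F))).
have : pfun (fun x => \sum_l x (k, i, l) * wordval (mat x) w l j).
  apply: polyfun_sum => l; apply: polyfun_mul.
    by apply: polyfun_var; rewrite mem_allvars wN ?mem_head.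
  by apply: IH => l' h; apply: wN; rewrite inE h orbT.
by apply: polyfun_ext => x; rewrite mxE; apply: eq_bigr => l _; rewrite mxE.
Qed.

(** Simultaneous conjugation when g' is the inverse of g; carrying the pair makes composition purely
    formal. *)
Definition cj g g' x : cvar n -> F := point (fun k => g *m mat x k *m g').

Lemma pfun_cj g g' f : pfun f -> pfun (fun x => f (cj g g' x)).
Proof.
apply: polyfun_comp => -[[k i] j]; rewrite mem_allvars /= => lt.
have : pfun (fun x => \sum_l (\sum_m g i m * x (k, m, l)) * g' l j).
  apply: polyfun_sum => l; apply: polyfun_mul; last exact: polyfun_const.
  apply: polyfun_sum => m; apply: polyfun_mul; first exact: polyfun_const.
  by apply: polyfun_var; rewrite mem_allvars.
apply: polyfun_ext => x; rewrite /cj /point /= mxE; apply: eq_bigr => l _.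
by rewrite mxE; congr (_ * _); apply: eq_bigr => m _; rewrite mxE.
Qed.

Lemma mat_cj g g' x k : mat (cj g g' x) k = g *m mat x k *m g'.
Proof. exact: mat_point. Qed.

Lemma cj_comp g g' h h' x : cj g g' (cj h h' x) =1 cj (g *m h) (h' *m g') x.
Proof. by move=> v; rewrite /cj /point mat_cj !mulmxA. Qed.

Lemma cj1 x : cj 1%:M 1%:M x =1 x.
Proof. by move=> [[k i] j]; rewrite /cj /point /= mul1mx mulmx1 mxE. Qed.

Lemma wordval_cj g g' x w : g *m g' = 1%:M -> g' *m g = 1%:M ->
  wordval (mat (cj g g' x)) w = g *m wordval (mat x) w *m g'.
Proof.
move=> gg' g'g; elim: w => [|k w IH] /=; first by rewrite mulmx1.
by rewrite IH mat_cj !mulmxA -[_ *m g' *m g]mulmxA g'g mulmx1.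
Qed.

Variable M : 'I_t.+1 -> word.
Hypothesis MN : forall i l, l \in M i -> (l < N)%N.
Hypothesis indep : locally_lin_indep F n (fun i : 'I_t => M (lift ord0 i)).

(** At the point of independence the matrix of vectorized words has a right inverse B. The
    determinant of its product with B is a nonzero polynomial function, and the adjugate shows that
    it kills every c i. *)
Lemma generic_indep (c : 'I_t -> (cvar n -> F) -> F) : (forall i, pfun (c i)) ->
  (forall x, \sum_i c i x *: wordval (mat x) (M (lift ord0 i)) = 0) ->
  forall i x, c i x = 0.
Proof.
move=> pc c0; have [A0 ind] := indep.
pose Mx x : 'M[F]_(t, n * n) := \matrix_i mxvec (wordval (mat x) (M (lift ord0 i))).
have mulMx (r : 'rV[F]_t) x :
    r *m Mx x = mxvec (\sum_i r 0 i *: wordval (mat x) (M (lift ord0 i))).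
  rewrite mulmx_sum_row linear_sum; apply: eq_bigr => i _.
  by rewrite rowK linearZ.
have free0 : row_free (Mx (point A0)).
  apply: inj_row_free => r; rewrite mulMx => /(congr1 vec_mx); rewrite mxvecK linear0 => r0.
  apply/rowP=> i; rewrite mxE; apply: ind; rewrite -[RHS]r0; apply: eq_bigr => l _.
  by congr (_ *: _); apply: eq_wordval => k; rewrite mat_point.
have [B EB] := row_freeP free0.
pose del x := \det (Mx x *m B).
have pdel : pfun del.
  have pM i j : pfun (fun x => (Mx x *m B) i j).
    have : pfun (fun x => \sum_l mxvec (wordval (mat x) (M (lift ord0 i))) 0 l * B l j).
      apply: polyfun_sum => l; apply: polyfun_mul; last exact: polyfun_const.
      case/mxvec_indexP: l => p q.
      by apply: (polyfun_ext _ (pfun_wordval p q (MN (i := lift ord0 i)))) => x; rewrite mxvecE.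
    by apply: polyfun_ext => x; rewrite mxE; apply: eq_bigr => l _; rewrite mxE.
  apply: polyfun_sum => s; apply: polyfun_mul; first exact: polyfun_const.
  by apply: polyfun_prod => i; apply: pM.
have del0 : del (point A0) != 0 by rewrite /del EB det1 oner_neq0.
have cdel i x : del x * c i x = 0.
  pose r : 'rV[F]_t := \row_i c i x.
  have r0 : r *m Mx x = 0.
    rewrite mulMx (_ : \sum_i _ = 0) ?linear0 // -[RHS](c0 x).
    by apply: eq_bigr => l _; rewrite mxE.
  have := congr1 (fun X => X *m B *m \adj (Mx x *m B)) r0.
  rewrite !mul0mx -[r *m _ *m B]mulmxA -mulmxA mul_mx_adj mul_mx_scalar.
  by move/rowP=> /(_ i); rewrite !mxE.
by move=> i; apply: (polyfun_cancel charF0 pdel (pc i) (cdel i)); exists (point A0).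
Qed.

Definition relation (b : 'I_t.+1 -> (cvar n -> F) -> F) :=
  forall x, \sum_i b i x *: wordval (mat x) (M i) = 0.

(** The combination a_0 b - b_0 a is a relation whose coefficient at M_0 is zero, hence a relation
    between M_1, ..., M_t. *)
Lemma relation_proportional0 a b i x : (forall i, pfun (a i)) -> (forall i, pfun (b i)) ->
  relation a -> relation b -> a ord0 x * b i x = b ord0 x * a i x.
Proof.
move=> pa pb ra rb; case: (unliftP ord0 i) => [j ->|->]; last by rewrite mulrC.
apply/eqP; rewrite -subr_eq0; apply/eqP; move: j x.
apply: generic_indep => [j|x].
  have : pfun (fun x => a ord0 x * b (lift ord0 j) x + (-1) * (b ord0 x * a (lift ord0 j) x)).
    by apply: polyfun_add; do ?apply: polyfun_mul => //; apply: polyfun_const.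
  by apply: polyfun_ext => x; rewrite mulN1r.
have := rb x; have := ra x; rewrite /= !big_ord_recl => ea eb.
under eq_bigr => j _ do rewrite scalerBl -!scalerA.
rewrite sumrB -!scaler_sumr.
move/eqP: ea; rewrite addrC addr_eq0 => /eqP ->.
move/eqP: eb; rewrite addrC addr_eq0 => /eqP ->.
by rewrite !scalerN !scalerA [b ord0 x * _]mulrC subrr.
Qed.

Variable lam : 'I_t.+1 -> (cvar n -> F) -> F.
Hypothesis lamP : forall i, pfun (lam i).
Hypothesis lam_rel : relation lam.
Hypothesis lam_nz : exists i x, lam i x != 0.

Lemma lam0_nz : exists x, lam ord0 x != 0.
Proof.
apply: NNPP => no; have l0 x : lam ord0 x = 0.
  by apply/eqP; apply: contraT => h; case: no; exists x.
case: lam_nz => i [x /eqP[]]; case: (unliftP ord0 i) => [j ->|->]; last exact: l0.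
move: j x; apply: generic_indep => [j|x]; first exact: lamP.
by have := lam_rel x; rewrite big_ord_recl l0 scale0r add0r.
Qed.

(** After multiplication by lam_0, which is not zero, the claim follows from two uses of the
    previous proportionality. *)
Lemma relation_proportional b : (forall i, pfun (b i)) -> relation b ->
  forall x, proportional (lam^~ x) (b^~ x).
Proof.
move=> pb rb x i j; apply/eqP; rewrite -subr_eq0; apply/eqP; move: x.
apply: (polyfun_cancel charF0 (lamP ord0)) lam0_nz.
  have : pfun (fun x => lam i x * b j x + (-1) * (lam j x * b i x)).
    by apply: polyfun_add; do ?apply: polyfun_mul => //; apply: polyfun_const.
  by apply: polyfun_ext => x; rewrite mulN1r.
move=> x; have e k := relation_proportional0 k x lamP pb lam_rel rb.
by rewrite mulrBr mulrCA e [lam ord0 x * _]mulrCA e; ring.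
Qed.

Lemma invariant_generator : exists (h : (cvar n -> F) -> F) (mu : 'I_t.+1 -> (cvar n -> F) -> F),
  [/\ pfun h, (forall i, pfun (mu i)), relation mu & forall i x, lam i x = h x * mu i x] /\
    ((forall (i j : 'I_n) s k x, i != j ->
      mu k (cj (1%:M + s *: delta_mx i j) (1%:M - s *: delta_mx i j) x) = mu k x) /\
    (forall (i : 'I_n) (s : F) k x, s != 0 ->
      mu k (cj (1%:M + (s ^+ n - 1) *: delta_mx i i)
        (1%:M + (s^-1 ^+ n - 1) *: delta_mx i i) x) = mu k x)).
Proof.
pose v0 : cvar n := (0%N, Ordinal n_gt0, Ordinal n_gt0).
have [mu [pmu gen]] := polyfun_rank_one_free charF0 v0 lamP lam_nz.
have [h [ph Eh]] := gen lam lamP (fun x i j => mulrC _ _).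
have [i0 [x0 nz0]] : exists i x, mu i x != 0.
  case: lam_nz => i [x]; rewrite Eh mulf_eq0 negb_or => /andP[_ nz]; by exists i, x.
have hnz : exists x, h x != 0.
  case: lam_nz => i [x]; rewrite Eh mulf_eq0 negb_or => /andP[nz _]; by exists x.
have mu_rel : relation mu.
  move=> x; apply/matrixP=> p q; rewrite summxE mxE; move: x.
  apply: (polyfun_cancel charF0 ph) hnz => [|x].
    have : pfun (fun x => \sum_i mu i x * wordval (mat x) (M i) p q).
      by apply: polyfun_sum => i; apply: polyfun_mul => //; apply: pfun_wordval; apply: MN.
    by apply: polyfun_ext => x; apply: eq_bigr => i _; rewrite mxE.
  have := congr1 (fun X : 'M_n => X p q) (lam_rel x); rewrite summxE [RHS]mxE => E.
  by rewrite -[RHS]E mulr_sumr; apply: eq_bigr => i _; rewrite !mxE Eh mulrA.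
pose chi g g' c := forall i x, mu i (cj g g' x) = c * mu i x.
(* Conjugating back shows that the conjugated mu is again a relation, hence a multiple of the
   generator. *)
have pre g g' : g *m g' = 1%:M -> g' *m g = 1%:M ->
    exists k, pfun k /\ forall i x, mu i (cj g g' x) = k x * mu i x.
  move=> gg' g'g.
  have pcj i : pfun (fun x => mu i (cj g g' x)) := pfun_cj g g' (pmu i).
  apply: gen => // x; apply: (relation_proportional pcj) => {}x.
  have := mu_rel (cj g g' x); under eq_bigr => i _ do rewrite wordval_cj //.
  move/(congr1 (fun X => g' *m X *m g)); rewrite mulmx0 mul0mx mulmx_sumr mulmx_suml => E.
  rewrite -[RHS]E; apply: eq_bigr => i _; rewrite -scalemxAr -scalemxAl; congr (_ *: _).
  by rewrite !mulmxA g'g mul1mx -mulmxA g'g mulmx1.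
have chi_ex g g' : g *m g' = 1%:M -> g' *m g = 1%:M -> exists c, chi g g' c.
  move=> gg' g'g; have [k [pk Ek]] := pre _ _ gg' g'g.
  have [k' [pk' Ek']] := pre _ _ g'g gg'.
  (* Conjugation by g and then by its inverse fixes mu, so the two multipliers are inverse
     polynomial functions and therefore constant. *)
  have one x : k x * k' (cj g g' x) = 1.
    apply/eqP; rewrite -subr_eq0; apply/eqP; move: x.
    apply: (polyfun_cancel charF0 (pmu i0)); last by exists x0.
      have : pfun (fun x => k x * k' (cj g g' x) + (- 1)).
        apply: polyfun_add; last exact: polyfun_const.
        by apply: polyfun_mul => //; apply: pfun_cj.
      exact: polyfun_ext.
    move=> x; have := Ek' i0 (cj g g' x); rewrite Ek.
    rewrite (pfun_ext1 (y := x) (pmu i0)); first by move=> E; rewrite mulrBr mulr1 {2}E; ring.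
    by move=> v; rewrite cj_comp g'g cj1.
  have cst := polyfun_unit_const charF0 pk (pfun_cj g g' pk') one.
  by exists (k x0) => i x; rewrite Ek (cst x x0).
have chi_mul g g' c h1 h1' c1 : chi g g' c -> chi h1 h1' c1 ->
    chi (g *m h1) (h1' *m g') (c * c1).
  move=> cg ch i x; rewrite -(pfun_ext1 (pmu i) (cj_comp g g' h1 h1' x)).
  by rewrite cg ch mulrA.
have chi_uniq g g' c c1 : chi g g' c -> chi g g' c1 -> c = c1.
  by move=> cg cg1; apply: (mulIf nz0); rewrite -cg -cg1.
have chi_inv g g' c c1 : g *m g' = 1%:M -> chi g g' c -> chi g' g c1 -> c * c1 = 1.
  move=> gg' cg cg1; apply: (chi_uniq 1%:M 1%:M); last first.
    by move=> i x; rewrite mul1r (pfun_ext1 (pmu i) (cj1 x)).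
  by have := chi_mul _ _ _ _ _ _ cg cg1; rewrite gg'.
have conj_chi g g' c h1 h1' c1 : g *m g' = 1%:M -> g' *m g = 1%:M ->
    chi g g' c -> chi h1 h1' c1 -> chi (g *m h1 *m g') (g *m h1' *m g') c1.
  move=> gg' g'g cg ch; have [c' cg'] := chi_ex _ _ g'g gg'.
  have := chi_mul _ _ _ _ _ _ (chi_mul _ _ _ _ _ _ cg ch) cg'.
  by rewrite mulrAC (chi_inv _ _ _ _ gg' cg cg') mul1r mulmxA.
pose u (i j : 'I_n) (s : F) : 'M[F]_n := 1%:M + s *: delta_mx i j.
pose e (i : 'I_n) (x : F) : 'M[F]_n := 1%:M + (x - 1) *: delta_mx i i.
have eM i (x y : F) : e i x *m e i y = e i (x * y).
  by rewrite /e mul_diag1; congr (_ + _ *: _); ring.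
have e1 i : e i 1 = 1%:M by rewrite /e subrr scale0r addr0.
have eV i (x : F) : x != 0 -> e i x *m e i x^-1 = 1%:M by move=> nx; rewrite eM mulfV.
have eV' i (x : F) : x != 0 -> e i x^-1 *m e i x = 1%:M by move=> nx; rewrite eM mulVf.
have uM (i j : 'I_n) s r : i != j -> u i j s *m u i j r = u i j (s + r).
  move=> nij; rewrite /u mulmxDr mulmx1 mulmxDl mul1mx -scalemxAl -scalemxAr.
  by rewrite mul_delta_mx_0 1?eq_sym // !scaler0 addr0 scalerDl addrA.
have u0 i j : u i j 0 = 1%:M by rewrite /u scale0r addr0.
(* Conjugation by diag(1, .., 2, .., 1) maps u(s) to u(2 s) = u(s)^2, so c = c^2 with c <> 0. *)
have transv (i j : 'I_n) s : i != j -> chi (u i j s) (u i j (- s)) 1.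
  move=> nij; have uV r : u i j r *m u i j (- r) = 1%:M by rewrite uM // subrr u0.
  have uV' r : u i j (- r) *m u i j r = 1%:M by rewrite uM // addNr u0.
  have [c cu] := chi_ex _ _ (uV s) (uV' s).
  have n2 : (2 : F) != 0 := natrS_neq0 charF0 1.
  have [c2 c2P] := chi_ex _ _ (eV i _ n2) (eV' i _ n2).
  have := conj_chi _ _ _ _ _ _ (eV i _ n2) (eV' i _ n2) c2P cu.
  have Eu r : e i 2 *m u i j r *m e i 2^-1 = u i j (r + r).
    have ed : e i 2 *m delta_mx i j = (2 : F) *: delta_mx i j.
      rewrite /e mulmxDl mul1mx -scalemxAl mul_delta_mx -{1}[delta_mx i j]scale1r -scalerDl.
      by congr (_ *: _); ring.
    have de : delta_mx i j *m e i 2^-1 = delta_mx i j :> 'M[F]_n.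
      by rewrite /e mulmxDr mulmx1 -scalemxAr mul_delta_mx_0 1?eq_sym // scaler0 addr0.
    rewrite /u mulmxDr mulmx1 mulmxDl eV // -scalemxAr -scalemxAl ed -scalemxAl de scalerA.
    by congr (_ + _ *: _); ring.
  rewrite !Eu => cc; have := chi_mul _ _ _ _ _ _ cu cu; rewrite !uM // => cc'.
  have E := chi_uniq _ _ _ _ cc cc'.
  have [c' cu'] := chi_ex _ _ (uV' s) (uV s).
  have nc : c != 0.
    by apply: contraNneq (oner_neq0 F) => z; rewrite -(chi_inv _ _ _ _ (uV s) cu cu') z mul0r.
  by have -> : 1 = c by apply: (mulfI nc); rewrite mulr1.
(* Permutation matrices make the value c at [e j s] independent of j. The product over all j is a
   scalar matrix, which acts trivially; hence c^n = 1, and c^n is the value at [e i (s ^+ n)]. *)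
have diag (i : 'I_n) s : s != 0 -> chi (e i (s ^+ n)) (e i (s^-1 ^+ n)) 1.
  move=> ns; have [c ci] := chi_ex _ _ (eV i _ ns) (eV' i _ ns).
  have pow k : chi (e i (s ^+ k)) (e i (s^-1 ^+ k)) (c ^+ k).
    elim: k => [|k IHk].
      by rewrite !expr0 e1 => l x; rewrite mul1r (pfun_ext1 (pmu l) (cj1 x)).
    by have := chi_mul _ _ _ _ _ _ ci IHk; rewrite !eM -!exprS -exprSr.
  have all_c j : chi (e j s) (e j s^-1) c.
    pose w : 'M[F]_n := perm_mx (tperm i j).
    have ww : w *m w = 1%:M by rewrite /w -perm_mxM tperm2 perm_mx1.
    have we (x : F) : w *m e i x *m w = e j x.
      rewrite /e mulmxDr mulmx1 mulmxDl ww -scalemxAr -scalemxAl; congr (_ + _ *: _).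
      rewrite /w -row_permE -[in X in _ *m X](tpermV i j) -col_permE.
      by apply/matrixP=> p q; rewrite !mxE; congr (_ && _)%:R;
        rewrite -(inj_eq (@perm_inj _ (tperm i j))) ?tpermV tpermK tpermL.
    have [d cw] := chi_ex _ _ ww ww.
    by have := conj_chi _ _ _ _ _ _ ww ww cw ci; rewrite !we.
  have prodE r : uniq r -> chi (1%:M + (s - 1) *: \sum_(j <- r) delta_mx j j)
      (1%:M + (s^-1 - 1) *: \sum_(j <- r) delta_mx j j) (c ^+ size r).
    elim: r => [_|j r IHr /= /andP[nj ur]].
      by rewrite big_nil !scaler0 addr0 => l x; rewrite mul1r (pfun_ext1 (pmu l) (cj1 x)).
    have dS : delta_mx j j *m (\sum_(l <- r) delta_mx l l) = 0 :> 'M[F]_n.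
      rewrite mulmx_sumr big_seq big1 // => l lr; rewrite mul_delta_mx_0 //.
      by apply: contraNneq nj => ->.
    have Sd : (\sum_(l <- r) delta_mx l l) *m delta_mx j j = 0 :> 'M[F]_n.
      rewrite mulmx_suml big_seq big1 // => l lr; rewrite mul_delta_mx_0 //.
      by apply: contraNneq nj => <-.
    have := chi_mul _ _ _ _ _ _ (all_c j) (IHr ur); rewrite -exprS big_cons.
    rewrite /e !mulmxDr !mulmxDl !mulmx1 !mul1mx -!scalemxAl -!scalemxAr dS Sd.
    by rewrite !scaler0 !addr0 !scalerDr !addrA [1%:M + _ + (s^-1 - 1) *: delta_mx j j]addrAC.
  have := prodE (enum 'I_n) (enum_uniq _); rewrite size_enum_ord big_enum.
  have -> : \sum_j delta_mx j j = 1%:M :> 'M[F]_n.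
    rewrite [RHS]matrix_sum_delta; apply: eq_bigr => j _; rewrite (bigD1 j) //= mxE eqxx.
    by rewrite scale1r big1 ?addr0 // => l nl; rewrite mxE eq_sym (negPf nl) scale0r.
  have sc (x : F) : 1%:M + (x - 1) *: 1%:M = x%:M :> 'M[F]_n.
    by rewrite scale_scalar_mx mulr1 -raddfD addrC subrK.
  rewrite !sc => cs; have cn : c ^+ n = 1.
    apply: (chi_uniq _ _ _ _ cs) => l x; rewrite mul1r; apply: (pfun_ext1 (pmu l)) => v.
    rewrite /cj /point mul_scalar_mx mul_mx_scalar scalerA mulVf // scale1r.
    exact: point_mat.
  by have := pow n; rewrite cn.
exists h, mu; split=> //; split=> [i j s k x nij|i s k x ns].
  by have := transv i j s nij k x; rewrite /u scaleNr mul1r.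
by have := diag i s ns k x; rewrite mul1r.
Qed.

End Relations.

(** * Coefficients of quasi-polynomials as polynomial functions, and the conclusion *)

Section Coefficients.
Variables (F : fieldType) (n : nat).

Definition terms (P : quasipoly F n) : seq (F * cmono n) := [seq s.1 | s <- P].

Definition qcoefs (L : seq (F * cmono n)) : quasipoly F n := [seq (s, [::]) | s <- L].

Lemma bigeval_is_coef A d (B : nat -> 'M[F]_d) (P : quasipoly F n) : is_coef P ->
  bigeval A B P = (pev (point A) (terms P))%:M.
Proof.
move=> /allP Pc; rewrite /bigeval /pev big_map raddf_sum [LHS]big_seq [RHS]big_seq.
by apply: eq_bigr => s /Pc /eqP ->; rewrite /= scale_scalar_mx mulr1.
Qed.

Lemma bigeval_qcoefs A d (B : nat -> 'M[F]_d) L : bigeval A B (qcoefs L) = (pev (point A) L)%:M.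
Proof.
rewrite bigeval_is_coef /terms /qcoefs; last by apply/allP=> _ /mapP[s _ ->].
by rewrite -map_comp map_id.
Qed.

Lemma letters_bounded (s : seq nat) : exists N, forall k, k \in s -> (k < N)%N.
Proof.
exists (\max_(k <- s) k).+1 => k ks; rewrite ltnS.
exact: (@leq_bigmax_seq _ s xpredT id).
Qed.

End Coefficients.

Theorem mainTheorem15 (F : fieldType) (n t : nat)
  (charF0 : [pchar F] =i pred0) (n_gt0 : (0 < n)%N)
  (lam : 'I_t.+1 -> quasipoly F n) (lamC : forall i, is_coef (lam i))
  (M : 'I_t.+1 -> word) :
  quasi_identity (qsum [seq qmul (lam i) (qword F n (M i)) | i <- enum 'I_t.+1]) ->
  locally_lin_indep F n (fun i : 'I_t => M (lift ord0 i)) ->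
  in_TQn (qsum [seq qmul (lam i) (qword F n (M i)) | i <- enum 'I_t.+1]).
Proof.
set P0 := qsum _ => qid indep; pose lamf i x := pev x (terms (lam i)).
have EP0 A d (B : nat -> 'M[F]_d) :
    bigeval A B P0 = \sum_i lamf i (point A) *: wordval B (M i).
  rewrite /P0 bigeval_sum big_enum; apply: eq_bigr => i _.
  by rewrite bigevalM bigeval_word bigeval_is_coef // mul_scalar_mx.
(* N bounds the letters of the words and the indices of the matrix variables in the coefficients, so
   that finitely many variables suffice. *)
have [N letN] := letters_bounded (flatten [seq M i | i <- enum 'I_t.+1] ++
  [seq v.1.1 | v <- flatten [seq flatten [seq s.2 | s <- terms (lam i)] | i <- enum 'I_t.+1]]).
have MN i l : l \in M i -> (l < N)%N.
  move=> lM; apply: letN; rewrite mem_cat; apply/orP; left.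
  by apply/flatten_mapP; exists i; rewrite ?mem_enum.
have lamP i : polyfun (allvars n N) (lamf i).
  exists (terms (lam i)); split=> // s sl v vs; rewrite mem_allvars; apply: letN.
  rewrite mem_cat; apply/orP; right; apply: map_f.
  apply/flatten_mapP; exists i; rewrite ?mem_enum //; apply/flatten_mapP; by exists s.
have lam_rel : relation M lamf.
  move=> x; have := qid (mat x); rewrite qevalE EP0 => E; rewrite -[RHS]E.
  by apply: eq_bigr => i _; congr (_ *: _); apply: eq_pev => v; rewrite point_mat.
(* If all coefficients vanish there is no generator mu, but the quasi-polynomial is then formally
   zero. *)
case: (classic (exists i x, lamf i x != 0)) => [lam_nz|no]; last first.
  apply: TQ_eq (TQ_zero F n) _; apply: qeq_bigeval => // d A B _.
  rewrite bigeval0 EP0 big1 // => i _; rewrite (_ : lamf i _ = 0) ?scale0r //.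
  by apply/eqP; apply: contraT => h; case: no; exists i, (point A).
have [h [mu [[[Lh [_ Eh]] pmu mu_rel Elam] [inv1 inv2]]]] :=
  invariant_generator charF0 n_gt0 MN indep lamP lam_rel lam_nz.
(* Each mu_i is a polynomial in traces at A; these are traces at B as well, so the coefficient joins
   its word in a single contraction at B. *)
have mu_rep i : rep N (fun d A (B : nat -> 'M[F]_d) p q => mu i (point A) * wordval B (M i) p q).
  have [L [Lvs EL]] := pmu i.
  have LN s v : s \in L -> v \in s.2 -> (v.1.1 < N)%N.
    by move=> sL vs; rewrite -mem_allvars; apply: Lvs vs.
  have cjE g g' A : pev (point (fun l => g *m A l *m g')) L = mu i (cj g g' (point A)).
    rewrite EL; apply: eq_pev => v; by rewrite /cj /point mat_point.
  have [||D [c Ec]] := invariant_trace_polynomial charF0 n_gt0 LN.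
  - by move=> a b s A nab; rewrite cjE inv1 // EL.
  - by move=> a s A ns; rewrite cjE inv2 // EL.
  have rep1 e k s : rep N (fun d (A : nat -> 'M[F]_n) (B : nat -> 'M[F]_d) p q =>
      c e k s * (psi s (fun j => A (k j)) * wordval B (M i) p q)).
    exact: (repZ (c e k s) (rep_trace_word F k s n_gt0 (MN i))).
  have rep2 (e : 'I_D) k := rep_sum (enum 'S_e) (rep1 e k).
  have rep3 (e : 'I_D) := rep_sum (enum {ffun 'I_e -> 'I_N}) (rep2 e).
  have := rep_sum (enum 'I_D) rep3.
  move/rep_ext; apply=> d A B p q _; rewrite EL Ec big_enum mulr_suml.
  apply: eq_bigr => e _; rewrite big_enum mulr_suml; apply: eq_bigr => k _.
  by rewrite big_enum mulr_suml; apply: eq_bigr => s _; rewrite mulrA.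
have [D [C EC]] := rep_sum (enum 'I_t.+1) mu_rep.
have [|P [TP EP]] := @trace_identity_in_TQn F n N charF0 n_gt0 D C.
  move=> A p q; rewrite -(EC n A A p q (compat_refl A)) big_enum.
  have := congr1 (fun X : 'M_n => X p q) (mu_rel (point A)); rewrite summxE [RHS]mxE => E.
  rewrite -[RHS]E; apply: eq_bigr => i _; rewrite mxE; congr (_ * _).
  by rewrite [in RHS](eq_wordval (B := A)) // => k; rewrite mat_point.
(* The factor h is restored as an element of C; equality with the given quasi-polynomial is checked
   on compatible pairs. *)
apply: TQ_eq (TQ_mul (qcoefs Lh) (qone F n) TP) _.
apply: qeq_bigeval => // d A B cAB; apply/matrixP=> p q.
rewrite !bigevalM bigeval_const mulmx1 bigeval_qcoefs mul_scalar_mx mxE EP // -(EC d A) //.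
rewrite EP0 summxE big_enum mulr_sumr; apply: eq_bigr => i _.
by rewrite mxE Elam Eh mulrA.
Qed.
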